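(* Assume that $\beta_1,\beta_2>0$ and $\beta_1-\beta_2>0$. There exists a version of the process $(x,t)\mapsto L^x_t$, $x\in\mathbb{R}$, $t\ge0$, which is jointly continuous in both variables.
   Context: $\{B_t,t\in\mathbb{R}\}$ is a two-sided Brownian motion with $B_0=0$ and variance $\mathbb{E}B_t^2=\sigma^2|t|$, $\sigma^2>0$. For $x\in\mathbb{R}$, $X^x_t$ is the (a.s. unique) Lipschitz solution of $dX_t/dt=\beta_1$ if $X_t<B_t$, $dX_t/dt=\beta_2$ if $X_t>B_t$, with $X^x_0=x$. $L^x_t$, $t\ge 0$, denotes the local time at $0$ of the process $B_s-X^x_s$ accumulated on $[0,t]$. It is normalized so that its associated excursion laws for excursions of $B-X^x$ above (resp. below) $0$ are $\lim_{y\downarrow0}|y|^{-1}Q^y_{-\beta_1}$ (resp. $\lim_{y\uparrow0}|y|^{-1}Q^y_{-\beta_2}$), where $Q^y_\mu$ is the law of Brownian motion (infinitesimal variance $\sigma^2$) with drift $\mu$ started at $y$ and killed on hitting $0$. Equivalently, $L^x_t=\lim_{\varepsilon\downarrow0}\frac{\sigma^2}{4\varepsilon}\int_0^t\mathbf 1_{\{|B_s-X^x_s|\le\varepsilon\}}ds$, i.e. half of the usual semimartingale local time at $0$ of $B-X^x$. *)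

(* Defs.v *)
From HB Require Import structures.
From mathcomp Require Import all_boot all_order all_algebra.
From mathcomp Require Import all_classical all_reals all_analysis.
Import Order.TTheory GRing.Theory Num.Theory.
Import numFieldNormedType.Exports.

Set Implicit Arguments.
Unset Strict Implicit.
Unset Printing Implicit Defensive.

Local Open Scope classical_set_scope.
Local Open Scope ring_scope.

(* The second parameter of [normal_prob] is the standard deviation; it is only
   used here with a positive value ([normal_prob m 0] is not a Dirac mass). *)
Definition two_sided_brownian_motion (R : realType) (d : measure_display)
    (T : measurableType d) (P : probability T R) (sigma : R)
    (B : R -> {RV P >-> R}) : Prop :=
  [/\ {ae P, forall w, B 0 w = 0},
      {ae P, forall w, continuous (fun t : R => B t w)},
      forall s t : R, s < t -> forall A : set R, measurable A ->
        P [set w | A (B t w - B s w)] =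
        normal_prob 0 (sigma * Num.sqrt (t - s)) A &
      forall (n : nat) (t : nat -> R) (A : nat -> set R),
        {homo t : i j / (i <= j)%N >-> i <= j} ->
        (forall i, measurable (A i)) ->
        P (\bigcap_(i < n) [set w | A i (B (t i.+1) w - B (t i) w)]) =
        (\prod_(i < n) P [set w | A i (B (t i.+1) w - B (t i) w)%R])%E].

(* No condition is imposed at times when [X t = b t]. For almost every Brownian
   path [b] these times form a Lebesgue-null set, for all Lipschitz [X] at once
   (a.s. [b] has an approximate derivative at almost no time), so the slope is
   prescribed at almost every time. *)
Definition lipschitz_solution (R : realType) (beta1 beta2 : R) (b : R -> R)
    (x : R) (X : R -> R) : Prop :=
  [/\ lipschitz (X : R^o -> R^o),
      X 0 = x,
      forall t : R, X t < b t -> is_derive t (1 : R) (X : R -> R) beta1 &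
      forall t : R, b t < X t -> is_derive t (1 : R) (X : R -> R) beta2].

Definition occupation_time (R : realType) (Y : R -> R) (t eps : R) : R :=
  fine (lebesgue_measure [set s : R | 0 <= s <= t /\ `|Y s| <= eps]).

(* The factor [sigma ^+ 2 / (4 * eps)] yields one half of the semimartingale
   local time at [0] of [Y]. *)
Definition is_local_time (R : realType) (sigma : R) (Y : R -> R) (t l : R) :
    Prop :=
  sigma ^+ 2 / (4 * eps) * occupation_time Y t eps @[eps --> 0^'+] --> l.

(* Main.v *)
Require Import Defs.
From HB Require Import structures.
From mathcomp Require Import all_boot all_order all_algebra.
From mathcomp Require Import all_classical all_reals all_analysis.
From mathcomp Require Import measurable_realfun ring lra.
Import Order.TTheory GRing.Theory Num.Theory.
Import numFieldNormedType.Exports.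
Set Implicit Arguments.
Unset Strict Implicit.
Unset Printing Implicit Defensive.

Local Open Scope classical_set_scope.
Local Open Scope ring_scope.

(* Let Y^x = B - X^x. By Tanaka's formula, the local time of Y^x at 0 is the
   increment of |Y^x| / 2 minus the integral of sign(Y^x) / 2 against dY^x. The gap
   |X^x - X^y| decreases at rate [beta1 - beta2] exactly while B lies between the two
   solutions, so the total time spent in this way is at most
   |x - y| / (beta1 - beta2). Hence the Tanaka formulas of x and y differ by terms
   of order |x - y|, up to a martingale whose bracket is also of order |x - y|, and
   the exponential martingale inequality gives
     P (L^x_t - L^y_t >= u) <= exp (- (l u - kappa (l + l^2) |x - y| - 1))
   for every l >= 0; increments in time are bounded in the same way. Choosing l of
   order 4 ^ k at distance 16 ^ (- k) makes the tails decay faster than any power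
   of the distance, and Kolmogorov's criterion applies.

   Stochastic integrals are avoided by discretizing: for the Euler scheme driven
   by the increments of B the exponential martingale is an elementary
   supermartingale, estimated by Taylor expansion of a smooth approximation of
   |y| / 2. For fixed smoothing the scheme converges pathwise, because its drift
   pushes two paths towards each other, and the sums of the second-order terms
   converge to occupation times, hence to the local time as the smoothing
   vanishes; Fatou's lemma carries the bound over. *)

(** * Gaussian exponential moments *)

(** The order of the limits shapes the estimates. With mesh s^2 the noise of one step has order s,
    and the exponential moment of a step is controlled up to C s^3; over t / s^2 steps this costs t
    C s, which vanishes with the mesh. But C depends on the smoothing width e, so the mesh must tend
    to 0 first and e afterwards: C is fixed for each e, the admissible meshes depend on C and on the
    path, and the events are combined by two nested lower limits. The second derivative of the
    smoothed potential jumps, and is therefore bracketed by continuous functions with ramps of width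
    e^2, which is negligible against e and hence invisible in the limit defining the local time. All
    errors that remain in the exponent at fixed e and small mesh are collected in the constant 1 of
    the tail bound. *)

Lemma le_norm_of_derive (R : realType) (f df : R -> R) (x M : R) :
  f 0 = 0 -> (forall z, is_derive z (1 : R) f (df z)) ->
  (forall z, `|z| <= `|x| -> `|df z| <= M) -> `|f x| <= M * `|x|.
Proof.
move=> f0 fdf dfM.
have cf : continuous f.
  move=> z; apply: differentiable_continuous; apply/derivable1_diffP.
  by have [] := fdf z.
have [x0|x0] := leP 0 x.
  have [|z z0x] := MVT_segment x0 (fun z _ => fdf z).
    exact: continuous_subspaceT.
  rewrite f0 !subr0 => ->; rewrite normrM ler_wpM2r// dfM//.
  move: z0x; rewrite in_itv/= => /andP[z0 zx].
  by rewrite !ger0_norm.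
have [|z z0x] := MVT_segment (ltW x0) (fun z _ => fdf z).
  exact: continuous_subspaceT.
rewrite f0 !sub0r => /eqP; rewrite eqr_oppLR => /eqP ->.
rewrite mulrN opprK normrM ler_wpM2r// dfM//.
move: z0x; rewrite in_itv/= => /andP[xz z0].
by rewrite !ler0_norm ?lerN2// ltW.
Qed.

Lemma expR_taylor2 (R : realType) (x : R) :
  `|expR x - 1 - x - x ^+ 2 / 2| <= `|x| ^+ 3 * expR `|x|.
Proof.
have e0 (z : R) : `|z| <= `|x| -> `|expR z - 1| <= expR `|x| * `|x|.
  move=> zx; have := expR_ge1Dx z; have := expR_ge1Dx (- z); rewrite expRN.
  have ez := expR_gt0 z => h1 h2.
  have h3 : expR z - 1 <= expR z * z.
    have := ler_wpM2l (ltW ez) h1; rewrite divff ?gt_eqF// => h.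
    by lra.
  have ezx : expR z <= expR `|x|.
    by rewrite ler_expR (le_trans _ zx)// ler_norm.
  have ex1 : 1 <= expR `|x| by rewrite -expR0 ler_expR.
  rewrite ler_norml; apply/andP; split; last first.
    apply: (le_trans h3); apply: (le_trans (y := expR z * `|z|)).
      by rewrite ler_pM2l// ler_norm.
    by rewrite ler_pM// ltW.
  rewrite lerNl opprB lerBlDr.
  have : `|x| <= expR `|x| * `|x| by rewrite ler_peMl.
  have := ler_norm (- z); rewrite normrN; lra.
have e1 (z : R) : `|z| <= `|x| -> `|expR z - 1 - z| <= expR `|x| * `|x| * `|x|.
  move=> zx; apply: le_trans (_ : expR `|x| * `|x| * `|z| <= _); last first.
    by rewrite ler_wpM2l// mulr_ge0// expR_ge0.
  apply: (@le_norm_of_derive _ (fun z => expR z - 1 - z) (fun z => expR z - 1)).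
  - by rewrite expR0; lra.
  - by move=> w; apply: is_derive_eq; rewrite subr0.
  - by move=> w wz; apply: e0; exact: le_trans zx.
rewrite (_ : `|x| ^+ 3 * _ = expR `|x| * `|x| * `|x| * `|x|); last by ring.
apply: (@le_norm_of_derive _ (fun z => expR z - 1 - z - z ^+ 2 / 2)
  (fun z => expR z - 1 - z)).
- by rewrite expR0 expr0n/= mul0r; lra.
- move=> w; apply: is_derive_eq.
  by rewrite /GRing.scale/=; field.
- exact: e1.
Qed.

(** Change of variables is applied to the Radon-Nikodym derivative, which uniqueness of densities
    identifies almost everywhere with [normal_pdf]. *)
Lemma ge0_integral_normal_prob (R : realType) (m s : R) (f : R -> R) :
  measurable_fun setT f -> (forall x, 0 <= f x) ->
  (\int[normal_prob m s]_x (f x)%:E =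
   \int[lebesgue_measure]_x (f x * normal_pdf m s x)%:E)%E.
Proof.
move=> mf f0; have dom := normal_prob_dominates m s.
rewrite -(Radon_Nikodym_SigmaFinite.change_of_variables dom)//; last first.
  exact/measurable_EFinP.
apply: ae_eq_integral => //.
- apply: emeasurable_funM; first exact/measurable_EFinP.
  apply: (measurable_int lebesgue_measure).
  exact: Radon_Nikodym_SigmaFinite.f_integrable.
- apply/measurable_EFinP; apply: measurable_funM => //.
  exact: measurable_normal_pdf.
- have : ae_eq lebesgue_measure setT
      (Radon_Nikodym_SigmaFinite.f (normal_prob m s) lebesgue_measure)
      (EFin \o normal_pdf m s).
  apply: integral_ae_eq => //.
  + exact: Radon_Nikodym_SigmaFinite.f_integrable.
  + by apply/measurable_EFinP; exact: measurable_normal_pdf.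
  + by move=> E _ mE; rewrite -Radon_Nikodym_SigmaFinite.f_integral.
  by apply: filterS => x /= /[apply] ->; rewrite EFinM.
Qed.

Lemma integral_normal_prob_expR (R : realType) (s c : R) : 0 < s ->
  (\int[normal_prob 0 s]_x (expR (c * x))%:E = (expR (c ^+ 2 * s ^+ 2 / 2))%:E)%E.
Proof.
move=> s0; rewrite ge0_integral_normal_prob//; last first.
  by apply: measurableT_comp => //; exact: measurable_funM.
under eq_integral => x _.
  (* Completing the square: the weight [expR (c * x)] shifts the mean to [c * s ^+ 2]. *)
  rewrite (_ : expR _ * _ =
      expR (c ^+ 2 * s ^+ 2 / 2) * normal_pdf (c * s ^+ 2) s x); last first.
    rewrite !normal_pdfE ?gt_eqF// mulrCA [RHS]mulrCA; congr (_ * _).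
    rewrite /normal_fun -!expRD; congr expR.
    by field; rewrite gt_eqF.
  rewrite EFinM; over.
rewrite /= ge0_integralZl_EFin ?expR_ge0//.
- by rewrite integral_normal_pdf mule1.
- by move=> x _; rewrite lee_fin normal_pdf_ge0.
- by apply/measurable_EFinP; exact: measurable_normal_pdf.
Qed.

Lemma integral_normal_prob_sum_expR (R : realType) (s : R) (l : seq (R * R)) :
  0 < s ->
  (\int[normal_prob 0 s]_x (\sum_(p <- l) p.1 * expR (p.2 * x))%:E =
   (\sum_(p <- l) p.1 * expR (p.2 ^+ 2 * s ^+ 2 / 2))%:E)%E.
Proof.
move=> s0.
have intE c : (normal_prob 0 s).-integrable setT
    (fun x : R => (expR (c * x))%:E).
  apply/integrableP; split.
    apply/measurable_EFinP.
    have : measurable_fun setT (fun x : R => expR (c * x)).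
      by apply: measurableT_comp => //; exact: measurable_funM.
    exact.
  under eq_integral do rewrite gee0_abs ?lee_fin ?expR_ge0//.
  by rewrite integral_normal_prob_expR// ltry.
under eq_integral do rewrite -sumEFin.
under eq_integral do under eq_bigr do rewrite EFinM.
rewrite integral_sum//; last by move=> p; exact: integrableZl.
rewrite -sumEFin; apply: eq_bigr => p _.
by rewrite integralZl// integral_normal_prob_expR// EFinM.
Qed.

Lemma sinh_cosh_taylor (R : realType) (z : R) :
  [/\ `|(expR z - expR (- z)) / 2 - z| <= `|z| ^+ 3 * expR `|z| &
      `|(expR z + expR (- z)) / 2 - 1 - z ^+ 2 / 2| <= `|z| ^+ 3 * expR `|z|].
Proof.
have := expR_taylor2 z; have := expR_taylor2 (- z); rewrite normrN sqrrN.
set E := _ * _; rewrite !ler_norml => /andP[h1 h2] /andP[h3 h4].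
by split; apply/andP; split; lra.
Qed.

(** The majorant is a combination of exponentials of linear functions, whose Gaussian integrals are
    explicit, so no Gaussian moment of a power is needed. Here [z] and [z ^+ 2 / 2] are traded for
    sinh z and cosh z - 1, [a ^+ 2] comes from the square of [u], and all cubic errors go into the
    last term, whose rate [(K + 2) / s] is harmless against a standard deviation of order [s]. *)
Lemma expR_le_sinh_cosh (R : realType) (K s a q r u z : R) : 0 <= K ->
  0 < s -> s <= 1 -> `|a| <= K -> `|q| <= K ->
  u <= a * z + q * z ^+ 2 / 2 + r + K * (`|z| + s) ^+ 3 ->
  `|u - a * z| <= K * (`|z| + s) ^+ 2 -> `|u| <= K * (`|z| + s) ->
  expR u <= 1 + r + a * ((expR z - expR (- z)) / 2)
    + (q + a ^+ 2) * ((expR z + expR (- z)) / 2 - 1)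
    + 6 * expR (K + 2) * (3 * K + 3 * K ^+ 2 + K ^+ 3) * s ^+ 3 *
      (expR ((K + 2) / s * z) + expR (- ((K + 2) / s) * z)).
Proof.
move=> K0 s0 s1 aK qK u1 u2 u3.
set v := `|z| + s in u1 u2 u3 *.
have v0 : 0 <= v by rewrite addr_ge0// ltW.
have zv : `|z| <= v by rewrite lerDl ltW.
pose W := v ^+ 3 * expR ((K + 1) * v).
have W0 : 0 <= W by rewrite mulr_ge0// ?exprn_ge0// expR_ge0.
have vW : v ^+ 3 <= W.
  by rewrite ler_peMr ?exprn_ge0// -expR0 ler_expR mulr_ge0// addr_ge0.
have EW : `|z| ^+ 3 * expR `|z| <= W.
  rewrite ler_pM ?exprn_ge0 ?expR_ge0//.
    by rewrite lerXn2r// nnegrE.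
  rewrite ler_expR (le_trans zv)// mulrDl mul1r lerDr mulr_ge0//.
have v4W : v ^+ 4 <= W.
  rewrite exprSr ler_wpM2l ?exprn_ge0//.
  rewrite (le_trans (_ : v <= expR v))//; first by rewrite (le_trans _ (expR_ge1Dx v))// lerDr.
  by rewrite ler_expR mulrDl mul1r lerDr mulr_ge0.
have u3W : `|u| ^+ 3 * expR `|u| <= K ^+ 3 * W.
  rewrite /W mulrA -exprMn ler_pM ?exprn_ge0 ?expR_ge0//.
    by rewrite lerXn2r// nnegrE// mulr_ge0.
  by rewrite ler_expR (le_trans u3)// ler_wpM2r// lerDl.
have uu : u ^+ 2 <= a ^+ 2 * z ^+ 2 + 2 * K ^+ 2 * W + K ^+ 2 * W.
  have -> : u ^+ 2 = a ^+ 2 * z ^+ 2 + 2 * (a * z * (u - a * z))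
      + (u - a * z) ^+ 2 by ring.
  apply: lerD; first apply: lerD => //.
    rewrite -[leRHS]mulrA ler_wpM2l//; apply: (le_trans (ler_norm _)).
    rewrite !normrM (le_trans (_ : _ <= K * v * (K * v ^+ 2)))//.
      by rewrite ler_pM ?mulr_ge0// ler_pM.
    rewrite (_ : _ * _ = K ^+ 2 * v ^+ 3); last by ring.
    by rewrite ler_wpM2l// exprn_ge0.
  rewrite -[leLHS]ger0_norm ?sqr_ge0// normrX.
  rewrite (le_trans (_ : _ <= (K * v ^+ 2) ^+ 2))//.
    by rewrite lerXn2r// nnegrE ?mulr_ge0// exprn_ge0.
  rewrite exprMn -exprM ler_wpM2l// exprn_ge0//.
have [sh ch] := sinh_cosh_taylor z.
have shW : a * z <= a * ((expR z - expR (- z)) / 2) + K * W.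
  rewrite -lerBlDl -mulrBr; apply: (le_trans (ler_norm _)).
  by rewrite normrM ler_pM// distrC (le_trans sh).
have qK2 : `|q + a ^+ 2| <= K + K ^+ 2.
  rewrite (le_trans (ler_normD _ _))// lerD// normrX lerXn2r// nnegrE//.
have chW : (q + a ^+ 2) * (z ^+ 2 / 2) <=
    (q + a ^+ 2) * ((expR z + expR (- z)) / 2 - 1) + (K + K ^+ 2) * W.
  rewrite -lerBlDl -mulrBr; apply: (le_trans (ler_norm _)).
  by rewrite normrM ler_pM// distrC (le_trans ch).
have K2 : 0 <= K ^+ 2 by rewrite exprn_ge0.
have K3 : 0 <= K ^+ 3 by rewrite exprn_ge0.
have KvW : K * v ^+ 3 <= K * W by rewrite ler_wpM2l.
(* The factor 6 is 3!, from the cubic term of the series of [expR (v / s)]; since [v / s] is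
   [|z| / s + 1], the shift by 1 produces [expR (K + 2)]. *)
have WS : W <= 6 * expR (K + 2) * s ^+ 3 *
      (expR ((K + 2) / s * z) + expR (- ((K + 2) / s) * z)).
  have vs : v <= v / s by rewrite ler_pdivlMr// ler_piMr.
  have vs0 : 0 <= v / s by rewrite divr_ge0// ltW.
  have h3 : v ^+ 3 <= 6 * s ^+ 3 * expR (v / s).
    have := expR_ge1Dxn 2 vs0; rewrite (_ : 3`!%:R = 6 :> R)// => h.
    have {}h : (v / s) ^+ 3 <= 6 * expR (v / s) by lra.
    have -> : v ^+ 3 = (v / s) ^+ 3 * s ^+ 3 by field; rewrite gt_eqF.
    by rewrite (le_trans (ler_wpM2r _ h)) ?exprn_ge0 ?(ltW s0)// mulrAC.
  have h4 : expR ((K + 1) * v) <= expR ((K + 1) * (v / s)).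
    by rewrite ler_expR ler_wpM2l// addr_ge0.
  apply: (le_trans (y := 6 * s ^+ 3 * expR (v / s) * expR ((K + 1) * (v / s)))).
    by rewrite ler_pM ?exprn_ge0 ?expR_ge0.
  rewrite -mulrA -expRD (_ : _ + _ = (K + 2) + (K + 2) / s * `|z|); last first.
    by rewrite /v; field; rewrite gt_eqF.
  rewrite expRD mulrA (mulrAC 6) ler_wpM2l//.
    by rewrite !mulr_ge0 ?expR_ge0 ?exprn_ge0 ?(ltW s0).
  have [z0|z0] := ger0P z; first by rewrite lerDl expR_ge0.
  by rewrite mulrN mulNr lerDr expR_ge0.
have := expR_taylor2 u; rewrite ler_norml => /andP[_ eu].
set S := expR (_ * z) + _ in WS *.
have : (3 * K + 3 * K ^+ 2 + K ^+ 3) * W <=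
   (3 * K + 3 * K ^+ 2 + K ^+ 3) * (6 * expR (K + 2) * s ^+ 3 * S).
  by rewrite ler_wpM2l// !addr_ge0// mulr_ge0.
have K2W : 0 <= K ^+ 2 * W by rewrite mulr_ge0.
move=> H; lra.
Qed.

(** A second-order cumulant expansion with error uniform in [s]: the rate [(K + 2) / s] times the
    deviation [sg * s] no longer depends on [s], so the cubic term integrates to order [s ^+ 3], and
    [1 + x <= expR x] moves everything into the exponent. *)
Lemma integral_normal_prob_expR_le (R : realType) (sg K : R) :
  0 < sg -> 0 <= K -> exists2 C : R, 0 <= C &
  forall s a q r (u : R -> R), 0 < s -> s <= 1 -> `|a| <= K -> `|q| <= K ->
  measurable_fun setT u ->
  (forall z, u z <= a * z + q * z ^+ 2 / 2 + r + K * (`|z| + s) ^+ 3) ->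
  (forall z, `|u z - a * z| <= K * (`|z| + s) ^+ 2) ->
  (forall z, `|u z| <= K * (`|z| + s)) ->
  (\int[normal_prob 0 (sg * s)]_z (expR (u z))%:E <=
   (expR (r + (q + a ^+ 2) * (sg * s) ^+ 2 / 2 + C * s ^+ 3))%:E)%E.
Proof.
move=> sg0 K0; pose w0 := sg ^+ 2 / 2.
have w00 : 0 <= w0 by rewrite divr_ge0 ?exprn_ge0 ?ltW.
pose C1 := 6 * expR (K + 2) * (3 * K + 3 * K ^+ 2 + K ^+ 3).
have C10 : 0 <= C1.
  by do ![apply: mulr_ge0 | apply: addr_ge0 | apply: exprn_ge0]; rewrite ?expR_ge0 ?invr_ge0//.
pose C2 := 2 * C1 * expR ((K + 2) ^+ 2 * w0).
have C20 : 0 <= C2.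
  by do ![apply: mulr_ge0 | apply: addr_ge0 | apply: exprn_ge0]; rewrite ?expR_ge0 ?invr_ge0//.
pose C3 := (K + K ^+ 2) * (w0 ^+ 2 / 2 + w0 ^+ 3 * expR w0).
have C30 : 0 <= C3.
  by rewrite /C3 mulr_ge0 ?addr_ge0 ?divr_ge0 ?mulr_ge0 ?exprn_ge0 ?expR_ge0 ?(ltW sg0).
exists (C2 + C3); first by rewrite addr_ge0.
move=> s a q r u s0 s1 aK qK mu u1 u2 u3.
(* Coefficients paired with rates: the constant, the two exponentials of sinh and cosh, and the two
   of the cubic remainder. *)
pose l : seq (R * R) := [:: (1 + r - (q + a ^+ 2), 0);
  (a / 2 + (q + a ^+ 2) / 2, 1); (- (a / 2) + (q + a ^+ 2) / 2, - 1);
  (C1 * s ^+ 3, (K + 2) / s); (C1 * s ^+ 3, - ((K + 2) / s))].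
have ss0 : 0 < sg * s by rewrite mulr_gt0.
apply: (@le_trans _ _
    (\int[normal_prob 0 (sg * s)]_x (\sum_(p <- l) p.1 * expR (p.2 * x))%:E)%E).
  have le z : expR (u z) <= \sum_(p <- l) p.1 * expR (p.2 * z).
    rewrite !big_cons big_nil/= !mul0r expR0 mul1r mulN1r.
    apply: (le_trans (expR_le_sinh_cosh K0 s0 s1 aK qK (u1 z) (u2 z) (u3 z))).
    by rewrite -/C1; lra.
  apply: ge0_le_integral => //.
  - by apply/measurable_EFinP; exact: measurableT_comp.
  - apply/measurable_EFinP.
    have mE (a' b' : R) : measurable_fun setT (fun x : R => a' * expR (b' * x)).
      apply: measurable_funM => //.
      by apply: measurableT_comp => //; exact: measurable_funM.
    by apply: measurable_sum => p; exact: mE.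
  - by move=> z _; rewrite lee_fin.
rewrite integral_normal_prob_sum_expR// lee_fin !big_cons big_nil/=.
rewrite expr0n/= !mul0r expR0 sqrrN !expr1n !mul1r sqrrN.
have -> : ((K + 2) / s) ^+ 2 * (sg * s) ^+ 2 / 2 = (K + 2) ^+ 2 * w0.
  by rewrite /w0; field; rewrite gt_eqF.
set w := (sg * s) ^+ 2 / 2.
have ww0 : w = w0 * s ^+ 2 by rewrite /w /w0; field.
have w_ge0 : 0 <= w by rewrite ww0 mulr_ge0// exprn_ge0// ltW.
have s2 : s ^+ 2 <= 1 by rewrite exprn_ile1// ltW.
have wle : w <= w0 by rewrite ww0 ler_piMr.
have sk n : s ^+ n.+1 <= s ^+ n by rewrite exprSr ler_piMr ?exprn_ge0 ?(ltW s0).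
have w2 : w ^+ 2 <= w0 ^+ 2 * s ^+ 3.
  by rewrite ww0 exprMn -exprM ler_wpM2l ?sqr_ge0//; exact: sk.
have w3 : w ^+ 3 <= w0 ^+ 3 * s ^+ 3.
  rewrite ww0 exprMn -exprM ler_wpM2l ?(exprn_ge0 _ w00)//.
  exact: le_trans (sk 5) (le_trans (sk 4) (sk 3)).
have ew : `|expR w - 1 - w| <= (w0 ^+ 2 / 2 + w0 ^+ 3 * expR w0) * s ^+ 3.
  have := expR_taylor2 w; rewrite (ger0_norm w_ge0) => tay.
  have -> : expR w - 1 - w = (expR w - 1 - w - w ^+ 2 / 2) + w ^+ 2 / 2 by lra.
  rewrite (le_trans (ler_normD _ _))// addrC mulrDl; apply: lerD.
    by rewrite ger0_norm ?divr_ge0 ?exprn_ge0//; lra.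
  rewrite (le_trans tay)// [leRHS]mulrAC ler_pM ?ler_expR//.
  exact: exprn_ge0.
have qa : `|q + a ^+ 2| <= K + K ^+ 2.
  by rewrite (le_trans (ler_normD _ _))// lerD// normrX lerXn2r// nnegrE.
have h : (q + a ^+ 2) * (expR w - 1 - w) <= C3 * s ^+ 3.
  by rewrite (le_trans (ler_norm _))// normrM /C3 -mulrA ler_pM.
apply: le_trans (expR_ge1Dx _); rewrite -[_ * _ / 2]mulrA -/w /C2; lra.
Qed.

(** * A smooth approximation of half the absolute value *)

(* [pot e] is the C^1 convex function equal to [|y| / 2] for [|y| >= e] and
   quadratic in between, and [dpot e] is its derivative. Its second derivative,
   the indicator of [|y| < e] divided by [2 * e], lies between the continuous
   functions [trap e e] and [trap e (e + e ^+ 2)]. *)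
Definition pot (R : realType) (e y : R) : R :=
  `|y| / 2 + (Num.max (e - `|y|) 0) ^+ 2 / (4 * e).

Definition dpot (R : realType) (e y : R) : R :=
  Num.max (- 2^-1) (Num.min 2^-1 (y / (2 * e))).

Definition trap (R : realType) (e a y : R) : R :=
  Num.max 0 (Num.min 1 ((a - `|y|) / e ^+ 2)) / (2 * e).

Section potential.
Context {R : realType} (e : R) (e0 : 0 < e).
Implicit Types y u a : R.

Lemma potN y : pot e (- y) = pot e y. Proof. by rewrite /pot normrN. Qed.

Lemma dpotN y : dpot e (- y) = - dpot e y.
Proof.
rewrite /dpot mulNr; set z := y / _.
rewrite /Num.max /Num.min; do !case: ifPn => //; lra.
Qed.

Lemma trapN a y : trap e a (- y) = trap e a y.
Proof. by rewrite /trap normrN. Qed.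

Lemma normr_dpot y : `|dpot e y| <= 2^-1.
Proof.
rewrite ler_norml /dpot; set z := y / _.
by rewrite /Num.max /Num.min; do !case: ifPn => //; lra.
Qed.

Lemma dpot_ndecr y1 y2 : y1 <= y2 -> dpot e y1 <= dpot e y2.
Proof.
move=> y12; have : y1 / (2 * e) <= y2 / (2 * e).
  by rewrite ler_pM2r// invr_gt0 mulr_gt0.
rewrite /dpot; set z1 := y1 / _; set z2 := y2 / _ => z12.
by rewrite /Num.max /Num.min; do !case: ifPn => //; lra.
Qed.

Lemma pot_small y : `|y| <= e -> pot e y = y ^+ 2 / (4 * e) + e / 4.
Proof.
move=> ye; rewrite /pot max_l ?subr_ge0//.
by rewrite -(real_normK (num_real y)); field; rewrite gt_eqF.
Qed.

Lemma pot_large y : e <= `|y| -> pot e y = `|y| / 2.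
Proof. by move=> ey; rewrite /pot max_r ?subr_le0// expr0n mul0r addr0. Qed.

Lemma dpot_small y : `|y| <= e -> dpot e y = y / (2 * e).
Proof.
move=> /ler_normlP[y1 y2].
have h1 : y / (2 * e) <= 2^-1.
  by rewrite ler_pdivrMr ?mulr_gt0//; lra.
have h2 : - 2^-1 <= y / (2 * e).
  by rewrite ler_pdivlMr ?mulr_gt0//; lra.
by rewrite /dpot min_r// max_r.
Qed.

Lemma dpot_large y : e <= y -> dpot e y = 2^-1.
Proof.
move=> ey; have h1 : 2^-1 <= y / (2 * e).
  by rewrite ler_pdivlMr ?mulr_gt0//; lra.
by rewrite /dpot min_l// max_r//; lra.
Qed.

Lemma trap_ge0 a y : 0 <= trap e a y.
Proof. by rewrite /trap divr_ge0 ?mulr_ge0 ?(ltW e0)// le_max lexx. Qed.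

Lemma trap_le a y : trap e a y <= (2 * e)^-1.
Proof.
rewrite /trap ler_piMl ?invr_ge0 ?mulr_ge0 ?(ltW e0)//.
by rewrite ge_max ler01/= ge_min lexx.
Qed.

Lemma trap_top a y : `|y| <= a - e ^+ 2 -> trap e a y = (2 * e)^-1.
Proof.
move=> ya; rewrite /trap min_l; first by rewrite max_r// mul1r.
by rewrite ler_pdivlMr ?exprn_gt0// mul1r lerBrDr addrC -lerBrDr.
Qed.

Lemma trap_out a y : a <= `|y| -> trap e a y = 0.
Proof.
move=> ya; rewrite /trap max_l ?mul0r// ge_min; apply/orP; right.
by rewrite pmulr_lle0 ?invr_gt0 ?exprn_gt0// subr_le0.
Qed.

Lemma trap_lin_ge a y : (a - `|y|) / e ^+ 2 <= 1 ->
  (a - `|y|) / e ^+ 2 / (2 * e) <= trap e a y.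
Proof.
move=> h; rewrite /trap ler_pM2r ?invr_gt0 ?mulr_gt0//.
by rewrite min_r// le_max lexx orbT.
Qed.

Lemma trap_lin_le a y : `|y| <= a -> trap e a y <= (a - `|y|) / e ^+ 2 / (2 * e).
Proof.
move=> h; rewrite /trap ler_pM2r ?invr_gt0 ?mulr_gt0//.
by rewrite ge_max ge_min lexx orbT andbT divr_ge0 ?subr_ge0// exprn_ge0// ltW.
Qed.

(** The parabola exceeds [|y| / 2] by [(|y| - e) ^+ 2 / (4 * e)], so it touches it at [|y| = e].
    Continuing the parabola beyond its range yields the remainder bound [u ^+ 2 / (4 * e)]. *)
Lemma pot_le y : pot e y <= y ^+ 2 / (4 * e) + e / 4.
Proof.
have [ye|ey] := leP `|y| e; first by rewrite pot_small.
rewrite pot_large ?(ltW ey)// -subr_ge0 (_ : _ - _ = (`|y| - e) ^+ 2 / (4 * e)).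
  by rewrite divr_ge0 ?sqr_ge0// mulr_ge0 ?ltW.
by rewrite -(real_normK (num_real y)); field; rewrite gt_eqF.
Qed.

Lemma pot_ge y : `|y| / 2 <= pot e y.
Proof. by rewrite /pot lerDl divr_ge0 ?sqr_ge0// mulr_ge0 ?ltW. Qed.

Let rest y u := pot e (y + u) - pot e y - dpot e y * u.

(** Positivity is convexity. The cubic error is needed only when the step from [y] to [y + u]
    crosses an edge of the quadratic zone: then [y] is within [|u|] of that edge, and [trap] has
    slope [1 / (2 * e ^+ 3)] on its ramp, so it is off by at most [|u| / (2 * e ^+ 3)] in front of
    [u ^+ 2 / 2]. *)
Let rest_ge0_le (y u : R) : 0 <= y ->
  [/\ 0 <= rest y u, rest y u <= u ^+ 2 / (4 * e),
   trap e e y * u ^+ 2 / 2 - `|u| ^+ 3 / (4 * e ^+ 3) <= rest y u &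
   rest y u <= trap e (e + e ^+ 2) y * u ^+ 2 / 2 + `|u| ^+ 3 / (4 * e ^+ 3)].
Proof.
move=> y0; have ny : `|y| = y by rewrite ger0_norm.
have c0 : 0 < 4 * e by rewrite mulr_gt0.
have c3 : 0 < 4 * e ^+ 3 by rewrite mulr_gt0// exprn_gt0.
have k3 : 0 <= `|u| ^+ 3 / (4 * e ^+ 3) by rewrite divr_ge0 ?exprn_ge0 ?(ltW c3).
have u2 : `|u| ^+ 2 = u ^+ 2 by rewrite real_normK ?num_real.
have u20 : 0 <= u ^+ 2 by rewrite sqr_ge0.
have [ye|ey] := leP y e; last first.
  have tr0 : trap e e y = 0 by rewrite trap_out// ny ltW.
  have rE : rest y u = pot e (y + u) - (y + u) / 2.
    have py : pot e y = y / 2 by rewrite pot_large ny// ltW.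
    by rewrite /rest py dpot_large ?(ltW ey)//; field.
  have r0 : 0 <= rest y u.
    rewrite rE subr_ge0; apply: le_trans (pot_ge _).
    by rewrite ler_pM2r ?invr_gt0// ler_norm.
  have tp : 0 <= trap e (e + e ^+ 2) y * u ^+ 2 / 2.
    by rewrite divr_ge0// mulr_ge0// trap_ge0.
  have [we|we] := leP e (y + u).
    have w0 : 0 <= y + u by apply: le_trans we; exact: ltW.
    have rE0 : rest y u = 0 by rewrite rE pot_large ger0_norm// subrr.
    rewrite rE0 tr0 mul0r mul0r sub0r oppr_le0; split => //.
      exact: (divr_ge0 u20 (ltW c0)).
    exact: addr_ge0.
  have rle : rest y u <= (e - (y + u)) ^+ 2 / (4 * e).
    rewrite rE lerBlDr; apply: le_trans (pot_le _) _.
    by rewrite le_eqVlt; apply/orP; left; apply/eqP; field; rewrite gt_eqF.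
  have u0 : u < 0 by lra.
  have nu : `|u| = - u by rewrite ltr0_norm.
  have rle2 : rest y u <= u ^+ 2 / (4 * e).
    apply: (le_trans rle); rewrite ler_pM2r ?invr_gt0// -(sqrrN u).
    by rewrite lerXn2r ?nnegrE//; lra.
  split => //; first by rewrite tr0 !mul0r sub0r (le_trans _ r0)// oppr_le0.
  apply: (le_trans rle2).
  have := @trap_lin_ge (e + e ^+ 2) y; rewrite ny => h.
  have {}h : (e + e ^+ 2 - y) / e ^+ 2 / (2 * e) <= trap e (e + e ^+ 2) y.
    by apply: h; rewrite ler_pdivrMr ?exprn_gt0// mul1r; lra.
  rewrite -lerBlDr.
  apply: (le_trans (y := (e + e ^+ 2 - y) / e ^+ 2 / (2 * e) * u ^+ 2 / 2)).
    rewrite lerBlDr -subr_ge0 (_ : _ - _ =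
        (`|u| - (y - e)) * u ^+ 2 / (4 * e ^+ 3)); last first.
      by rewrite (exprSr `|u| 2) u2; field; rewrite gt_eqF.
    by rewrite divr_ge0 ?(ltW c3)// mulr_ge0//; lra.
  by rewrite ler_pM2r ?invr_gt0// ler_wpM2r.
have yn : `|y| <= e by rewrite ny.
have rE : rest y u = pot e (y + u) - (y ^+ 2 + 2 * y * u + e ^+ 2) / (4 * e).
  rewrite /rest (pot_small yn) (dpot_small yn); field; by rewrite gt_eqF.
have rle : rest y u <= u ^+ 2 / (4 * e).
  rewrite rE lerBlDr; apply: le_trans (pot_le _) _.
  by rewrite le_eqVlt; apply/orP; left; apply/eqP; field; rewrite gt_eqF.
have tle : trap e e y * u ^+ 2 / 2 <= u ^+ 2 / (4 * e).
  rewrite (_ : _ / (4 * e) = (2 * e)^-1 * u ^+ 2 / 2); last first.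
    by field; rewrite gt_eqF.
  by rewrite ler_pM2r ?invr_gt0// ler_wpM2r// trap_le.
have ttop : trap e (e + e ^+ 2) y = (2 * e)^-1 by rewrite trap_top// addrK.
have r4 : rest y u <=
    trap e (e + e ^+ 2) y * u ^+ 2 / 2 + `|u| ^+ 3 / (4 * e ^+ 3).
  rewrite (le_trans rle)// ttop (_ : _ / (4 * e) = (2 * e)^-1 * u ^+ 2 / 2).
    by rewrite lerDl.
  by field; rewrite gt_eqF.
have [we|we] := leP `|y + u| e.
  have rE2 : rest y u = u ^+ 2 / (4 * e).
    by rewrite rE pot_small//; field; rewrite gt_eqF.
  split => //; first by rewrite rE2 divr_ge0// ltW.
  by rewrite rE2; apply: le_trans tle; rewrite lerBlDr lerDl.
have ud : e - y <= `|u| by have := ler_normD y u; rewrite ny; lra.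
have small : trap e e y * u ^+ 2 / 2 - `|u| ^+ 3 / (4 * e ^+ 3) <= 0.
  rewrite subr_le0; apply: (le_trans (y := (e - y) / e ^+ 2 / (2 * e) * u ^+ 2 / 2)).
    rewrite ler_pM2r ?invr_gt0// ler_wpM2r//.
    by have := trap_lin_le yn; rewrite ny.
  rewrite -subr_ge0 (_ : _ - _ = (`|u| - (e - y)) * u ^+ 2 / (4 * e ^+ 3)).
    by rewrite divr_ge0 ?(ltW c3)// mulr_ge0// subr_ge0.
  by rewrite (exprSr `|u| 2) u2; field; rewrite gt_eqF.
have r0 : 0 <= rest y u.
  rewrite rE pot_large ?(ltW we)//; move: we; have [w0|w0] := ger0P (y + u) => we.
    rewrite (_ : _ - _ = (e - y) * (2 * u - (e - y)) / (4 * e)).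
      by rewrite divr_ge0 ?(ltW c0)// mulr_ge0//; lra.
    by field; rewrite gt_eqF.
  rewrite (_ : _ - _ = (e + y) * (- (2 * u) - (e + y)) / (4 * e)).
    by rewrite divr_ge0 ?(ltW c0)// mulr_ge0//; lra.
  by field; rewrite gt_eqF.
by split => //; exact: le_trans small r0.
Qed.

Lemma pot_taylor y u :
  [/\ 0 <= pot e (y + u) - pot e y - dpot e y * u,
   pot e (y + u) - pot e y - dpot e y * u <= u ^+ 2 / (4 * e),
   trap e e y * u ^+ 2 / 2 - `|u| ^+ 3 / (4 * e ^+ 3) <=
     pot e (y + u) - pot e y - dpot e y * u &
   pot e (y + u) - pot e y - dpot e y * u <=
     trap e (e + e ^+ 2) y * u ^+ 2 / 2 + `|u| ^+ 3 / (4 * e ^+ 3)].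
Proof.
have [y0|/ltW] := leP 0 y; first exact: rest_ge0_le.
rewrite -oppr_ge0 => /(rest_ge0_le (- u)).
by rewrite /rest -opprD !potN dpotN !trapN sqrrN normrN mulrNN.
Qed.

Lemma pot_lip y1 y2 : `|pot e y1 - pot e y2| <= `|y1 - y2| / 2.
Proof.
have key y u : - (`|u| / 2) <= pot e (y + u) - pot e y.
  have [+ _ _ _] := pot_taylor y u; rewrite subr_ge0; apply: le_trans.
  rewrite lerNl (le_trans (ler_norm _))// normrN normrM mulrC ler_wpM2l//.
  exact: normr_dpot.
rewrite ler_norml; have := key y2 (y1 - y2); have := key y1 (y2 - y1).
rewrite (distrC y2) !subrKC => h1 h2; apply/andP; split => //; lra.
Qed.

Lemma measurable_pot : measurable_fun setT (pot e).
Proof.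
apply: measurable_funD.
  by apply: measurable_funM => //; exact: measurable_normr.
apply: measurable_funM => //; apply: measurable_funX.
by apply: measurable_maxr => //; exact: measurable_funB.
Qed.

End potential.

(** * One-step exponential moments of the potential *)

Definition slope (R : realType) (b1 b2 y : R) : R := if 0 < y then b1 else b2.

(** For mesh [s ^+ 2] the noise [z] has order [s] and the drift [dl] order [s ^+ 2]; powers of
    [|z| + s] give a common scale for both. *)
Lemma shift_estimates (R : realType) (b1 s dl z : R) :
  0 < b1 -> 0 < s -> s <= 1 -> 0 <= dl -> dl <= b1 * s ^+ 2 ->
  [/\ `|z - dl| <= (1 + b1) * (`|z| + s),
      dl <= b1 * (`|z| + s) ^+ 2,
      `|(z - dl) ^+ 2 - z ^+ 2| <= (2 * b1 + b1 ^+ 2) * (`|z| + s) ^+ 3 &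
      (z - dl) ^+ 2 <= (1 + b1) ^+ 2 * (`|z| + s) ^+ 2].
Proof.
move=> b10 s0 s1 dl0 dlb; set v := `|z| + s; set u := z - dl.
have s20 : 0 <= s ^+ 2 by rewrite sqr_ge0.
have zv : `|z| <= v by rewrite lerDl ltW.
have sv : s <= v by rewrite lerDr.
have v0 : 0 <= v by rewrite addr_ge0// ltW.
have s2v : s ^+ 2 <= v by rewrite (le_trans _ sv)// expr2 ler_piMr// ltW.
have s2v2 : s ^+ 2 <= v ^+ 2 by rewrite lerXn2r// nnegrE// ltW.
have nu : `|u| <= (1 + b1) * v.
  rewrite (le_trans (ler_normB _ _))// mulrDl mul1r lerD// ger0_norm//.
  by rewrite (le_trans dlb)// ler_pM2l.
split => //.
- by rewrite (le_trans dlb)// ler_pM2l.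
- have -> : u ^+ 2 - z ^+ 2 = dl ^+ 2 - 2 * z * dl by rewrite /u; ring.
  rewrite (le_trans (ler_normB _ _))// [leLHS]addrC [leRHS]mulrDl; apply: lerD.
    rewrite !normrM (ger0_norm dl0) ger0_norm//.
    apply: (le_trans (y := 2 * `|z| * (b1 * s ^+ 2))); first by rewrite ler_wpM2l.
    rewrite (_ : 2 * `|z| * _ = 2 * b1 * (`|z| * s ^+ 2)); last by ring.
    by rewrite ler_pM2l ?mulr_gt0// exprS ler_pM.
  rewrite ger0_norm ?sqr_ge0//; apply: (le_trans (y := (b1 * s ^+ 2) ^+ 2)).
    by rewrite lerXn2r// nnegrE// mulr_ge0// ltW.
  by rewrite exprMn ler_wpM2l ?sqr_ge0// expr2 exprSr mulrC ler_pM.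
- rewrite -exprMn -(real_normK (num_real u)) lerXn2r// nnegrE.
  by rewrite mulr_ge0// addr_ge0// ltW.
Qed.

Lemma pot_shift_estimates (R : realType) (e b1 : R) : 0 < e -> 0 < b1 ->
  exists2 K : R, 0 <= K & forall s dl z y : R,
  0 < s -> s <= 1 -> 0 <= dl -> dl <= b1 * s ^+ 2 ->
  let F := pot e (y + (z - dl)) - pot e y in
  [/\ F <= dpot e y * (z - dl) + trap e (e + e ^+ 2) y * z ^+ 2 / 2
           + K * (`|z| + s) ^+ 3,
      dpot e y * (z - dl) + trap e e y * z ^+ 2 / 2
           - K * (`|z| + s) ^+ 3 <= F,
      `|F - dpot e y * z| <= K * (`|z| + s) ^+ 2 &
      `|F| <= K * (`|z| + s)].
Proof.
move=> e0 b10.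
have c0 : 0 < 4 * e by rewrite mulr_gt0.
have c3 : 0 < 4 * e ^+ 3 by rewrite mulr_gt0// exprn_gt0.
have b11 : 0 < 1 + b1 by rewrite addr_gt0.
pose k1 := (2 * b1 + b1 ^+ 2) / (4 * e) + (1 + b1) ^+ 3 / (4 * e ^+ 3).
pose k2 := b1 / 2 + (1 + b1) ^+ 2 / (4 * e).
pose k3 := (1 + b1) / 2.
have k10 : 0 <= k1.
  apply: addr_ge0; apply: divr_ge0; rewrite ?(ltW c0) ?(ltW c3)//.
    by rewrite addr_ge0 ?sqr_ge0// mulr_ge0// ltW.
  by rewrite exprn_ge0// ltW.
have k20 : 0 <= k2.
  by apply: addr_ge0; apply: divr_ge0; rewrite ?(ltW c0) ?sqr_ge0 ?(ltW b10).
have k30 : 0 <= k3 by rewrite divr_ge0// ltW.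
exists (k1 + k2 + k3); first exact: (addr_ge0 (addr_ge0 k10 k20) k30).
move=> s dl z y s0 s1 dl0 dlb F.
have [u1 u2 u3 u4] := shift_estimates z b10 s0 s1 dl0 dlb.
have [r1 r2 r3 r4] := pot_taylor e0 y (z - dl).
set v := `|z| + s in u1 u2 u3 u4 *; set u := z - dl in F u1 u2 u3 u4 r1 r2 r3 r4 *.
have v0 : 0 <= v by rewrite addr_ge0// ltW.
have vn n : 0 <= v ^+ n by rewrite exprn_ge0.
have kle k n : 0 <= k1 + k2 + k3 - k -> k * v ^+ n <= (k1 + k2 + k3) * v ^+ n.
  by rewrite subr_ge0 => ?; rewrite ler_wpM2r.
have k1v : k1 * v ^+ 3 <= (k1 + k2 + k3) * v ^+ 3 by apply: kle; lra.
have k2v : k2 * v ^+ 2 <= (k1 + k2 + k3) * v ^+ 2 by apply: kle; lra.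
have k3v : k3 * v <= (k1 + k2 + k3) * v by rewrite -(expr1 v); apply: kle; lra.
have uu3 : `|u| ^+ 3 / (4 * e ^+ 3) <= (1 + b1) ^+ 3 / (4 * e ^+ 3) * v ^+ 3.
  rewrite [leRHS]mulrAC ler_pM2r ?invr_gt0// -exprMn lerXn2r// nnegrE// mulr_ge0// ltW//.
have tr a : `|trap e a y * u ^+ 2 / 2 - trap e a y * z ^+ 2 / 2| <=
    (2 * b1 + b1 ^+ 2) / (4 * e) * v ^+ 3.
  rewrite (_ : _ - _ = trap e a y / 2 * (u ^+ 2 - z ^+ 2)); last by ring.
  have t0 : 0 <= trap e a y / 2 by rewrite mulr_ge0 ?invr_ge0//; exact: trap_ge0.
  rewrite normrM (ger0_norm t0) (_ : _ / _ * v ^+ 3 =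
    (2 * e)^-1 / 2 * ((2 * b1 + b1 ^+ 2) * v ^+ 3)); last first.
    by field; rewrite gt_eqF.
  apply: ler_pM => //; rewrite ler_pM2r ?invr_gt0//; exact: trap_le.
have k1E : k1 * v ^+ 3 = (2 * b1 + b1 ^+ 2) / (4 * e) * v ^+ 3
    + (1 + b1) ^+ 3 / (4 * e ^+ 3) * v ^+ 3 by rewrite mulrDl.
split.
- have := tr (e + e ^+ 2); rewrite ler_norml => /andP[t1 t2].
  by rewrite /F; lra.
- have := tr e; rewrite ler_norml => /andP[t1 t2].
  by rewrite /F; lra.
- have -> : F - dpot e y * z = (F - dpot e y * u) - dpot e y * dl.
    by rewrite /u; ring.
  rewrite (le_trans (ler_normB _ _))// (le_trans _ k2v)// [leLHS]addrC [leRHS]mulrDl lerD//.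
    rewrite normrM (ger0_norm dl0) (_ : _ / _ * _ = 2^-1 * (b1 * v ^+ 2)).
      by rewrite ler_pM// normr_dpot.
    by ring.
  rewrite ger0_norm//; apply: (le_trans r2).
  by rewrite [leRHS]mulrAC ler_pM2r// invr_gt0.
- rewrite (le_trans (pot_lip e0 _ _))// (le_trans _ k3v)// addrC addKr.
  by rewrite [leRHS]mulrAC ler_pM2r// invr_gt0.
Qed.

(** Both paths receive the same Gaussian [z], so their noise coefficients subtract before being
    squared; with equal weights the resulting bracket term vanishes where [dpot] agrees at [p] and
    [q]. The minus sign at [p] calls for the lower curvature bound [trap e e], the plus sign at [q]
    for the upper one. *)
Lemma pot_step_le (R : realType) (sg b1 b2 e l1 l2 : R) :
  0 < sg -> 0 < b2 -> b2 < b1 -> 0 < e -> 0 <= l1 -> 0 <= l2 ->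
  exists2 C : R, 0 <= C & forall s p q : R, 0 < s -> s <= 1 ->
  (\int[normal_prob 0 (sg * s)]_z
    (expR (- l1 * (pot e (p + (z - s ^+ 2 * slope b1 b2 p)) - pot e p)
           + l2 * (pot e (q + (z - s ^+ 2 * slope b1 b2 q)) - pot e q)))%:E <=
   (expR (l1 * (s ^+ 2 * (slope b1 b2 p * dpot e p)
                - (sg * s) ^+ 2 * trap e e p / 2)
          - l2 * (s ^+ 2 * (slope b1 b2 q * dpot e q)
                - (sg * s) ^+ 2 * trap e (e + e ^+ 2) q / 2)
          + (sg * s) ^+ 2 * (l2 * dpot e q - l1 * dpot e p) ^+ 2 / 2
          + C * s ^+ 3))%:E)%E.
Proof.
move=> sg0 b20 b21 e0 l10 l20.
have b10 : 0 < b1 by exact: lt_trans b21.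
have [k k0 Hk] := pot_shift_estimates e0 b10.
pose L := l1 + l2; have L0 : 0 <= L by rewrite addr_ge0.
have ie0 : 0 <= (2 * e)^-1 by rewrite invr_ge0 mulr_ge0// ltW.
pose K := L * (k + 2^-1 + (2 * e)^-1).
have K0 : 0 <= K by rewrite mulr_ge0// !addr_ge0.
have lek : L * k <= K by rewrite ler_wpM2l//; lra.
have le4 : L * 2^-1 <= K by rewrite ler_wpM2l//; lra.
have le5 : L * (2 * e)^-1 <= K by rewrite ler_wpM2l//; lra.
have [C C0 HC] := integral_normal_prob_expR_le sg0 K0.
exists C => // s p q s0 s1.
pose dl y : R := s ^+ 2 * slope b1 b2 y.
have dl0 y : 0 <= dl y.
  by rewrite mulr_ge0 ?sqr_ge0// /slope; case: ifP => _; rewrite ltW.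
have dlb y : dl y <= b1 * s ^+ 2.
  by rewrite /dl mulrC ler_wpM2r ?sqr_ge0// /slope; case: ifP => // _; rewrite ltW.
have comb x1 x2 B1 B2 : `|x1| <= B1 -> `|x2| <= B2 ->
    `|- l1 * x1 + l2 * x2| <= l1 * B1 + l2 * B2.
  move=> h1 h2; rewrite (le_trans (ler_normD _ _))// !normrM normrN.
  by rewrite (ger0_norm l10) (ger0_norm l20) lerD// ler_wpM2l.
have split_add (w : R) : 0 <= w -> l1 * (k * w) + l2 * (k * w) <= K * w.
  move=> w0; rewrite (_ : _ + _ = L * k * w); first exact: ler_wpM2r.
  by rewrite /L; ring.
apply: (le_trans (HC s (- l1 * dpot e p + l2 * dpot e q)
    (- l1 * trap e e p + l2 * trap e (e + e ^+ 2) q)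
    (l1 * (dl p * dpot e p) - l2 * (dl q * dpot e q)) _ s0 s1 _ _ _ _ _ _)).
- apply: (le_trans (comb _ _ _ _ (normr_dpot e p) (normr_dpot e q))).
  by rewrite -mulrDl.
- apply: (le_trans (comb _ _ (2 * e)^-1 (2 * e)^-1 _ _)).
  + by rewrite ger0_norm ?trap_ge0 ?trap_le.
  + by rewrite ger0_norm ?trap_ge0 ?trap_le.
  by rewrite -mulrDl.
- have mp y : measurable_fun setT (fun z : R => pot e (y + (z - dl y)) - pot e y).
    apply: measurable_funB => //; apply: measurableT_comp => //.
      exact: measurable_pot.
    by apply: measurable_funD => //; exact: measurable_funB.
  by apply: measurable_funD; apply: measurable_funM.
- move=> z; have [_ h1 _ _] := Hk s (dl p) z p s0 s1 (dl0 p) (dlb p).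
  have [h2 _ _ _] := Hk s (dl q) z q s0 s1 (dl0 q) (dlb q).
  have v3 : 0 <= (`|z| + s) ^+ 3 by rewrite exprn_ge0// addr_ge0// ltW.
  have := split_add _ v3.
  have := ler_wpM2l l10 h1; have := ler_wpM2l l20 h2.
  by rewrite /dl; lra.
- move=> z; have [_ _ h1 _] := Hk s (dl p) z p s0 s1 (dl0 p) (dlb p).
  have [_ _ h2 _] := Hk s (dl q) z q s0 s1 (dl0 q) (dlb q).
  rewrite (le_trans _ (split_add _ (sqr_ge0 _)))//.
  apply: le_trans (comb _ _ _ _ h1 h2).
  by rewrite le_eqVlt; apply/orP; left; apply/eqP; congr (`|_|); rewrite /dl; ring.
- move=> z; have [_ _ _ h1] := Hk s (dl p) z p s0 s1 (dl0 p) (dlb p).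
  have [_ _ _ h2] := Hk s (dl q) z q s0 s1 (dl0 q) (dlb q).
  rewrite (le_trans (comb _ _ _ _ h1 h2))// split_add// addr_ge0// ltW//.
rewrite lee_fin ler_expR le_eqVlt; apply/orP; left; apply/eqP; rewrite /dl; ring.
Qed.

(** * Exponential supermartingales of Euler schemes *)

Lemma ge0_integral_indep_pair d d1 d2 (T : measurableType d)
    (T1 : measurableType d1) (T2 : measurableType d2) (R : realType)
    (P : probability T R) (X : {RV P >-> T1}) (Y : {RV P >-> T2})
    (phi : T1 * T2 -> \bar R) :
  (forall A B, measurable A -> measurable B ->
    P (X @^-1` A `&` Y @^-1` B) = P (X @^-1` A) * P (Y @^-1` B))%E ->
  measurable_fun setT phi -> (forall z, 0 <= phi z)%E ->
  (\int[P]_w phi (X w, Y w) =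
   \int[distribution P X]_x \int[distribution P Y]_y phi (x, y))%E.
Proof.
move=> ind mphi phi0.
have mXY : measurable_fun setT (fun w => (X w, Y w)).
  exact: measurable_fun_pair.
have -> : (\int[P]_w phi (X w, Y w) =
    \int[pushforward P (fun w => (X w, Y w))]_z phi z)%E.
  by rewrite ge0_integral_pushforward.
rewrite -fubini_tonelli1//.
pose XY : {mfun T >-> (T1 * T2)%type} := mfun_Sub (mem_set mXY).
have XYE : XY = (fun w => (X w, Y w)) :> (T -> T1 * T2).
  exact: mfun_valP.
have := @product_measure_unique _ _ _ _ _ (distribution P X) (distribution P Y)
  (distribution P XY).
rewrite /distribution XYE => /(_ _) H.
apply: eq_measure_integral => A mA _; apply/esym; apply: H => //.
Qed.

(** A pi-system of rectangles generating the sigma-algebra of the first [n] increments; independence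
    is available as a product formula on exactly such sets. *)
Definition past d (T : measurableType d) (R : realType) (xi : nat -> T -> R)
    (n : nat) : set (set T) :=
  [set E | exists2 A : nat -> set R, (forall i, measurable (A i)) &
    E = \bigcap_(i < n) (xi i @^-1` A i)].

Section past_theory.
Context d (T : measurableType d) (R : realType) (P : probability T R).
Variable xi : nat -> {RV P >-> R}.
Hypothesis indep_xi : forall n (A : nat -> set R), (forall i, measurable (A i)) ->
  P (\bigcap_(i < n) (xi i @^-1` A i)) = (\prod_(i < n) P (xi i @^-1` A i))%E.

Lemma past_measurable n : past xi n `<=` measurable.
Proof.
move=> _ [A mA ->]; apply: bigcap_measurableType => // i _.
by rewrite -[_ @^-1` _]setTI; exact: measurable_funP.
Qed.

Lemma sigma_past_measurable n : <<s past xi n >> `<=` measurable.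
Proof.
by apply: smallest_sub; [exact: sigma_algebra_measurable|exact: past_measurable].
Qed.

Lemma past_setI_closed n : setI_closed (past xi n).
Proof.
move=> _ _ [A mA ->] [B mB ->]; exists (fun i => A i `&` B i).
  by move=> i; exact: measurableI.
by rewrite -bigcapI.
Qed.

Lemma past_indep n (E : set T) (A : set R) : <<s past xi n >> E ->
  measurable A -> P (E `&` xi n @^-1` A) = (P E * P (xi n @^-1` A))%E.
Proof.
move=> pE mA; set D := xi n @^-1` A.
have mD : measurable D by rewrite -[D]setTI; exact: measurable_funP.
suff : <<s past xi n >> `<=`
    [set E | measurable E /\ P (E `&` D) = (P E * P D)%E].
  by move=> /(_ _ pE)[].
apply: lambda_system_subset.
- exact: past_setI_closed.
- split => //.
  + by split => //; rewrite setTI probability_setT mul1e.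
  + move=> X Y YX [mX PX] [mY PY]; split; first exact: measurableD.
    have fin Z : measurable Z -> P Z \is a fin_num by exact: fin_num_measure.
    have lty Z : measurable Z -> (P Z < +oo)%E by move=> mZ; rewrite ltey_eq fin.
    have mXD := measurableI _ _ mX mD.
    have e1 : P (X `&` D `\` Y) = (P (X `&` D) - P (Y `&` D))%E.
      by rewrite measureD ?lty// setIAC (setIidr YX).
    have e2 : P (X `\` Y) = (P X - P Y)%E.
      by rewrite measureD ?lty// (setIidr YX).
    rewrite setDE setIAC -setDE e1 PX PY e2 muleBl ?fin//.
    by rewrite fin_num_adde_defr// fin.
  + move=> F ndF HF; split; first by apply: bigcup_measurable => k _; have [] := HF k.
    have mF k : measurable (F k) by have [] := HF k.
    have cF : P (F k) @[k --> \oo] --> P (\bigcup_k F k).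
      by apply: nondecreasing_cvg_mu => //; exact: bigcupT_measurable.
    have cFD : P (F k `&` D) @[k --> \oo] --> P (\bigcup_k F k `&` D).
      rewrite setI_bigcupl; apply: nondecreasing_cvg_mu => //.
      + by move=> k; exact: measurableI.
      + by apply: bigcupT_measurable => k; exact: measurableI.
      + move=> a b ab; apply/subsetPset; apply: setSI.
        by apply/subsetPset; exact: ndF.
    have FDE : (fun k => P (F k `&` D)) = (fun k => (P (F k) * P D)%E).
      by apply/funext => k; have [_ ->] := HF k.
    rewrite FDE in cFD; apply: (cvg_unique _ cFD) => //.
    by apply: cvgeZr => //; rewrite fin_num_measure.
- move=> E' [A' mA' ->]; split; first by apply: past_measurable; exists A'.
  (* Placing [A] in coordinate [n] turns the intersection with [D] into a rectangle in [n.+1]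
     coordinates, where the product formula applies. *)
  pose A'' i := if i == n then A else A' i.
  have mA'' i : measurable (A'' i) by rewrite /A''; case: ifP.
  have e1 : \bigcap_(i < n) (xi i @^-1` A' i) = \bigcap_(i < n) (xi i @^-1` A'' i).
    by apply: eq_bigcapr => i /= ltin; rewrite /A'' ltn_eqF.
  have e2 : xi n @^-1` A'' n = D by rewrite /A'' eqxx.
  have e3 : \bigcap_(i < n) (xi i @^-1` A'' i) `&` D =
      \bigcap_(i < n.+1) (xi i @^-1` A'' i).
    apply/seteqP; split=> w.
      move=> [Hw Dw] i /=; rewrite ltnS leq_eqVlt => /orP[/eqP->|]; last exact: Hw.
      by move: Dw; rewrite -e2.
    move=> Hw; split; last by rewrite -e2; exact: (Hw n (ltnSn n)).
    by move=> i /= ilt; apply: Hw => /=; exact: ltnW.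
  by rewrite e1 e3 !indep_xi// big_ord_recr/= e2.
- by [].
Qed.
End past_theory.

Section adapted.
Context d (T : measurableType d) (R : realType) (P : probability T R).
Variable xi : nat -> {RV P >-> R}.

Definition adapted dV (V : measurableType dV) (n : nat) (S : T -> V) :=
  measurable_fun setT (S : g_sigma_algebraType (past xi n) -> V).

Lemma pastS n : past xi n `<=` past xi n.+1.
Proof.
move=> _ [A mA ->]; exists (fun i => if i == n then setT else A i).
  by move=> i; case: ifP.
apply/seteqP; split=> w Hw i /=.
  rewrite ltnS leq_eqVlt => /orP[/eqP ->|ilt]; first by rewrite eqxx.
  by rewrite ltn_eqF//; exact: Hw.
by move=> ilt; have := Hw i (ltnW ilt); rewrite /= ltn_eqF.
Qed.

Lemma adaptedS dV (V : measurableType dV) n (S : T -> V) :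
  adapted n S -> adapted n.+1 S.
Proof.
move=> aS _ B mB; have := aS measurableT B mB.
apply: smallest_sub; first exact: smallest_sigma_algebra.
by apply: subset_trans (@sub_sigma_algebra _ _ _); exact: pastS.
Qed.

Lemma adapted_increment n : adapted n.+1 (xi n : T -> R).
Proof.
move=> _ B mB; rewrite setTI; apply: sub_sigma_algebra.
exists (fun i => if i == n then B else setT); first by move=> i; case: ifP.
apply/seteqP; split=> w /=; last by move=> /(_ n (ltnSn n)); rewrite /= eqxx.
by move=> Bw i _ /=; case: eqP => // ->.
Qed.

Hypothesis indep_xi : forall n (A : nat -> set R), (forall i, measurable (A i)) ->
  P (\bigcap_(i < n) (xi i @^-1` A i)) = (\prod_(i < n) P (xi i @^-1` A i))%E.
(** Conditional expectation is replaced by Tonelli's theorem. The identity map from [T] to [T] with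
    the sigma-algebra of the past is a random variable independent of [xi n], the product up to [n]
    is a function of it, and the inner integral over [xi n] is at most 1. *)
Lemma exp_supermartingale dV (V : measurableType dV) (S : nat -> T -> V)
    (h : nat -> V -> R -> R) :
  (forall n, adapted n (S n)) ->
  (forall n, measurable_fun setT (fun p : V * R => h n p.1 p.2)) ->
  (forall n v z, 0 <= h n v z) ->
  (forall n v, (\int[distribution P (xi n)]_z (h n v z)%:E <= 1)%E) ->
  forall n, (\int[P]_w (\prod_(i < n) h i (S i w) (xi i w))%:E <= 1)%E.
Proof.
move=> aS mh h0 hle.
pose W n w := \prod_(i < n) h i (S i w) (xi i w).
have W0 n w : 0 <= W n w by apply: prodr_ge0 => i _; exact: h0.
have WS n w : W n.+1 w = W n w * h n (S n w) (xi n w).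
  by rewrite /W big_ord_recr.
have aW n : adapted n (W n).
  elim: n => [|n IH].
    rewrite (_ : W 0%N = cst 1); first exact: measurable_cst.
    by apply/funext => w; rewrite /W big_ord0.
  rewrite (_ : W n.+1 = (fun w => W n w * h n (S n w) (xi n w))); last first.
    by apply/funext => w; exact: WS.
  apply: measurable_funM; first exact: adaptedS.
  apply: (@measurableT_comp _ _ _ _ _ _ (fun p : V * R => h n p.1 p.2) _
    (fun w : g_sigma_algebraType (past xi n.+1) => (S n w, xi n w))) => //.
  by apply: measurable_fun_pair; [exact: adaptedS|exact: adapted_increment].
elim=> [|n IH].
  under eq_integral do rewrite big_ord0.
  by rewrite integral_cst// mul1e; exact: probability_le1.
pose T' := g_sigma_algebraType (past xi n).
have mid : measurable_fun setT (id : T -> T').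
  move=> _ B mB; rewrite setTI preimage_id; exact: (@sigma_past_measurable _ _ _ P xi n B mB).
pose X : {RV P >-> T'} := mfun_Sub (mem_set mid).
have XE : X = id :> (T -> T') by exact: mfun_valP.
pose phi (p : T' * R) : \bar R := (W n p.1 * h n (S n p.1) p.2)%:E.
have mphi : measurable_fun setT phi.
  apply/measurable_EFinP; apply: measurable_funM.
    exact: (measurableT_comp (aW n)).
  apply: (@measurableT_comp _ _ _ _ _ _ (fun p : V * R => h n p.1 p.2) _
    (fun p : T' * R => (S n p.1, p.2))) => //.
  by apply: measurable_fun_pair => //; exact: (measurableT_comp (aS n)).
have phi0 p : (0 <= phi p)%E by rewrite lee_fin mulr_ge0.
have ind A B : measurable A -> measurable B ->
    P (X @^-1` A `&` xi n @^-1` B) = (P (X @^-1` A) * P (xi n @^-1` B))%E.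
  by move=> mA mB; rewrite XE; exact: past_indep.
have := ge0_integral_indep_pair ind mphi phi0.
rewrite XE /phi/= => E.
under eq_integral do rewrite -/(W n.+1 _) WS.
rewrite E.
have nuE x : (\int[distribution P (xi n)]_y (W n x * h n (S n x) y)%:E =
    (W n x)%:E * \int[distribution P (xi n)]_y (h n (S n x) y)%:E)%E.
  have mhx : measurable_fun setT (fun y : R => (h n (S n x) y)%:E).
    by apply/measurable_EFinP; exact: (measurable_fun_pair2 (S n x) (mh n)).
  under eq_integral do rewrite EFinM.
  by rewrite ge0_integralZl_EFin// => y _; rewrite lee_fin.
apply: (@le_trans _ _ (\int[distribution P X]_x (W n x)%:E)%E).
  apply: ge0_le_integral => //.
  - by move=> x _; apply: integral_ge0 => y _; exact: (phi0 (x, y)).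
  - exact: (measurable_fun_fubini_tonelli_F phi).
  - by apply/measurable_EFinP; exact: aW.
  - move=> x _; rewrite nuE -[leRHS]mule1 lee_wpmul2l// lee_fin W0//.
rewrite ge0_integral_distribution//; first by apply/measurable_EFinP; exact: aW.
by move=> y; rewrite lee_fin.
Qed.
End adapted.

Lemma ge0_integral_distribution_normal d (T : measurableType d) (R : realType)
    (P : probability T R) (xi : {RV P >-> R}) (m s : R) (f : R -> R) :
  (forall A : set R, measurable A -> P (xi @^-1` A) = normal_prob m s A) ->
  measurable_fun setT f -> (forall x, 0 <= f x) ->
  (\int[distribution P xi]_x (f x)%:E = \int[normal_prob m s]_x (f x)%:E)%E.
Proof.
move=> law mf f0.
(* [xi'] is [xi] retyped into [U]: the integral returns to [P], where the two agree, and then goes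
   to the law of [xi'], which is compared with [normal_prob]. *)
pose U : measurableType _ := measurableTypeR R.
have mxi : @measurable_fun _ _ T U setT xi by exact: (@measurable_funPT _ _ T R xi).
pose xi' : {RV P >-> U} := @mfun_Sub _ _ T U _ (mem_set mxi).
have mfU : measurable_fun setT (fun x : U => (f x)%:E) by exact/measurable_EFinP.
have mfR : measurable_fun setT (fun x : R => (f x)%:E) by exact/measurable_EFinP.
have fE x : (0 <= (f x)%:E)%E by rewrite lee_fin.
rewrite (ge0_integral_distribution xi mfR fE).
rewrite -(ge0_integral_distribution xi' mfU fE).
apply: eq_measure_integral => A mA _; exact: law.
Qed.

(** The scheme follows Y = B - X rather than X, so it is started at - x, and [slope] is the drift of
    X: [b1] for positive y, when X is below B. At y = 0, where [lipschitz_solution] prescribes no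
    derivative, it takes [b2]. *)
Fixpoint euler (R : realType) (b1 b2 dt : R) (dW : nat -> R) (y0 : R) (n : nat)
    : R :=
  if n is n'.+1 then
    let y := euler b1 b2 dt dW y0 n' in y + (dW n' - dt * slope b1 b2 y)
  else y0.

(* [energy_drift] is the exponent in [pot_step_le], so that for two Euler paths
   with the same Gaussian increments each step contributes to [energy] a factor
   of exponential moment at most 1. Here [s] is the square root of the mesh. *)
Definition energy_drift (R : realType) (sg b1 b2 e l1 l2 C s p q : R) : R :=
  l1 * (s ^+ 2 * (slope b1 b2 p * dpot e p) - (sg * s) ^+ 2 * trap e e p / 2)
  - l2 * (s ^+ 2 * (slope b1 b2 q * dpot e q)
          - (sg * s) ^+ 2 * trap e (e + e ^+ 2) q / 2)
  + (sg * s) ^+ 2 * (l2 * dpot e q - l1 * dpot e p) ^+ 2 / 2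
  + C * s ^+ 3.

Definition energy (R : realType) (sg b1 b2 e l1 l2 C s p q z : R) : R :=
  - l1 * (pot e (p + (z - s ^+ 2 * slope b1 b2 p)) - pot e p)
  + l2 * (pot e (q + (z - s ^+ 2 * slope b1 b2 q)) - pot e q)
  - energy_drift sg b1 b2 e l1 l2 C s p q.

Definition grid_increment (R : realType) (b : R -> R) (dt : R) (i : nat) : R :=
  b (i.+1%:R * dt) - b (i%:R * dt).

Section measurability_of_energy.
Context {R : realType}.

Lemma measurable_slope (b1 b2 : R) : measurable_fun setT (slope b1 b2).
Proof.
rewrite /slope; apply: measurable_fun_ifT => //.
exact: measurable_fun_ltr.
Qed.

Lemma measurable_dpot (e : R) : measurable_fun setT (dpot e).
Proof.
apply: measurable_maxr => //; apply: measurable_minr => //.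
exact: measurable_funM.
Qed.

Lemma measurable_trap (e a : R) : measurable_fun setT (trap e a).
Proof.
apply: measurable_funM => //; apply: measurable_maxr => //.
apply: measurable_minr => //; apply: measurable_funM => //.
exact: measurable_funB.
Qed.

Lemma measurable_energy (sg b1 b2 e l1 l2 C s : R) :
  measurable_fun setT (fun v : R * R * R =>
    energy sg b1 b2 e l1 l2 C s v.1.1 v.1.2 v.2).
Proof.
have mp : measurable_fun setT (fun v : R * R * R => v.1.1).
  exact: (measurableT_comp measurable_fst).
have mq : measurable_fun setT (fun v : R * R * R => v.1.2).
  exact: (measurableT_comp measurable_snd).
have mz : measurable_fun setT (fun v : R * R * R => v.2) by exact: measurable_snd.
have mpot (f : R * R * R -> R) : measurable_fun setT f ->
    measurable_fun setT (fun v => pot e (f v)).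
  by move=> mf; apply: measurableT_comp mf; exact: measurable_pot.
have mdpot (f : R * R * R -> R) : measurable_fun setT f ->
    measurable_fun setT (fun v => dpot e (f v)).
  by move=> mf; apply: measurableT_comp mf; exact: measurable_dpot.
have mslope (f : R * R * R -> R) : measurable_fun setT f ->
    measurable_fun setT (fun v => slope b1 b2 (f v)).
  by move=> mf; apply: measurableT_comp mf; exact: measurable_slope.
have mstep (f : R * R * R -> R) : measurable_fun setT f ->
    measurable_fun setT (fun v =>
      pot e (f v + (v.2 - s ^+ 2 * slope b1 b2 (f v))) - pot e (f v)).
  move=> mf; apply: measurable_funB; last exact: mpot.
  apply: mpot; apply: measurable_funD => //; apply: measurable_funB => //.
  by apply: measurable_funM => //; exact: mslope.
have mgain a (f : R * R * R -> R) : measurable_fun setT f ->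
    measurable_fun setT (fun v => s ^+ 2 * (slope b1 b2 (f v) * dpot e (f v))
      - (sg * s) ^+ 2 * trap e a (f v) / 2).
  move=> mf; apply: measurable_funB.
    apply: measurable_funM => //; apply: measurable_funM; first exact: mslope.
    exact: mdpot.
  apply: measurable_funM => //; apply: measurable_funM => //.
  by apply: measurableT_comp mf; exact: measurable_trap.
rewrite /energy /energy_drift; apply: measurable_funB.
  apply: measurable_funD; (apply: measurable_funM; first exact: measurable_cst).
    exact: (mstep _ mp).
  exact: (mstep _ mq).
apply: measurable_funD; last exact: measurable_cst.
apply: measurable_funD.
  apply: measurable_funB; (apply: measurable_funM; first exact: measurable_cst).
    exact: (mgain _ _ mp).
  exact: (mgain _ _ mq).
apply: measurable_funM; last exact: measurable_cst.
apply: measurable_funM; first exact: measurable_cst.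
apply: measurable_funX; apply: measurable_funB;
  (apply: measurable_funM; first exact: measurable_cst).
  exact: (mdpot _ mq).
exact: (mdpot _ mp).
Qed.
End measurability_of_energy.

Definition increment d (T : measurableType d) (R : realType)
    (P : probability T R) (B : R -> {RV P >-> R}) (s t : R) : {RV P >-> R} :=
  mfun_Sub (mem_set (measurable_funB (@measurable_funPT _ _ T R (B t))
                                     (@measurable_funPT _ _ T R (B s)))).

Section euler_energy.
Context d (T : measurableType d) (R : realType) (P : probability T R).
Variables (sg : R) (B : R -> {RV P >-> R}).
Hypotheses (sg0 : 0 < sg) (BM : two_sided_brownian_motion sg B).

Lemma increment_law s t (A : set R) : s < t -> measurable A ->
  P (increment B s t @^-1` A) = normal_prob 0 (sg * Num.sqrt (t - s)) A.
Proof.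
move=> st mA; have [_ _ + _] := BM => <-//.
Qed.

Lemma increment_indep (t : nat -> R) n (A : nat -> set R) :
  {homo t : i j / (i <= j)%N >-> i <= j} -> (forall i, measurable (A i)) ->
  P (\bigcap_(i < n) (increment B (t i) (t i.+1) @^-1` A i)) =
  (\prod_(i < n) P (increment B (t i) (t i.+1) @^-1` A i))%E.
Proof.
move=> ht mA; have [_ _ _ /(_ n t A ht mA)] := BM.
have E i : increment B (t i) (t i.+1) @^-1` A i =
    [set w | A i (B (t i.+1) w - B (t i) w)] by [].
rewrite (eq_bigcapr (fun i _ => E i)) => ->.
by apply: eq_bigr => i _; rewrite E.
Qed.

Lemma increment_grid_indep (dt : R) : 0 <= dt ->
  forall n (A : nat -> set R), (forall i, measurable (A i)) ->
  P (\bigcap_(i < n) (increment B (i%:R * dt) (i.+1%:R * dt) @^-1` A i)) =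
  (\prod_(i < n) P (increment B (i%:R * dt) (i.+1%:R * dt) @^-1` A i))%E.
Proof.
move=> dt0 n A mA; apply: (@increment_indep (fun i => i%:R * dt)) => //.
by move=> i j ij; rewrite ler_wpM2r// ler_nat.
Qed.

(** [C] is the constant of the one-step estimate and serves all meshes, starting points and ranges.
    Summing from [m] on means factors equal to 1 before step [m]; this gives access to increments of
    local time between two times. *)
Lemma euler_energy_le1 (b1 b2 e l1 l2 : R) :
  0 < b2 -> b2 < b1 -> 0 < e -> 0 <= l1 -> 0 <= l2 ->
  exists2 C : R, 0 <= C & forall (s x y : R) (m n : nat), 0 < s -> s <= 1 ->
  (\int[P]_w (expR (\sum_(i < n | (m <= i)%N)
     energy sg b1 b2 e l1 l2 C s
       (euler b1 b2 (s ^+ 2) (grid_increment (B ^~ w) (s ^+ 2)) x i)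
       (euler b1 b2 (s ^+ 2) (grid_increment (B ^~ w) (s ^+ 2)) y i)
       (grid_increment (B ^~ w) (s ^+ 2) i)))%:E <= 1)%E.
Proof.
move=> b20 b21 e0 l10 l20.
have [C C0 HC] := pot_step_le sg0 b20 b21 e0 l10 l20.
exists C => // s x y m n s0 s1.
pose xi i := increment B (i%:R * s ^+ 2) (i.+1%:R * s ^+ 2).
pose Y x w i := euler b1 b2 (s ^+ 2) (fun j => xi j w) x i.
pose h (i : nat) (v : R * R) (z : R) : R :=
  if (m <= i)%N then expR (energy sg b1 b2 e l1 l2 C s v.1 v.2 z) else 1.
pose S (i : nat) (w : T) : R * R := (Y x w i, Y y w i).
have mh i : measurable_fun setT (fun p : R * R * R => h i p.1 p.2).
  rewrite /h; case: (m <= i)%N => //.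
  by apply: measurableT_comp => //; exact: measurable_energy.
rewrite (eq_integral (fun w => (\prod_(i < n) h i (S i w) (xi i w))%:E));
  last by move=> w _; rewrite expR_sum big_mkcond.
have s20 : 0 <= s ^+ 2 by rewrite sqr_ge0.
apply: (exp_supermartingale (increment_grid_indep s20)) => //.
- have aY x0 i : adapted xi i (fun w => Y x0 w i).
    elim: i => [|i IH]; first exact: measurable_cst.
    rewrite /Y/=; apply: measurable_funD; first exact: adaptedS.
    apply: measurable_funB; first exact: adapted_increment.
    apply: measurable_funM; first exact: measurable_cst.
    apply: measurableT_comp; first exact: measurable_slope.
    exact: adaptedS.
  by move=> i; apply: measurable_fun_pair; exact: aY.
- by move=> i v z; rewrite /h; case: ifP => _ //; exact: expR_ge0.
move=> i [p q]; rewrite /h/=; case: (m <= i)%N; last first.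
  by rewrite integral_cst// mul1e; exact: probability_le1.
have me : measurable_fun setT (fun z => energy sg b1 b2 e l1 l2 C s p q z).
  exact: (measurable_fun_pair2 (p, q) (measurable_energy sg b1 b2 e l1 l2 C s)).
rewrite (@ge0_integral_distribution_normal _ _ _ _ _ 0 (sg * s)); first last.
- by move=> z; exact: expR_ge0.
- exact: measurableT_comp.
- move=> A mA; have ii : i%:R * s ^+ 2 < i.+1%:R * s ^+ 2.
    by rewrite ltr_pM2r ?exprn_gt0// ltr_nat.
  rewrite (increment_law ii mA) -natr1 mulrDl mul1r addrC addKr sqrtr_sqr.
  by rewrite gtr0_norm.
rewrite /energy; set X := energy_drift _ _ _ _ _ _ _ _ _ _.
under eq_integral => z _ do rewrite expRD mulrC EFinM.
rewrite ge0_integralZl_EFin ?expR_ge0//.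
- apply: (@le_trans _ _ ((expR (- X))%:E * (expR X)%:E)%E).
    by rewrite lee_wpmul2l ?lee_fin ?expR_ge0//; exact: HC.
  by rewrite -EFinM -expRD addNr expR0.
- apply/measurable_EFinP; apply: measurableT_comp => //.
  have mpot (a : R) : measurable_fun setT
      (fun z : R => pot e (a + (z - s ^+ 2 * slope b1 b2 a)) - pot e a).
    apply: measurable_funB => //; apply: measurableT_comp.
      exact: measurable_pot.
    by apply: measurable_funD => //; exact: measurable_funB.
  have mtot : measurable_fun setT (fun z : R =>
      - l1 * (pot e (p + (z - s ^+ 2 * slope b1 b2 p)) - pot e p) +
      l2 * (pot e (q + (z - s ^+ 2 * slope b1 b2 q)) - pot e q)).
    by apply: measurable_funD; apply: measurable_funM => //; exact: mpot.
  exact: mtot.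
Qed.
End euler_energy.

(** * Events that hold eventually *)

Section limit_events.
Context d (T : measurableType d) (R : realType) (P : probability T R).

Lemma probability_liminf_le (S : nat -> set T) (q : \bar R) :
  (forall n, measurable (S n)) -> (forall n, P (S n) <= q)%E ->
  (P (\bigcup_N \bigcap_(n in [set n | (N <= n)%N]) S n) <= q)%E.
Proof.
move=> mS Sq; pose F N := \bigcap_(n in [set n | (N <= n)%N]) S n.
have mF N : measurable (F N) by exact: bigcap_measurableType.
have cvgF : P (F N) @[N --> \oo] --> P (\bigcup_N F N).
  apply: nondecreasing_cvg_mu => //; first exact: bigcupT_measurable.
  move=> N M NM; apply/subsetPset => w Fw n /= Mn.
  by apply: Fw => /=; exact: leq_trans Mn.
rewrite -(cvg_lim _ cvgF)//; apply: lime_le; first by apply/cvg_ex; eexists; exact: cvgF.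
apply: nearW => N; apply: le_trans (Sq N); apply: le_measure; rewrite ?inE//.
by move=> w; apply => /=.
Qed.

(** Fatou's lemma for sets, twice: [j] will index the smoothing and [n] the mesh, so the rank from
    which [S j n] holds may depend on [j] and on the path. *)
Lemma probability_liminf2_le (A : set T) (S : nat -> nat -> set T) (q : \bar R) :
  measurable A -> (forall j n, measurable (S j n)) ->
  (forall j n, P (S j n) <= q)%E ->
  {ae P, forall w, A w -> exists J, forall j, (J <= j)%N ->
    exists N, forall n, (N <= n)%N -> S j n w} ->
  (P A <= q)%E.
Proof.
move=> mA mS Sq [N [mN PN0 AN]].
pose F j := \bigcup_N \bigcap_(n in [set n | (N <= n)%N]) S j n.
pose G := \bigcup_J \bigcap_(j in [set j | (J <= j)%N]) F j.
have mF j : measurable (F j).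
  by apply: bigcupT_measurable => n; exact: bigcap_measurableType.
have mG : measurable G.
  by apply: bigcupT_measurable => n; exact: bigcap_measurableType.
have Gq : (P G <= q)%E.
  by apply: probability_liminf_le => // j; exact: probability_liminf_le.
apply: (@le_trans _ _ (P (G `|` N))).
  apply: le_measure; rewrite ?inE//; first exact: measurableU.
  move=> w Aw; have [Nw|nNw] := pselect (N w); [by right|left].
  pose HA := contrapT (fun h => nNw (AN w h)).
  have [J HJ] := HA Aw.
  exists J => // j /= /HJ[M HM]; exists M => // n /= Mn; exact: HM.
have GN : (P (G `|` N) <= P G + P N)%E by exact: measureU2.
by rewrite (le_trans GN)// PN0 adde0.
Qed.

Lemma exp_markov (a : T -> R) (rho : R) : measurable_fun setT a ->
  (\int[P]_w (expR (a w))%:E <= 1)%E ->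
  (P [set w | (rho <= a w)%R] <= (expR (- rho))%:E)%E.
Proof.
move=> ma a1; pose D := [set w | rho <= a w].
have mD : measurable D.
  rewrite -[D]setTI; apply: measurable_fun_le => //; exact: measurable_cst.
have h : ((expR rho)%:E * P D <= 1)%E.
  rewrite -integral_cst//; apply: le_trans a1.
  apply: (@le_trans _ _ (\int[P]_(w in D) (expR (a w))%:E)%E).
    apply: ge0_le_integral => //.
    - by move=> w _; rewrite lee_fin expR_ge0.
    - by apply/measurable_EFinP; apply: measurable_funTS; exact: measurableT_comp.
    - by move=> w Dw; rewrite lee_fin ler_expR.
  apply: ge0_subset_integral => //.
  by apply/measurable_EFinP; exact: measurableT_comp.
have -> : P D = ((expR (- rho))%:E * ((expR rho)%:E * P D))%E.
  by rewrite muleA -EFinM -expRD addNr expR0 mul1e.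
by rewrite -[leRHS]mule1 lee_wpmul2l// lee_fin expR_ge0.
Qed.
End limit_events.

(** * Solutions and their Euler approximations *)

Section measure_up_to.
Context {R : realType}.
Local Notation mu := (@lebesgue_measure R).
Implicit Types (A : set R) (r s : R).

Definition up_to A r : set R := [set s | 0 <= s <= r /\ A s].
(** When [A] is the set where [|Y|] is at most [eps], this is convertible to
    [occupation_time Y r eps]. *)
Definition measure_up_to A r : R := fine (mu (up_to A r)).

Lemma up_toE A r : up_to A r = `[0, r] `&` A.
Proof. by apply/seteqP; split => s /=; rewrite /up_to/= in_itv. Qed.

Lemma measurable_up_to A r : measurable A -> measurable (up_to A r).
Proof. by move=> mA; rewrite up_toE; exact: measurableI. Qed.

Lemma up_to_fin A r : measurable A -> mu (up_to A r) \is a fin_num.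
Proof.
move=> mA; have mU := measurable_up_to r mA.
rewrite ge0_fin_numE//; apply: (@le_lt_trans _ _ (mu `[0, r])).
  by apply: le_measure; rewrite ?inE//= up_toE; exact: subIsetl.
by rewrite lebesgue_measure_itv/=; case: ifP => _; rewrite ?ltry// -EFinB ltry.
Qed.

Lemma measure_up_toE A r : measurable A ->
  (measure_up_to A r)%:E = mu (up_to A r).
Proof. by move=> mA; rewrite fineK// up_to_fin. Qed.

Lemma measure_up_to_ge0 A r : 0 <= measure_up_to A r.
Proof. by rewrite fine_ge0. Qed.

Lemma measure_up_to_sub A1 A2 r : measurable A1 -> measurable A2 ->
  A1 `<=` A2 -> measure_up_to A1 r <= measure_up_to A2 r.
Proof.
move=> m1 m2 A12; rewrite -lee_fin !measure_up_toE//.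
apply: le_measure; rewrite ?inE; [exact: measurable_up_to..|].
by rewrite !up_toE; exact: setIS.
Qed.

Let step A r s : measurable A -> 0 <= r -> r <= s ->
  mu (up_to A s) = (mu (up_to A r) + mu (`]r, s] `&` A))%E.
Proof.
move=> mA r0 rs; rewrite -measureU.
- congr (mu _); apply/seteqP; split => z; rewrite !up_toE /= !in_itv/=.
    move=> [/andP[z0 zs] Az]; have [zr|rz] := leP z r; [left|right] => //.
    by rewrite z0.
  by move=> [[/andP[z0 zr]]|[/andP[rz zs]]] Az; split => //; apply/andP; split; lra.
- exact: measurable_up_to.
- exact: measurableI.
- apply/seteqP; split => z //=; rewrite up_toE /= !in_itv/=.
  by move=> [[/andP[_ zr] _] [/andP[rz _] _]]; lra.
Qed.

Let mu_oc r s : r <= s -> mu `]r, s] = (s - r)%:E.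
Proof.
rewrite lebesgue_measure_itv/= lte_fin le_eqVlt => /orP[/eqP ->|->//].
by rewrite ltxx subrr.
Qed.

Lemma measure_up_to_le A r s : measurable A -> 0 <= r -> r <= s ->
  measure_up_to A s <= measure_up_to A r + (s - r).
Proof.
move=> mA r0 rs; rewrite -lee_fin EFinD !measure_up_toE// (step mA r0 rs).
rewrite leeD2l// -mu_oc//; apply: le_measure; rewrite ?inE//.
exact: measurableI.
Qed.

Lemma measure_up_to_ndecr A r s : measurable A -> 0 <= r -> r <= s ->
  measure_up_to A r <= measure_up_to A s.
Proof.
move=> mA r0 rs; rewrite -lee_fin !measure_up_toE// (step mA r0 rs).
by rewrite leeDl.
Qed.

Lemma measure_up_to_full A r s : measurable A -> 0 <= r -> r <= s ->
  (forall z, r < z <= s -> A z) ->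
  measure_up_to A s = measure_up_to A r + (s - r).
Proof.
move=> mA r0 rs Ars; apply: EFin_inj; rewrite EFinD !measure_up_toE//.
rewrite (step mA r0 rs) -mu_oc// setIidl// => z; rewrite /= in_itv/=; exact: Ars.
Qed.

Lemma measure_up_to_none A r s : measurable A -> 0 <= r -> r <= s ->
  (forall z, r < z <= s -> ~ A z) -> measure_up_to A s = measure_up_to A r.
Proof.
move=> mA r0 rs Ars; apply: EFin_inj; rewrite !measure_up_toE//.
rewrite (step mA r0 rs) (_ : _ `&` A = set0) ?measure0 ?adde0//.
by apply/seteqP; split => z //= [/= + Az]; rewrite in_itv/= => /Ars.
Qed.

Lemma measure_up_to0 A : measurable A -> measure_up_to A 0 = 0.
Proof.
move=> mA; apply/eqP; rewrite eq_le measure_up_to_ge0 andbT -lee_fin.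
rewrite measure_up_toE//; apply: (@le_trans _ _ (mu `[0, 0])).
  apply: le_measure; rewrite ?inE//; first exact: measurable_up_to.
  by rewrite up_toE; exact: subIsetl.
by rewrite lebesgue_measure_itv/= ltxx.
Qed.

End measure_up_to.

(** Continuous induction: by continuity the supremum of the points [s] with [h s <= h a] is such a
    point, and a step from it to any later point would contradict maximality unless it is [b]. *)
Lemma creeping (R : realType) (h : R -> R) (a b : R) : a <= b -> continuous h ->
  (forall s, a <= s -> s < b -> exists2 r, s < r <= b & h r <= h s) ->
  h b <= h a.
Proof.
move=> ab ch step; pose A := [set s | a <= s <= b /\ h s <= h a].
have Aa : A a by split; rewrite ?lexx.
have supA : has_sup A.
  by split; [exists a|exists b => s [/andP[]]].
have Ac : A (sup A).
  have cA : closed A.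
    rewrite (_ : A = [set` `[a, b]] `&` h @^-1` [set z | z <= h a]).
      apply: closedI; first exact: itv_closed.
      by apply: preimage_closed; [move=> z _; exact: ch|exact: closed_le].
    by apply/seteqP; split => s /=; rewrite in_itv.
  have := closure_sup (ex_intro _ a Aa) supA.2.
  by rewrite -((closure_id A).1 cA).
set c := sup A in Ac; have [/andP[ac cb] hc] := Ac.
have [bc|cb'] := leP b c; first by rewrite (le_trans _ hc)// (le_anti (introT andP (conj bc cb))).
have [r /andP[cr rb] hr] := step c ac cb'.
have : r <= c.
  apply: ub_le_sup; first by case: supA.
  by split; [rewrite rb andbT (le_trans ac)// ltW|rewrite (le_trans hr)].
by rewrite leNgt cr.
Qed.

Lemma continuous_of_lipschitz (R : realType) (h : R -> R) (C : R) :
  (forall s r, `|h s - h r| <= C * `|s - r|) -> continuous h.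
Proof.
move=> hC s; apply/cvgrPdist_le => eps eps0.
have C1 : 0 < `|C| + 1 by rewrite ltr_wpDl.
near=> r; apply: (le_trans (hC s r)).
apply: (@le_trans _ _ ((`|C| + 1) * `|s - r|)).
  by rewrite ler_wpM2r// (le_trans (ler_norm C))// lerDl.
rewrite -ler_pdivlMl//; near: r; apply/nbhs_ballP.
exists ((`|C| + 1)^-1 * eps) => /=; first by rewrite mulr_gt0 ?invr_gt0.
by move=> z /ltW.
Unshelve. all: by end_near. Qed.

(* The null set is covered by an open set [U] of measure [eta]; adding a multiple
   of [measure_up_to U] to the linear bound absorbs the behaviour of [F] there,
   where only the Lipschitz bound is available. *)
Lemma lipschitz_derive_le_off_null (R : realType) (F dF : R -> R) (K m a b : R)
    (Z : set R) :
  0 <= a -> a <= b -> (forall s r, `|F s - F r| <= K * `|s - r|) ->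
  measurable Z -> lebesgue_measure Z = 0%E ->
  (forall s, a <= s -> s < b -> ~ Z s ->
    is_derive s (1 : R) F (dF s) /\ dF s <= m) ->
  F b - F a <= m * (b - a).
Proof.
move=> a0 ab lipF mZ Z0 dFm.
have K0 : 0 <= K.
  by have := lipF 1 0; rewrite subr0 normr1 mulr1; apply: le_trans.
suff key eta : 0 < eta -> F b - F a <= (m + eta) * (b - a) + (K + `|m|) * eta.
  apply/ler_addgt0Pr => eps eps0.
  pose eta := eps / (b - a + (K + `|m|) + 1).
  have den : 0 < b - a + (K + `|m|) + 1.
    by rewrite ltr_wpDl// addr_ge0 ?subr_ge0// addr_ge0.
  have eta0 : 0 < eta by rewrite divr_gt0.
  apply: (le_trans (key _ eta0)).
  rewrite mulrDl -addrA lerD2l -mulrC -mulrDl mulrC.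
  have -> : eps = eta * (b - a + (K + `|m|) + 1) by rewrite divfK// gt_eqF.
  by rewrite ler_wpM2l ?(ltW eta0)//; lra.
move=> eta0.
have Zfin : (lebesgue_measure Z < +oo)%E by rewrite Z0.
have [U [oU ZU Ueta]] := lebesgue_regularity_outer mZ Zfin eta0.
have mU : measurable U by exact: open_measurable.
have Ule : (lebesgue_measure U <= eta%:E)%E.
  have -> : U = (U `\` Z) `|` Z by rewrite setUC setDUK.
  have mUZ : measurable (U `\` Z) by exact: measurableD.
  have := measureU2 (@lebesgue_measure R) mUZ mZ.
  by move=> /le_trans; apply; rewrite [X in (_ + X)%E]Z0 adde0 ltW.
(* Truncation at 0 makes [M] Lipschitz on the whole line, so that [h] is continuous everywhere, as
   [creeping] demands. *)
pose M s := measure_up_to U (Num.max s 0).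
have MC s r : `|M s - M r| <= 1 * `|s - r|.
  wlog sr : s r / s <= r.
    move=> H; have [/H//|/ltW/H] := leP s r.
    by rewrite distrC (distrC s).
  have s0 : 0 <= Num.max s 0 by rewrite le_max lexx orbT.
  have srm : Num.max s 0 <= Num.max r 0.
    by rewrite ge_max !le_max sr lexx !orbT.
  have h1 := measure_up_to_ndecr mU s0 srm.
  have h2 := measure_up_to_le mU s0 srm.
  have h3 : Num.max r 0 - Num.max s 0 <= r - s.
    by rewrite /Num.max; do !case: ifPn; lra.
  rewrite mul1r distrC (distrC s) !ger0_norm ?subr_ge0// /M; lra.
have ME s : 0 <= s -> M s = measure_up_to U s by move=> s0; rewrite /M max_l.
have MN s : M s <= eta.
  rewrite -lee_fin measure_up_toE// (le_trans _ Ule)//.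
  apply: le_measure; rewrite ?inE//; first exact: measurable_up_to.
  by rewrite up_toE; exact: subIsetr.
pose h s := F s - (m + eta) * s - (K + `|m|) * M s.
have ch : continuous h.
  apply: (@continuous_of_lipschitz _ _ (K + `|m + eta| + (K + `|m|))) => s r.
  rewrite (_ : h s - h r = (F s - F r) - (m + eta) * (s - r)
    - (K + `|m|) * (M s - M r)); last by rewrite /h; ring.
  rewrite (le_trans (ler_normB _ _))// [leRHS]mulrDl lerD//.
    rewrite (le_trans (ler_normB _ _))// [leRHS]mulrDl lerD//.
    by rewrite normrM.
  rewrite normrM ger0_norm ?addr_ge0// ler_wpM2l ?addr_ge0//.
  by rewrite -[leRHS]mul1r.
have hba : h b <= h a.
  apply: creeping => // s as_ sb; have s0 : 0 <= s by rewrite (le_trans a0).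
  have [Zs|nZs] := pselect (Z s).
    have /nbhs_ballP[del /= del0 Udel] : nbhs s U.
      by apply: open_nbhs_nbhs; split => //; exact: ZU.
    pose r := Num.min b (s + del / 2).
    have sr : s < r by rewrite lt_min sb/= ltrDl divr_gt0.
    have rb : r <= b by rewrite ge_min lexx.
    have rdel : r <= s + del / 2 by rewrite ge_min lexx orbT.
    exists r; first by rewrite sr.
    have r0 : 0 <= r by rewrite (le_trans s0)// ltW.
    have Mr : M r = M s + (r - s).
      rewrite !ME//; apply: measure_up_to_full => //; first exact: ltW.
      move=> z /andP[sz zr]; apply: Udel => /=; rewrite /ball/=.
      by rewrite distrC gtr0_norm ?subr_gt0//; lra.
    have Fr : F r - F s <= K * (r - s).
      have := lipF r s; rewrite (gtr0_norm (_ : 0 < r - s)) ?subr_gt0//.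
      by apply: le_trans; exact: ler_norm.
    have mm : - m * (r - s) <= `|m| * (r - s).
      by rewrite ler_wpM2r ?subr_ge0 ?(ltW sr)// -normrN ler_norm.
    have ee : 0 <= eta * (r - s) by rewrite mulr_ge0 ?subr_ge0 ?ltW.
    by rewrite /h Mr; lra.
  have [dFs dFsm] := dFm _ as_ sb nZs.
  have [dFs1 dFsE] := dFs.
  have dq : h^-1 *: ((F \o shift s) (h *: (1 : R)) - F s) @[h --> 0^'] --> dF s.
    by rewrite -dFsE; exact: dFs1.
  have dFs_lt : dF s < m + eta by rewrite (le_lt_trans dFsm)// ltrDl.
  have /nbhs_ballP[del /= del0 Hdel] : nbhs (0 : R) (fun h : R => h != 0 ->
      h^-1 *: ((F \o shift s) (h *: (1 : R)) - F s) < m + eta).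
    exact: cvgr_lt _ dq _ dFs_lt.
  pose z := Num.min (b - s) (del / 2).
  have z0 : 0 < z by rewrite lt_min subr_gt0 sb/= divr_gt0.
  have zb : z <= b - s by rewrite ge_min lexx.
  have zdel : z <= del / 2 by rewrite ge_min lexx orbT.
  have zd : z < del by lra.
  exists (s + z); first by rewrite ltrDl z0/= -lerBrDl.
  have := Hdel z; rewrite /ball/= sub0r normrN gtr0_norm// => /(_ zd).
  rewrite gt_eqF// => /(_ isT); rewrite /GRing.scale/= mulr1 /shift/=.
  rewrite -ltr_pdivlMl ?invr_gt0// invrK (addrC z) => Fz.
  have sz0 : 0 <= s + z by rewrite addr_ge0// ltW.
  have Mz : M s <= M (s + z).
    by rewrite !ME// measure_up_to_ndecr// lerDl ltW.
  have kM : (K + `|m|) * M s <= (K + `|m|) * M (s + z).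
    by rewrite ler_wpM2l// addr_ge0.
  by rewrite /h; lra.
have Ma : 0 <= M a by rewrite measure_up_to_ge0.
have kM : (K + `|m|) * (M b - M a) <= (K + `|m|) * eta.
  by rewrite ler_wpM2l ?addr_ge0//; have := MN b; lra.
by move: hba; rewrite /h; lra.
Qed.

(** * One solution against its Euler scheme *)

Section solution_path.
Context {R : realType} (b1 b2 : R) (b20 : 0 < b2) (b21 : b2 < b1).
Variables (b X : R -> R) (x t : R).
Hypotheses (cb : continuous b) (solX : lipschitz_solution b1 b2 b x X).
Let Y s := b s - X s.
Hypothesis null_zeros : lebesgue_measure [set s | 0 <= s <= t /\ `|Y s| <= 0] = 0%E.

Lemma solution_lipschitz : exists2 K : R, 0 <= K &
  forall s r, `|X s - X r| <= K * `|s - r|.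
Proof.
have [/pinfty_ex_gt0[K K0 HK] _ _ _] := solX.
by exists K; [exact: ltW|move=> s r; exact: (HK (s, r))].
Qed.

Lemma solution_continuous : continuous X.
Proof. by have [K _ HK] := solution_lipschitz; exact: continuous_of_lipschitz HK. Qed.

Lemma distance_continuous : continuous Y.
Proof. by move=> s; apply: cvgB; [exact: cb|exact: solution_continuous]. Qed.

Lemma measurable_level (a : R) : measurable [set s | `|Y s| <= a].
Proof.
apply: closed_measurable.
apply: (@preimage_closed _ _ (fun s => `|Y s|) [set z | z <= a]).
  by move=> s _; apply: continuous_comp; [exact: distance_continuous|exact: norm_continuous].
exact: closed_le.
Qed.

Let Z : set R := up_to [set s | `|Y s| <= 0] t.

(** Off the zeros of [Y] the derivative of [X] is [b1] or [b2]; on the zeros nothing is prescribed,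
    but they form a null set and [X] is Lipschitz. *)
Lemma solution_increment (s r : R) : 0 <= s -> s <= r -> r <= t ->
  b2 * (r - s) <= X r - X s <= b1 * (r - s).
Proof.
move=> s0 sr rt; have [K K0 HK] := solution_lipschitz.
have mZ : measurable Z by apply: measurable_up_to; exact: measurable_level.
have [_ _ dlt dgt] := solX.
pose dX z := if X z < b z then b1 else b2.
have derX z : s <= z -> z < r -> ~ Z z -> is_derive z (1 : R) X (dX z).
  move=> sz zr nZ; rewrite /dX; case: ifPn => [|]; first exact: dlt.
  rewrite -leNgt le_eqVlt => /orP[/eqP bX|]; last exact: dgt.
  exfalso; apply: nZ; split; first by lra.
  by rewrite /= /Y bX subrr normr0.
apply/andP; split; last first.
  apply: (@lipschitz_derive_le_off_null _ X dX K b1 s r Z) => // z sz zr nZ.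
  by split; [exact: derX|rewrite /dX; case: ifP => // _; exact: ltW].
have : (- X r) - (- X s) <= - b2 * (r - s).
  apply: (@lipschitz_derive_le_off_null _ (fun z => - X z) (fun z => - dX z)
    K (- b2) s r Z) => // [u v|z sz zr nZ].
    by rewrite -opprD normrN.
  split; first by have := derX z sz zr nZ => ?; exact: is_deriveN.
  by rewrite lerN2 /dX; case: ifP => // _; exact: ltW.
by rewrite mulNr; lra.
Qed.

Lemma solution_increment_above (s r : R) : s <= r ->
  (forall z, s <= z <= r -> 0 < Y z) -> X r - X s = b1 * (r - s).
Proof.
move=> sr Ypos; have [_ _ dlt _] := solX.
have [||z _ //] := @MVT_segment _ X (fun=> b1) s r sr; last first.
  by apply: continuous_subspaceT; exact: solution_continuous.
- move=> z; rewrite in_itv/= => /andP[sz zr]; apply: dlt.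
  by rewrite -subr_gt0 Ypos// !ltW.
Qed.

Lemma solution_increment_below (s r : R) : s <= r ->
  (forall z, s <= z <= r -> Y z < 0) -> X r - X s = b2 * (r - s).
Proof.
move=> sr Yneg; have [_ _ _ dgt] := solX.
have [||z _ //] := @MVT_segment _ X (fun=> b2) s r sr; last first.
  by apply: continuous_subspaceT; exact: solution_continuous.
- move=> z; rewrite in_itv/= => /andP[sz zr]; apply: dgt.
  by rewrite -subr_lt0 Yneg// !ltW.
Qed.

Variables (dt del : R).
Hypotheses (b00 : b 0 = 0) (dt0 : 0 <= dt).
Hypothesis osc : forall s r, 0 <= s -> s <= r -> r <= t -> r <= s + dt ->
  `|Y r - Y s| <= del.
Let y := euler b1 b2 dt (grid_increment b dt) (- x).

(** Errors do not accumulate and there is no Gronwall factor. While the error is at most [del], one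
    step adds at most [(b1 - b2) * dt]. Beyond [del], either the drifts reduce the error, or the
    scheme and, by [osc], [Y] throughout the step lie on the same side of 0, where both drifts
    coincide and the error is unchanged. *)
Lemma euler_close (i : nat) : i%:R * dt <= t ->
  `|y i - Y (i%:R * dt)| <= del + (b1 - b2) * dt.
Proof.
elim: i => [|i IH] it.
  have X0 : X 0 = x by have [] := solX.
  rewrite /y/= /Y mul0r b00 X0 sub0r subrr normr0.
  have t0 : 0 <= t by move: it; rewrite mul0r.
  have := osc (lexx 0) (lexx 0) t0; rewrite add0r subrr normr0 => /(_ dt0) ?.
  by rewrite addr_ge0// mulr_ge0// subr_ge0 ltW.
set s := i%:R * dt; set r := i.+1%:R * dt in it *.
have rE : r = s + dt by rewrite /r -natr1 mulrDl mul1r.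
have s0 : 0 <= s by rewrite mulr_ge0.
have sr : s <= r by rewrite rE lerDl.
have {}IH := IH (le_trans sr it).
have cdt : 0 <= (b1 - b2) * dt by rewrite mulr_ge0// subr_ge0 ltW.
have /andP[inc1 inc2] := solution_increment s0 sr it.
have rs : r - s = dt by rewrite rE addrC addKr.
rewrite rs in inc1 inc2.
have yS : y i.+1 - Y r = (y i - Y s) + (X r - X s) - dt * slope b1 b2 (y i).
  by rewrite /y /= -/y /grid_increment -/r -/s /Y; ring.
have Ynear z : s <= z <= r -> `|Y z - Y s| <= del.
  move=> /andP[sz zr]; apply: osc => //; first exact: le_trans it.
  by rewrite -rE.
have del0 : 0 <= del by rewrite (le_trans _ (Ynear s _)) ?lexx.
move: IH; rewrite !ler_norml yS => /andP[IH1 IH2].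
have sl : slope b1 b2 (y i) = b1 \/ slope b1 b2 (y i) = b2.
  by rewrite /slope; case: ifP => _; [left|right].
have d1 : dt * b2 <= dt * b1 by rewrite ler_wpM2l// ltW.
have [far|near] := leP (y i - Y s) (- del).
  (* the Euler path is far below: it cannot drift away any further *)
  have [yi|yi] := ltP 0 (y i).
    have Yp z : s <= z <= r -> 0 < Y z.
      by move=> /Ynear; rewrite ler_norml => /andP[h1 h2]; lra.
    have XE := solution_increment_above sr Yp; rewrite rs in XE.
    have -> : slope b1 b2 (y i) = b1 by rewrite /slope yi.
    by rewrite XE; apply/andP; split; lra.
  have -> : slope b1 b2 (y i) = b2 by rewrite /slope ltNge yi.
  by apply/andP; split; lra.
have [near2|far] := leP (y i - Y s) del.
  by case: sl => ->; apply/andP; split; lra.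
have [yi|yi] := ltP 0 (y i).
  have -> : slope b1 b2 (y i) = b1 by rewrite /slope yi.
  by apply/andP; split; lra.
have Yn z : s <= z <= r -> Y z < 0.
  by move=> /Ynear; rewrite ler_norml => /andP[h1 h2]; lra.
have XE := solution_increment_below sr Yn; rewrite rs in XE.
have -> : slope b1 b2 (y i) = b2 by rewrite /slope ltNge yi.
by rewrite XE; apply/andP; split; lra.
Qed.

Let dl := del + (del + (b1 - b2) * dt).

Lemma level_step (i : nat) z : i.+1%:R * dt <= t ->
  i%:R * dt < z <= i.+1%:R * dt -> `|y i - Y z| <= dl.
Proof.
move=> it /andP[iz zi].
have isi : i%:R * dt <= i.+1%:R * dt by rewrite ler_wpM2r// ler_nat.
have h1 := euler_close (le_trans isi it).
have h2 : `|Y z - Y (i%:R * dt)| <= del.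
  apply: osc; [exact: mulr_ge0|exact: ltW|exact: le_trans it|].
  by rewrite (le_trans zi)// -natr1 mulrDl mul1r.
rewrite (_ : y i - Y z = (y i - Y (i%:R * dt)) - (Y z - Y (i%:R * dt))); last by ring.
by rewrite (le_trans (ler_normB _ _))// /dl addrC lerD.
Qed.

(** Step by step: either [y k] lies on the plateau of [trap], where the right side gains the full
    [dt], or [Y] stays outside the shrunken level during the whole step. The reverse inequality
    exchanges plateau and support. *)
Lemma occupation_le_sum_trap (e a : R) (k : nat) : 0 < e -> k%:R * dt <= t ->
  occupation_time Y (k%:R * dt) (a - e ^+ 2 - dl) <=
  2 * e * \sum_(i < k) dt * trap e a (y i).
Proof.
move=> e0; rewrite -[occupation_time _ _ _]/(measure_up_to
  [set s | `|Y s| <= a - e ^+ 2 - dl] (k%:R * dt)).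
set A := [set s | _]; have mA : measurable A by exact: measurable_level.
elim: k => [|k IH] kt.
  by rewrite mul0r measure_up_to0// big_ord0 mulr0.
have ks : k%:R * dt <= k.+1%:R * dt by rewrite ler_wpM2r// ler_nat.
have k0 : 0 <= k%:R * dt by rewrite mulr_ge0.
have {}IH := IH (le_trans ks kt).
have kdt : k.+1%:R * dt - k%:R * dt = dt by rewrite -natr1 mulrDl mul1r addrC addKr.
rewrite big_ord_recr/= mulrDr.
have [yk|yk] := leP `|y k| (a - e ^+ 2).
  rewrite (le_trans (measure_up_to_le mA k0 ks))// kdt lerD// trap_top//.
  by rewrite mulrCA mulfV ?mulr1// gt_eqF// mulr_gt0.
rewrite (@measure_up_to_none _ A _ _ mA k0 ks); last first.
  move=> z zk /=; rewrite /A/= => Yz; have := level_step kt zk.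
  have := ler_normD (y k - Y z) (Y z); rewrite subrK; lra.
rewrite (le_trans IH)// lerDl; apply: mulr_ge0; first by rewrite mulr_ge0// ltW.
by apply: mulr_ge0 => //; exact: trap_ge0.
Qed.

Lemma sum_trap_le_occupation (e a : R) (k : nat) : 0 < e -> k%:R * dt <= t ->
  2 * e * \sum_(i < k) dt * trap e a (y i) <=
  occupation_time Y (k%:R * dt) (a + dl).
Proof.
move=> e0; rewrite -[occupation_time _ _ _]/(measure_up_to
  [set s | `|Y s| <= a + dl] (k%:R * dt)).
set A := [set s | _]; have mA : measurable A by exact: measurable_level.
elim: k => [|k IH] kt.
  by rewrite mul0r measure_up_to0// big_ord0 mulr0.
have ks : k%:R * dt <= k.+1%:R * dt by rewrite ler_wpM2r// ler_nat.
have k0 : 0 <= k%:R * dt by rewrite mulr_ge0.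
have {}IH := IH (le_trans ks kt).
have kdt : k.+1%:R * dt - k%:R * dt = dt by rewrite -natr1 mulrDl mul1r addrC addKr.
rewrite big_ord_recr/= mulrDr.
have [yk|yk] := leP a `|y k|.
  rewrite trap_out// !mulr0 addr0 (le_trans IH)//.
  exact: measure_up_to_ndecr.
rewrite (@measure_up_to_full _ A _ _ mA k0 ks); last first.
  move=> z zk; rewrite /A/=; have := level_step kt zk.
  have := ler_normB (y k) (y k - Y z); rewrite opprB addrC subrK; lra.
rewrite kdt lerD// mulrCA ler_piMr// mulrC -ler_pdivlMr ?mulr_gt0//.
by rewrite mul1r trap_le.
Qed.

End solution_path.

(** * Two Euler paths with the same noise *)

Definition sum_trap (R : realType) (e a dt : R) (y : nat -> R) (n : nat) : R :=
  \sum_(0 <= i < n) dt * trap e a (y i).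

Section euler_pair.
Context {R : realType} (b1 b2 : R) (b20 : 0 < b2) (b21 : b2 < b1).
Variable e : R.
Hypothesis e0 : 0 < e.

Let c := b1 - b2.
Let c0 : 0 < c. Proof. by rewrite subr_gt0. Qed.

Lemma dpot_ge0 y : 0 <= y -> 0 <= dpot e y.
Proof.
move=> y0; have := dpot_ndecr e0 y0.
by rewrite (dpot_small e0) ?normr0 ?(ltW e0)// mul0r.
Qed.

Lemma dpot_le0 y : y <= 0 -> dpot e y <= 0.
Proof.
by move=> y0; rewrite -oppr_ge0 -dpotN dpot_ge0// oppr_ge0.
Qed.

(** The jump of [slope] sits at the zero of [dpot], so the product is a continuous, piecewise linear
    function of [dpot] with slopes [b1] and [b2]. *)
Lemma slope_dpot_lip p q :
  `|slope b1 b2 p * dpot e p - slope b1 b2 q * dpot e q| <=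
  b1 * `|dpot e p - dpot e q|.
Proof.
have b10 : 0 < b1 := lt_trans b20 b21.
rewrite /slope; have [p0|p0] := ltP 0 p; have [q0|q0] := ltP 0 q.
- by rewrite -mulrBr normrM gtr0_norm.
- have fp := dpot_ge0 (ltW p0); have fq := dpot_le0 q0.
  have h : b1 * dpot e q <= b2 * dpot e q by rewrite ler_wnM2r// ltW.
  have h1 : 0 <= b1 * dpot e p by rewrite mulr_ge0// ltW.
  have h2 : b2 * dpot e q <= 0 by rewrite mulr_ge0_le0// ltW.
  rewrite !ger0_norm; lra.
- have fq := dpot_ge0 (ltW q0); have fp := dpot_le0 p0.
  have h : b1 * dpot e p <= b2 * dpot e p by rewrite ler_wnM2r// ltW.
  have h1 : 0 <= b1 * dpot e q by rewrite mulr_ge0// ltW.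
  have h2 : b2 * dpot e p <= 0 by rewrite mulr_ge0_le0// ltW.
  rewrite !ler0_norm; lra.
- by rewrite -mulrBr normrM gtr0_norm// ler_wpM2r// ltW.
Qed.

(** [dpot] differs from the indicator of y > 0 minus 1/2 only for [|y| <= e], where the normalized
    [trap] equals 1. If p <= 0 < q the difference of indicators is -1, but then the hypothesis puts
    both points in that zone and the two [trap] terms compensate. *)
Lemma dpot_diff_le p q : - e <= p - q ->
  `|dpot e p - dpot e q| <= (0 < p)%R%:R - (0 < q)%R%:R
    + 2 * e * trap e (e + e ^+ 2) p + 2 * e * trap e (e + e ^+ 2) q.
Proof.
move=> pq; have e20 : 0 < 2 * e by rewrite mulr_gt0.
pose u y := 2 * e * trap e (e + e ^+ 2) y.
have u0 y : 0 <= u y by apply: mulr_ge0; [exact: ltW|exact: trap_ge0].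
have u1 y : `|y| <= e -> u y = 1.
  by move=> ye; rewrite /u trap_top ?addrK// mulfV// gt_eqF.
have pos y : (0 < y)%R%:R = (if 0 < y then 1 else 0) :> R by case: ifP.
have step y : `|dpot e y - ((0 < y)%R%:R - 2^-1)| <= u y / 2.
  have [ye|ey] := leP `|y| e.
    rewrite (u1 _ ye) pos; have := normr_dpot e y; rewrite !ler_norml.
    have [/ltW/dpot_ge0|/dpot_le0] := ltP 0 y; lra.
  suff -> : dpot e y = (0 < y)%R%:R - 2^-1.
    by rewrite subrr normr0 divr_ge0.
  rewrite pos; have [y0|y0] := ltP 0 y.
    rewrite (gtr0_norm y0) in ey; rewrite dpot_large ?(ltW ey)//; lra.
  rewrite (ler0_norm y0) in ey; apply: oppr_inj.
  by rewrite -dpotN dpot_large ?(ltW ey)//; lra.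
rewrite -/(u p) -/(u q).
have := normr_dpot e p; have := normr_dpot e q.
have := step p; have := step q; have up := u0 p; have uq := u0 q.
rewrite !pos !ler_norml; have [p0|p0] := ltP 0 p; have [q0|q0] := ltP 0 q;
  try lra.
have -> : u p = 1 by apply: u1; rewrite ler0_norm//; lra.
have -> : u q = 1 by apply: u1; rewrite gtr0_norm//; lra.
lra.
Qed.

Variables (dt : R) (dW : nat -> R).
Hypotheses (dt0 : 0 <= dt) (cdt : c * dt <= e).

(** Euler paths can cross, because a straddling step removes [c * dt] from the gap however small the
    gap is. The overshoot is at most one such step, since a reversed straddling pair is pushed
    back. *)
Lemma euler_pair_bounds p0 q0 n : q0 <= p0 ->
  - (c * dt) <= euler b1 b2 dt dW p0 n - euler b1 b2 dt dW q0 n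
             <= p0 - q0 + c * dt.
Proof.
move=> pq; have cd0 : 0 <= c * dt by rewrite mulr_ge0// ltW.
elim: n => [|n] /=; first by lra.
set p := euler _ _ _ _ p0 n; set q := euler _ _ _ _ q0 n => /andP[h1 h2].
rewrite (_ : _ - _ = p - q - dt * (slope b1 b2 p - slope b1 b2 q)); last by ring.
have cE : c * dt = dt * (b1 - b2) by rewrite /c mulrC.
rewrite /slope; have [sp|sp] := ltP 0 p; have [sq|sq] := ltP 0 q;
  rewrite ?subrr ?mulr0; lra.
Qed.

(* The gap between two Euler paths changes only at the steps at which they
   straddle 0, and each such step changes it by [c * dt]. *)
Lemma sum_slope_indicator p0 q0 n :
  c * \sum_(0 <= i < n) dt * ((0 < euler b1 b2 dt dW p0 i)%R%:R
                              - (0 < euler b1 b2 dt dW q0 i)%R%:R) =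
  (p0 - q0) - (euler b1 b2 dt dW p0 n - euler b1 b2 dt dW q0 n).
Proof.
elim: n => [|n IH]; first by rewrite big_geq// mulr0 /= subrr.
rewrite big_nat_recr//= mulrDr IH /slope /c.
by case: ifP => _; case: ifP => _ /=; ring.
Qed.

Let sum_dpot_diff_le_sorted p0 q0 n : q0 <= p0 ->
  \sum_(0 <= i < n) dt * `|dpot e (euler b1 b2 dt dW p0 i)
                           - dpot e (euler b1 b2 dt dW q0 i)| <=
  (p0 - q0 + c * dt) / c
  + 2 * e * (\sum_(0 <= i < n) dt * trap e (e + e ^+ 2) (euler b1 b2 dt dW p0 i))
  + 2 * e * (\sum_(0 <= i < n) dt * trap e (e + e ^+ 2) (euler b1 b2 dt dW q0 i)).
Proof.
move=> pq; pose I i : R := dt * ((0 < euler b1 b2 dt dW p0 i)%R%:R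
                              - (0 < euler b1 b2 dt dW q0 i)%R%:R).
apply: (@le_trans _ _ (\sum_(0 <= i < n) (I i
   + 2 * e * (dt * trap e (e + e ^+ 2) (euler b1 b2 dt dW p0 i))
   + 2 * e * (dt * trap e (e + e ^+ 2) (euler b1 b2 dt dW q0 i))))).
  apply: ler_sum => i _; have /andP[h _] := euler_pair_bounds i pq.
  have /dpot_diff_le : - e <= euler b1 b2 dt dW p0 i - euler b1 b2 dt dW q0 i.
    (* The overshoot [c * dt] is at most [e], so a crossing can only happen inside the smoothing
       zone. *)
    by apply: le_trans h; rewrite lerN2.
  by move=> /(ler_wpM2l dt0); rewrite /I; lra.
rewrite !big_split/= -!mulr_sumr lerD2r lerD2r.
have E := sum_slope_indicator p0 q0 n; rewrite -mulr_sumr in E.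
rewrite ler_pdivlMr// [leLHS]mulrC E.
by have /andP[h _] := euler_pair_bounds n pq; lra.
Qed.

Lemma sum_dpot_diff_le p0 q0 n :
  \sum_(0 <= i < n) dt * `|dpot e (euler b1 b2 dt dW p0 i)
                           - dpot e (euler b1 b2 dt dW q0 i)| <=
  (`|p0 - q0| + c * dt) / c
  + 2 * e * (\sum_(0 <= i < n) dt * trap e (e + e ^+ 2) (euler b1 b2 dt dW p0 i))
  + 2 * e * (\sum_(0 <= i < n) dt * trap e (e + e ^+ 2) (euler b1 b2 dt dW q0 i)).
Proof.
have [qp|pq] := leP q0 p0.
  by rewrite ger0_norm ?subr_ge0//; exact: sum_dpot_diff_le_sorted.
rewrite distrC gtr0_norm ?subr_gt0//.
under eq_bigr do rewrite distrC.
by rewrite addrAC; apply: sum_dpot_diff_le_sorted; exact: ltW.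
Qed.

End euler_pair.

Lemma sum_telescope_lin (R : realType) (m n : nat) (a a' u v v' : nat -> R)
    (k1 k2 k3 k4 k5 : R) : (m <= n)%N ->
  \sum_(m <= i < n) (k1 * (a i.+1 - a i) + k2 * (a' i.+1 - a' i) - k3 * u i
                     + k4 * (v i - v' i) - k5) =
  k1 * (a n - a m) + k2 * (a' n - a' m) - k3 * (\sum_(m <= i < n) u i)
  + k4 * (\sum_(m <= i < n) v i - \sum_(m <= i < n) v' i) - (n%:R - m%:R) * k5.
Proof.
move=> mn; rewrite !big_split/= !sumrN sumr_const_nat -!mulr_sumr !telescope_sumr//.
by rewrite sumrB -[k5 *+ _]mulr_natl natrB.
Qed.

Section energy_bounds.
Context {R : realType} (sg b1 b2 e : R).
Hypotheses (sg0 : 0 < sg) (b20 : 0 < b2) (b21 : b2 < b1) (e0 : 0 < e).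
Variables (s : R) (dW : nat -> R) (l C : R).
Hypotheses (s0 : 0 < s) (l0 : 0 <= l).
Let dt := s ^+ 2.
Let dt0 : 0 <= dt. Proof. by rewrite /dt sqr_ge0. Qed.
Let Y y0 i := euler b1 b2 dt dW y0 i.

(** A discrete Tanaka formula. The potentials telescope and cost only the initial and final gaps, as
    [pot] is Lipschitz with constant 1/2; drift and bracket are both charged to the summed
    differences of [dpot], that is, to the straddling time and the time near 0. *)
Lemma energy_space_ge p0 q0 n : (b1 - b2) * dt <= e ->
  - l * (`|p0 - q0| + (b1 - b2) * dt)
  - (l * b1 + l ^+ 2 * sg ^+ 2 / 2) *
    ((`|p0 - q0| + (b1 - b2) * dt) / (b1 - b2) +
     2 * e * sum_trap e (e + e ^+ 2) dt (Y p0) n +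
     2 * e * sum_trap e (e + e ^+ 2) dt (Y q0) n)
  + l * sg ^+ 2 / 2 *
    (sum_trap e e dt (Y p0) n - sum_trap e (e + e ^+ 2) dt (Y q0) n)
  - n%:R * dt * (C * s) <=
  \sum_(0 <= i < n) energy sg b1 b2 e l l C s (Y p0 i) (Y q0 i) (dW i).
Proof.
move=> cdt; set D0 := `|p0 - q0|.
set tp := sum_trap e e _ _ _; set tq := sum_trap e (e + e ^+ 2) _ (Y q0) _.
set A := _ + 2 * e * tq.
have Ale : \sum_(0 <= i < n) dt * `|dpot e (Y p0 i) - dpot e (Y q0 i)| <= A.
  exact: sum_dpot_diff_le.
have lk : 0 <= l * b1 + l ^+ 2 * sg ^+ 2 / 2.
  rewrite addr_ge0 ?mulr_ge0 ?sqr_ge0// ltW//; exact: lt_trans b21.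
have one i : - l * (pot e (Y p0 i.+1) - pot e (Y p0 i))
   + l * (pot e (Y q0 i.+1) - pot e (Y q0 i))
   - (l * b1 + l ^+ 2 * sg ^+ 2 / 2) * (dt * `|dpot e (Y p0 i) - dpot e (Y q0 i)|)
   + l * sg ^+ 2 / 2 * (dt * trap e e (Y p0 i) - dt * trap e (e + e ^+ 2) (Y q0 i))
   - dt * (C * s) <=
   energy sg b1 b2 e l l C s (Y p0 i) (Y q0 i) (dW i).
  rewrite /energy /energy_drift -[Y p0 i.+1]/(Y p0 i + (dW i - dt * slope b1 b2 (Y p0 i))).
  rewrite -[Y q0 i.+1]/(Y q0 i + (dW i - dt * slope b1 b2 (Y q0 i))).
  set p := Y p0 i; set q := Y q0 i.
  have sl := slope_dpot_lip b20 b21 e0 p q.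
  have {}sl : slope b1 b2 p * dpot e p - slope b1 b2 q * dpot e q <=
    b1 * `|dpot e p - dpot e q| := le_trans (ler_norm _) sl.
  have h1 := ler_wpM2l dt0 sl; have {}h1 := ler_wpM2l l0 h1.
  have d1 : `|dpot e p - dpot e q| <= 1.
    rewrite (le_trans (ler_normB _ _))//.
    by have := normr_dpot e p; have := normr_dpot e q; lra.
  (* A difference at most 1 dominates its own square, so the linear bound on the straddling time
     also bounds the bracket. *)
  have d2 : (l * dpot e q - l * dpot e p) ^+ 2 <= l ^+ 2 * `|dpot e p - dpot e q|.
    rewrite -mulrBr exprMn ler_wpM2l ?sqr_ge0//.
    by rewrite -sqrrN opprB -(real_normK (num_real _)) expr2 ler_piMr.
  have h2 : (sg * s) ^+ 2 / 2 * (l * dpot e q - l * dpot e p) ^+ 2 <=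
      (sg * s) ^+ 2 / 2 * (l ^+ 2 * `|dpot e p - dpot e q|).
    by rewrite ler_wpM2l// divr_ge0// sqr_ge0.
  by rewrite /dt in h1 *; lra.
apply: le_trans (ler_sum (index_iota 0 n) (fun i _ => one i)).
rewrite (sum_telescope_lin (fun i => pot e (Y p0 i)) (fun i => pot e (Y q0 i))
  (fun i => dt * `|dpot e (Y p0 i) - dpot e (Y q0 i)|)
  (fun i => dt * trap e e (Y p0 i))
  (fun i => dt * trap e (e + e ^+ 2) (Y q0 i)))// subr0.
rewrite -/(sum_trap e e dt (Y p0) n) -/(sum_trap e (e + e ^+ 2) dt (Y q0) n).
rewrite -/tp -/tq.
have kA := ler_wpM2l lk Ale.
have Dn : `|Y p0 n - Y q0 n| <= D0 + (b1 - b2) * dt.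
  rewrite /D0; have [qp|pq] := leP q0 p0.
    have := euler_pair_bounds b21 dW dt0 n qp; rewrite -/(Y p0 n) -/(Y q0 n).
    by rewrite (ger0_norm (_ : 0 <= p0 - q0)) ?subr_ge0// ler_norml; lra.
  have := euler_pair_bounds b21 dW dt0 n (ltW pq); rewrite -/(Y p0 n) -/(Y q0 n).
  by rewrite (distrC p0) (gtr0_norm (_ : 0 < q0 - p0)) ?subr_gt0// ler_norml; lra.
have h1 : `|pot e (Y p0 n) - pot e (Y q0 n)| <= (D0 + (b1 - b2) * dt) / 2.
  by rewrite (le_trans (pot_lip e0 _ _))// ler_pM2r ?invr_gt0.
have h2 : `|pot e (Y p0 0) - pot e (Y q0 0)| <= D0 / 2 by exact: pot_lip.
have {}h1 : l * (pot e (Y p0 n) - pot e (Y q0 n)) <= l * ((D0 + (b1 - b2) * dt) / 2).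
  by rewrite ler_wpM2l// (le_trans (ler_norm _)).
have {}h2 : - l * (D0 / 2) <= l * (pot e (Y p0 0) - pot e (Y q0 0)).
  rewrite mulNr -mulrN ler_wpM2l// lerNl (le_trans (ler_norm _))// normrN//.
have c0 : 0 <= b1 - b2 by rewrite subr_ge0 ltW.
have cd : 0 <= l * ((b1 - b2) * dt) by exact: (mulr_ge0 l0 (mulr_ge0 c0 dt0)).
lra.
Qed.

(** With second weight 0 there is no cancellation between paths: drift and bracket are bounded by
    the elapsed time, and the telescoping potential by the displacement of the path. *)
Lemma energy_time_ge p0 q0 m n : (m <= n)%N -> 0 <= C ->
  - l * (`|Y p0 n - Y p0 m| / 2)
  - (l * b1 + l ^+ 2 * sg ^+ 2) * ((n%:R - m%:R) * dt)
  + l * sg ^+ 2 / 2 *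
    (sum_trap e e dt (Y p0) n - sum_trap e e dt (Y p0) m) - n%:R * dt * (C * s) <=
  \sum_(m <= i < n) energy sg b1 b2 e l 0 C s (Y p0 i) (Y q0 i) (dW i).
Proof.
move=> mn C0; set tn := sum_trap _ _ _ _ n; set tm := sum_trap _ _ _ _ m.
have one i : - l * (pot e (Y p0 i.+1) - pot e (Y p0 i)) + 0 * (0 - 0) - 0 * 0
   + l * sg ^+ 2 / 2 * (dt * trap e e (Y p0 i) - 0)
   - ((l * b1 + l ^+ 2 * sg ^+ 2) * dt + dt * (C * s)) <=
   energy sg b1 b2 e l 0 C s (Y p0 i) (Y q0 i) (dW i).
  rewrite /energy /energy_drift -[Y p0 i.+1]/(Y p0 i + (dW i - dt * slope b1 b2 (Y p0 i))).
  rewrite !mul0r; set p := Y p0 i.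
  have b10 : 0 < b1 := lt_trans b20 b21.
  have f1 : `|dpot e p| <= 1 by rewrite (le_trans (normr_dpot e p))//; lra.
  have sl : slope b1 b2 p * dpot e p <= b1.
    rewrite (le_trans (ler_norm _))// normrM -[leRHS]mulr1 ler_pM//.
    by rewrite /slope; case: ifP => _; rewrite gtr0_norm// ltW.
  have h1 := ler_wpM2l dt0 sl; have {}h1 := ler_wpM2l l0 h1.
  have d2 : (0 - l * dpot e p) ^+ 2 <= l ^+ 2.
    rewrite sub0r sqrrN exprMn ler_piMr ?sqr_ge0//.
    by rewrite -(real_normK (num_real _)) exprn_ile1.
  have h2 : (sg * s) ^+ 2 / 2 * (0 - l * dpot e p) ^+ 2 <= (sg * s) ^+ 2 / 2 * l ^+ 2.
    by rewrite ler_wpM2l// divr_ge0// sqr_ge0.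
  have h3 : 0 <= (sg * s) ^+ 2 * l ^+ 2 by rewrite mulr_ge0 ?sqr_ge0.
  by rewrite /dt in h1 *; lra.
apply: le_trans (ler_sum (index_iota m n) (fun i _ => one i)).
rewrite (sum_telescope_lin (fun i => pot e (Y p0 i)) (fun=> 0) (fun=> 0)
  (fun i => dt * trap e e (Y p0 i)) (fun=> 0))// !big1_eq !mul0r !subr0.
have -> : \sum_(m <= i < n) dt * trap e e (Y p0 i) = tn - tm.
  by rewrite /tn /tm /sum_trap [in RHS](big_cat_nat (m := 0) (n := m) (p := n))//= addrAC subrr add0r.
have h1 := pot_lip e0 (Y p0 n) (Y p0 m).
have {}h1 : l * (pot e (Y p0 n) - pot e (Y p0 m)) <= l * (`|Y p0 n - Y p0 m| / 2).
  by rewrite ler_wpM2l// (le_trans (ler_norm _)).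
have h2 : 0 <= m%:R * (dt * (C * s)).
  by rewrite mulr_ge0// mulr_ge0// mulr_ge0// ltW.
lra.
Qed.

End energy_bounds.

(** * Tail bounds for local time increments *)

Lemma continuous_dist_lt (R : realType) (Y : R -> R) (s del : R) :
  {for s, continuous Y} -> 0 < del -> exists2 d, 0 < d &
  forall r, `|r - s| < d -> `|Y r - Y s| < del.
Proof.
move=> cY del0.
have /nbhs_ballP[d /= d0 Hd] : nbhs s (fun r => `|Y s - Y r| < del).
  by have /cvgrPdist_lt/(_ _ del0) := cY.
exists d => // r rs; rewrite distrC; apply: Hd.
by rewrite /ball/= distrC.
Qed.

Lemma continuous_uniform_on_itv (R : realType) (Y : R -> R) (a b del : R) :
  continuous Y -> 0 < del -> exists2 d, 0 < d &
  forall s r, a <= s <= b -> `|r - s| <= d -> `|Y r - Y s| <= del.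
Proof.
move=> cY del0; have del20 : 0 < del / 2 by rewrite divr_gt0.
pose Q d s := forall r, `|r - s| <= d -> `|Y r - Y s| <= del.
have cov : forall s, `[a, b]%classic s ->
    \forall s' \near s & d \near (0 : R)^'+, Q d s'.
  move=> s _; have [d d0 Hd] := continuous_dist_lt (cY s) del20.
  have d20 : 0 < d / 2 by rewrite divr_gt0.
  exists (ball s (d / 2), [set z | z < d / 2]) => /=.
    by split; [exact: nbhsx_ballx|exact: nbhs_right_lt].
  move=> [s' z] /= [bs' zd] r rs'; rewrite /ball/= distrC in bs'.
  have h1 : `|Y s' - Y s| < del / 2 by apply: Hd; lra.
  have h2 : `|Y r - Y s| < del / 2.
    by apply: Hd; have := ler_normD (r - s') (s' - s); rewrite addrA subrK; lra.
  have := ler_normB (Y r - Y s) (Y s' - Y s).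
  by rewrite (_ : Y r - Y s - (Y s' - Y s) = Y r - Y s'); [lra|ring].
have cpt : near_covering (`[a, b]%classic : set R).
  by apply/compact_near_coveringP; exact: segment_compact.
have /nbhs_ballP[d /= d0 Hd] : nbhs (0 : R) (fun d => 0 < d ->
    `[a, b]%classic `<=` Q d).
  exact: (cpt R ((0 : R)^'+) Q _ cov).
exists (d / 2); first by rewrite divr_gt0.
move=> s r sab; apply: Hd => //; rewrite ?divr_gt0//.
by rewrite /ball/= sub0r normrN gtr0_norm ?divr_gt0//; lra.
Qed.

Section local_time_limits.
Context {R : realType} (sg : R) (sg0 : 0 < sg).

Lemma local_time_dist (Y : R -> R) (t L eta : R) :
  is_local_time sg Y t L -> 0 < eta -> exists2 e1, 0 < e1 &
  forall e, 0 < e -> e < e1 ->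
    `|sg ^+ 2 / (4 * e) * occupation_time Y t e - L| <= eta.
Proof.
move=> LT eta0.
have /nbhs_ballP[d /= d0 Hd] : nbhs (0 : R) (fun e => 0 < e ->
    `|L - sg ^+ 2 / (4 * e) * occupation_time Y t e| <= eta).
  by have /cvgrPdist_le/(_ _ eta0) := LT.
exists d => // e e0 ed; rewrite distrC; apply: Hd => //.
by rewrite /ball/= sub0r normrN gtr0_norm.
Qed.

Lemma local_time_occupation_le (Y : R -> R) (t L : R) :
  is_local_time sg Y t L -> exists2 e1, 0 < e1 &
  forall e, 0 < e -> e < e1 ->
    occupation_time Y t e <= 4 * (`|L| + 1) / sg ^+ 2 * e.
Proof.
move=> /local_time_dist/(_ ltr01)[e1 e10 He1]; exists e1 => // e e0 ee1.
have h := He1 e e0 ee1.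
have {}h : sg ^+ 2 / (4 * e) * occupation_time Y t e <= `|L| + 1.
  by move: h; rewrite ler_norml => /andP[_]; have := ler_norm L; lra.
have k0 : 0 < 4 * e / sg ^+ 2 by rewrite divr_gt0 ?exprn_gt0 ?mulr_gt0.
have := ler_wpM2l (ltW k0) h.
rewrite (_ : _ * (_ * _) = occupation_time Y t e); last first.
  by field; rewrite !gt_eqF.
by move=> /le_trans; apply; rewrite le_eqVlt; apply/orP; left; apply/eqP; field; rewrite gt_eqF.
Qed.

Lemma local_time_sandwich (Y : R -> R) (t L eta : R) :
  is_local_time sg Y t L -> 0 < eta -> exists2 e1, 0 < e1 &
  forall e, 0 < e -> e < e1 ->
  [/\ L - eta <= sg ^+ 2 / (4 * e) * occupation_time Y t (e - 2 * e ^+ 2),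
      sg ^+ 2 / (4 * e) * occupation_time Y t (e + 2 * e ^+ 2) <= L + eta &
      occupation_time Y t (e + 2 * e ^+ 2) <= eta].
Proof.
move=> LT eta0; have eta20 : 0 < eta / 2 by rewrite divr_gt0.
have [e1 e10 He1] := local_time_dist LT eta20.
have [e2 e20 He2] := local_time_occupation_le LT.
have sg20 : 0 < sg ^+ 2 by rewrite exprn_gt0.
pose A := `|L| + eta / 2; have A0 : 0 < A by rewrite ltr_wpDl.
pose K := 4 * (`|L| + 1) / sg ^+ 2.
have K0 : 0 < K by rewrite divr_gt0// mulr_gt0// ltr_wpDl.
(* The first three bounds keep the perturbed levels positive and in the range of the two estimates;
   [eta / (4 * A)] pays for the relative error [2 * e], and [eta / (2 * K)] makes the occupation
   time itself small. *)
pose e3 := Num.min (Num.min (e1 / 2) (e2 / 2)) (Num.min (4^-1)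
   (Num.min (eta / (4 * A)) (eta / (2 * K)))).
have p1 : 0 < e1 / 2 by rewrite divr_gt0.
have p2 : 0 < e2 / 2 by rewrite divr_gt0.
have p3 : 0 < 4^-1 :> R by rewrite invr_gt0.
have p4 : 0 < eta / (4 * A) by rewrite divr_gt0// mulr_gt0.
have p5 : 0 < eta / (2 * K) by rewrite divr_gt0// mulr_gt0.
have e30 : 0 < e3 by rewrite /e3 !lt_min p1 p2 p3 p4 p5.
exists e3 => // e e0; rewrite !lt_min => /andP[/andP[h1 h2] /andP[h3 /andP[h4 h5]]].
have e2e : e ^+ 2 <= e / 4.
  by rewrite expr2 ler_wpM2l ?(ltW e0)// (ltW h3).
have e2p : 0 < e ^+ 2 by rewrite exprn_gt0.
have eA : 2 * e * A <= eta / 2.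
  by move: h4; rewrite ltr_pdivlMr ?mulr_gt0//; lra.
have eK : K * (2 * e) <= eta.
  rewrite (_ : K * (2 * e) = e * (2 * K)); last by ring.
  by rewrite -ler_pdivlMr ?(ltW h5)// mulr_gt0.
have bnd e' : 0 < e' -> e' < e1 ->
    L - eta / 2 <= sg ^+ 2 / (4 * e') * occupation_time Y t e' <= L + eta / 2.
  move=> e'0 e'1; have := He1 e' e'0 e'1; set l := sg ^+ 2 / _ * _.
  by rewrite ler_norml => /andP[u v]; apply/andP; split; lra.
have absL : L <= `|L| by exact: ler_norm.
have absL' : - L <= `|L| by rewrite -normrN ler_norm.
split.
- have e'0 : 0 < e - 2 * e ^+ 2 by lra.
  have /andP[lo hi] : L - eta / 2 <= sg ^+ 2 / (4 * (e - 2 * e ^+ 2)) *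
      occupation_time Y t (e - 2 * e ^+ 2) <= L + eta / 2 by apply: bnd => //; lra.
  set l := sg ^+ 2 / _ * _ in lo hi.
  rewrite (_ : sg ^+ 2 / (4 * e) * _ = l - 2 * e * l); last first.
    by rewrite /l; field; rewrite !gt_eqF.
  have : 2 * e * l <= 2 * e * A by rewrite ler_wpM2l ?mulr_ge0 ?(ltW e0)// /A; lra.
  lra.
- have e'0 : 0 < e + 2 * e ^+ 2 by lra.
  have /andP[lo hi] : L - eta / 2 <= sg ^+ 2 / (4 * (e + 2 * e ^+ 2)) *
      occupation_time Y t (e + 2 * e ^+ 2) <= L + eta / 2 by apply: bnd => //; lra.
  set l := sg ^+ 2 / _ * _ in lo hi.
  rewrite (_ : sg ^+ 2 / (4 * e) * _ = l + 2 * e * l); last first.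
    by rewrite /l; field; rewrite !gt_eqF.
  have : 2 * e * l <= 2 * e * A by rewrite ler_wpM2l ?mulr_ge0 ?(ltW e0)// /A; lra.
  lra.
- have e'0 : 0 < e + 2 * e ^+ 2 by lra.
  apply: (le_trans (He2 _ e'0 _)); first by lra.
  rewrite -/K; apply: le_trans eK; rewrite ler_wpM2l ?(ltW K0)//; lra.
Qed.

(** A finite local time forces the occupation time of the level [e] to be of order [e], hence the
    zeros to be null. This settles the drift at the times where [lipschitz_solution] leaves it
    open. *)
Lemma local_time_zeros_null (b1 b2 : R) (b X : R -> R) (x t L : R) :
  continuous b -> lipschitz_solution b1 b2 b x X ->
  is_local_time sg (fun s => b s - X s) t L ->
  lebesgue_measure [set s | 0 <= s <= t /\ `|b s - X s| <= 0] = 0%E.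
Proof.
move=> cb solX LT; have [e1 e10 He1] := local_time_occupation_le LT.
have mlev a : measurable [set s | `|b s - X s| <= a].
  exact: measurable_level cb solX a.
rewrite -[X in lebesgue_measure X]/(up_to [set s | `|b s - X s| <= 0] t).
rewrite -measure_up_toE//; congr EFin; apply/eqP.
rewrite eq_le measure_up_to_ge0 andbT; apply/ler_addgt0Pr => eps eps0; rewrite add0r.
pose K := 4 * (`|L| + 1) / sg ^+ 2.
have K0 : 0 < K by rewrite divr_gt0 ?exprn_gt0// mulr_gt0// ltr_wpDl.
pose e := Num.min (e1 / 2) (eps / K).
have e0 : 0 < e.
  by rewrite /e lt_min; apply/andP; split; [exact: divr_gt0|exact: (divr_gt0 eps0 K0)].
have ee1 : e < e1 by rewrite gt_min; apply/orP; left; lra.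
apply: (@le_trans _ _ (occupation_time (fun s => b s - X s) t e)).
  rewrite -[occupation_time _ _ _]/(measure_up_to [set s | `|b s - X s| <= e] t).
  by apply: measure_up_to_sub => // s /= /le_trans; apply; exact: ltW.
apply: (le_trans (He1 e e0 ee1)); rewrite -/K mulrC -ler_pdivlMr//.
by rewrite ge_min lexx orbT.
Qed.

End local_time_limits.

Lemma step_small (R : realType) (t a : R) : 0 < a ->
  exists N, forall k, (N <= k)%N -> (0 < k)%N /\ t / k%:R <= a.
Proof.
move=> a0; exists (Num.truncn (t / a)).+1 => k Nk; split; first exact: leq_trans Nk.
have k0 : 0 < k%:R :> R by rewrite ltr0n (leq_trans _ Nk).
rewrite ler_pdivrMr// mulrC -ler_pdivrMr//.
apply: (le_trans (ltW (truncnS_gt _))); rewrite ler_nat//.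
Qed.

(** * Pathwise limits of the energies *)

Section discretization.
Context {R : realType} (b1 b2 : R) (b20 : 0 < b2) (b21 : b2 < b1).
Variables (b : R -> R) (t : R).
Hypotheses (cb : continuous b) (b00 : b 0 = 0) (t0 : 0 < t).

Lemma discretization_eventually (X : R -> R) (x e : R) :
  lipschitz_solution b1 b2 b x X ->
  lebesgue_measure [set s | 0 <= s <= t /\ `|b s - X s| <= 0] = 0%E ->
  0 < e -> exists N, forall k, (N <= k)%N ->
  (forall s r, 0 <= s -> s <= r -> r <= t -> r <= s + t / k%:R ->
    `|(b r - X r) - (b s - X s)| <= e ^+ 2) /\
  forall j, (j <= k)%N ->
  let dt := t / k%:R in
  let y := euler b1 b2 dt (grid_increment b dt) (- x) in
  [/\ occupation_time (fun s => b s - X s) (j%:R * dt) (e - 2 * e ^+ 2) <=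
        2 * e * sum_trap e e dt y j,
      2 * e * sum_trap e e dt y j <=
        occupation_time (fun s => b s - X s) (j%:R * dt) (e + 2 * e ^+ 2),
      2 * e * sum_trap e (e + e ^+ 2) dt y j <=
        occupation_time (fun s => b s - X s) (j%:R * dt) (e + 2 * e ^+ 2) &
      `|y j - (b (j%:R * dt) - X (j%:R * dt))| <= e ^+ 2].
Proof.
move=> solX null e0; have c0 : 0 < b1 - b2 by rewrite subr_gt0.
have e20 : 0 < e ^+ 2 by rewrite exprn_gt0.
have del0 : 0 < e ^+ 2 / 4 by rewrite divr_gt0.
have cY := distance_continuous cb solX.
have [d d0 Hd] := continuous_uniform_on_itv 0 t cY del0.
(* With oscillation [e ^+ 2 / 4] and drift gap at most [e ^+ 2 / 2] per step, the path stays within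
   [e ^+ 2] of the scheme during a step; the ramp of [trap] accounts for the other half of
   [2 * e ^+ 2]. *)
have a0 : 0 < Num.min d (e ^+ 2 / (2 * (b1 - b2))).
  by rewrite lt_min d0 divr_gt0// mulr_gt0.
have [N HN] := step_small t a0; exists N => k /HN[k0].
rewrite le_min => /andP[dtd dtc].
have kR0 : 0 < k%:R :> R by rewrite ltr0n.
have dt0 : 0 <= t / k%:R by rewrite divr_ge0// ltW.
have cdt : (b1 - b2) * (t / k%:R) <= e ^+ 2 / 2.
  rewrite mulrC -ler_pdivlMr//; apply: (le_trans dtc).
  by rewrite le_eqVlt; apply/orP; left; apply/eqP; field; rewrite gt_eqF.
have osc s r : 0 <= s -> s <= r -> r <= t -> r <= s + t / k%:R ->
    `|(b r - X r) - (b s - X s)| <= e ^+ 2 / 4.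
  move=> s0 sr rt rs; apply: Hd; first by rewrite s0 (le_trans sr).
  by rewrite ger0_norm ?subr_ge0//; lra.
split; first by move=> s r s0 sr rt rs; have := osc s r s0 sr rt rs; lra.
move=> j jk dt y.
have jt : j%:R * dt <= t.
  by rewrite /dt mulrCA ler_piMr ?(ltW t0)// ler_pdivrMr// mul1r ler_nat.
have cl := euler_close b21 cb solX null b00 dt0 osc jt.
have lo a := occupation_le_sum_trap b21 cb solX null b00 dt0 osc a e0 jt.
have hi a := sum_trap_le_occupation b21 cb solX null b00 dt0 osc a e0 jt.
have mono a a' : a <= a' -> occupation_time (fun s => b s - X s) (j%:R * dt) a <=
    occupation_time (fun s => b s - X s) (j%:R * dt) a'.
  move=> aa'; apply: (@measure_up_to_sub _ [set s | `|b s - X s| <= a]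
    [set s | `|b s - X s| <= a']); [exact: measurable_level cb solX _..|].
  by move=> s /= /le_trans; apply.
rewrite -/dt in cdt cl lo hi; rewrite /sum_trap !big_mkord; split.
- by apply: le_trans (lo e); apply: mono; lra.
- by apply: (le_trans (hi e)); apply: mono; lra.
- by apply: (le_trans (hi _)); apply: mono; lra.
- by apply: (le_trans cl); lra.
Qed.

Variable sg : R.
Hypothesis sg0 : 0 < sg.
Let c := b1 - b2.

Lemma energy_space_eventually (X X' : R -> R) (x x' L L' l : R) :
  lipschitz_solution b1 b2 b x X -> lipschitz_solution b1 b2 b x' X' ->
  is_local_time sg (fun s => b s - X s) t L ->
  is_local_time sg (fun s => b s - X' s) t L' -> 0 <= l ->
  exists2 e1, 0 < e1 & forall e C, 0 < e -> e < e1 -> 0 <= C ->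
  exists N, forall k, (N <= k)%N ->
  l * (L - L') - (1 + b1 / c + sg ^+ 2 / c) * (l + l ^+ 2) * `|x - x'| - 1 <=
  \sum_(0 <= i < k) energy sg b1 b2 e l l C (Num.sqrt (t / k%:R))
    (euler b1 b2 (t / k%:R) (grid_increment b (t / k%:R)) (- x) i)
    (euler b1 b2 (t / k%:R) (grid_increment b (t / k%:R)) (- x') i)
    (grid_increment b (t / k%:R) i).
Proof.
move=> solX solX' LT LT' l0.
have b10 : 0 < b1 by exact: lt_trans b21.
have c0 : 0 < c by rewrite subr_gt0.
have null := local_time_zeros_null sg0 cb solX LT.
have null' := local_time_zeros_null sg0 cb solX' LT'.
pose M := l * b1 + l ^+ 2 * sg ^+ 2 / 2.
have M0 : 0 <= M.
  by rewrite /M addr_ge0// ?divr_ge0// mulr_ge0 ?sqr_ge0// ltW.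
(* The local time errors enter as [2 * l * eta] and [2 * M * eta], together at most 1/4; the mesh
   errors below take at most 1/2, so the final constant 1 covers both. *)
pose eta := (4 * M + 4 * l + 1)^-1 / 2.
have den0 : 0 < 4 * M + 4 * l + 1 by rewrite ltr_wpDl// addr_ge0// mulr_ge0.
have eta0 : 0 < eta by rewrite divr_gt0// invr_gt0.
have etaE : (4 * M + 4 * l + 1) * eta = 2^-1.
  by rewrite /eta mulrA mulfV ?mul1r// gt_eqF.
have [e1 e10 He1] := local_time_sandwich sg0 LT eta0.
have [e2 e20 He2] := local_time_sandwich sg0 LT' eta0.
exists (Num.min e1 e2); first by rewrite lt_min e10.
move=> e C e0; rewrite lt_min => /andP[ee1 ee2] C0.
have [lo hi occ] := He1 e e0 ee1.
have [lo' hi' occ'] := He2 e e0 ee2.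
have [N1 HN1] := discretization_eventually solX null e0.
have [N2 HN2] := discretization_eventually solX' null' e0.
(* All mesh errors are at most [W * s]. Since [C] enters [W], the mesh is chosen after [e] and
   [C]. *)
pose W := l * c + M + t * C + 1.
have lc0 : 0 <= l * c := mulr_ge0 l0 (ltW c0).
have tC0 : 0 <= t * C := mulr_ge0 (ltW t0) C0.
have W0 : 0 < W by exact: ltr_wpDl (addr_ge0 (addr_ge0 lc0 M0) tC0) ltr01.
pose a := Num.min (Num.min 1 (e / c)) ((2 * W)^-1 ^+ 2).
have a0 : 0 < a.
  by rewrite /a !lt_min ltr01 divr_gt0//= exprn_gt0// invr_gt0 mulr_gt0.
have [N3 HN3] := step_small t a0.
exists (maxn N1 (maxn N2 N3)) => k; rewrite !geq_max => /and3P[k1 k2 k3].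
have [k0] := HN3 k k3; rewrite !le_min => /andP[/andP[dt1 dtc] dtW].
have kR0 : 0 < k%:R :> R by rewrite ltr0n.
set dt := t / k%:R in dt1 dtc dtW *.
have dt_gt0 : 0 < dt by rewrite divr_gt0.
pose s := Num.sqrt dt; have s2 : s ^+ 2 = dt by rewrite sqr_sqrtr// ltW.
have s0 : 0 < s by rewrite sqrtr_gt0.
have kdt : k%:R * dt = t by rewrite /dt mulrCA mulfV ?mulr1// gt_eqF.
have cdt : (b1 - b2) * s ^+ 2 <= e.
  by rewrite s2 mulrC -ler_pdivlMr.
have sW : s <= (2 * W)^-1.
  rewrite -(@ler_pXn2r _ 2)// ?nnegrE ?invr_ge0 ?mulr_ge0 ?(ltW s0) ?(ltW W0)//.
  by rewrite s2.
have s1 : s <= 1 by rewrite -sqrtr1 ler_wsqrtr.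
have dts : dt <= s by rewrite -s2 expr2 ler_piMr// ltW.
have small : (l * c + M) * dt + t * (C * s) <= 2^-1.
  apply: (@le_trans _ _ (W * s)).
    have : (l * c + M) * dt <= (l * c + M) * s.
      exact: ler_wpM2l (addr_ge0 lc0 M0) _ _ dts.
    by rewrite /W; lra.
  rewrite mulrC -ler_pdivlMr//; apply: (le_trans sW).
  by rewrite le_eqVlt; apply/orP; left; apply/eqP; field; rewrite gt_eqF.
have [_ /(_ k (leqnn k))] := HN1 k k1; rewrite /= -/dt kdt => -[A1 _ A2 _].
have [_ /(_ k (leqnn k))] := HN2 k k2; rewrite /= -/dt kdt => -[_ _ A3 _].
have := energy_space_ge sg0 b20 b21 e0 (grid_increment b dt) C l0
  (- x) (- x') k cdt.
rewrite -/s s2; apply: le_trans.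
set y := euler _ _ _ _ (- x) in A1 A2 *; set y' := euler _ _ _ _ (- x') in A3 *.
have D : `|- x - - x'| = `|x - x'| by rewrite opprK addrC distrC.
rewrite D; set D0 := `|x - x'|; have D00 : 0 <= D0 by exact: normr_ge0.
have S1 : L - eta <= sg ^+ 2 / 2 * sum_trap e e dt y k.
  apply: (le_trans lo); apply: (@le_trans _ _ (sg ^+ 2 / (4 * e) * (2 * e * sum_trap e e dt y k))).
    by rewrite ler_wpM2l// divr_ge0 ?sqr_ge0// mulr_ge0// ltW.
  by rewrite le_eqVlt; apply/orP; left; apply/eqP; field; rewrite gt_eqF.
have S2 : sg ^+ 2 / 2 * sum_trap e (e + e ^+ 2) dt y' k <= L' + eta.
  apply: le_trans hi'; apply: (@le_trans _ _ (sg ^+ 2 / (4 * e) * (2 * e * sum_trap e (e + e ^+ 2) dt y' k))).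
    by rewrite le_eqVlt; apply/orP; left; apply/eqP; field; rewrite gt_eqF.
  by rewrite ler_wpM2l// divr_ge0 ?sqr_ge0// mulr_ge0// ltW.
have S3 : l * (L - L' - 2 * eta) <= l * (sg ^+ 2 / 2 * sum_trap e e dt y k -
    sg ^+ 2 / 2 * sum_trap e (e + e ^+ 2) dt y' k).
  by rewrite ler_wpM2l//; lra.
have S4 : M * ((D0 + (b1 - b2) * dt) / (b1 - b2)
    + 2 * e * sum_trap e (e + e ^+ 2) dt y k
    + 2 * e * sum_trap e (e + e ^+ 2) dt y' k) <= M * (D0 / c + dt + 2 * eta).
  rewrite ler_wpM2l// (_ : (D0 + _) / _ = D0 / c + dt); first by lra.
  by rewrite /c; field; rewrite gt_eqF.
have S5 : l * D0 + M * (D0 / c) <=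
    (1 + b1 / c + sg ^+ 2 / c) * (l + l ^+ 2) * D0.
  rewrite /M -subr_ge0 (_ : _ - _ = (l ^+ 2 + l ^+ 2 * (b1 / c) + l * (sg ^+ 2 / c)
     + l ^+ 2 * (sg ^+ 2 / c) / 2) * D0).
    have q1 : 0 <= b1 / c := divr_ge0 (ltW b10) (ltW c0).
    have q2 : 0 <= sg ^+ 2 / c := divr_ge0 (sqr_ge0 sg) (ltW c0).
    have l2 : 0 <= l ^+ 2 := sqr_ge0 l.
    apply: mulr_ge0 D00; apply: addr_ge0; last first.
      exact: divr_ge0 (mulr_ge0 l2 q2) (ler0n _ 2).
    apply: addr_ge0 (mulr_ge0 l0 q2).
    exact: addr_ge0 l2 (mulr_ge0 l2 q1).
  by field; rewrite gt_eqF.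
rewrite kdt -/M -/c in S4 *; lra.
Qed.

Lemma energy_time_eventually (X : R -> R) (x L L' l r y0 : R) :
  lipschitz_solution b1 b2 b x X -> 0 <= r -> r <= t ->
  is_local_time sg (fun s => b s - X s) r L' ->
  is_local_time sg (fun s => b s - X s) t L -> 0 <= l ->
  exists2 e1, 0 < e1 & forall e C, 0 < e -> e < e1 -> 0 <= C ->
  exists N, forall k, (N <= k)%N ->
  l * (L - L') - l * `|b t - b r| - (2 * b1 + sg ^+ 2) * (l + l ^+ 2) * (t - r) - 1 <=
  \sum_(Num.truncn (r / (t / k%:R)) <= i < k)
    energy sg b1 b2 e l 0 C (Num.sqrt (t / k%:R))
    (euler b1 b2 (t / k%:R) (grid_increment b (t / k%:R)) (- x) i)
    (euler b1 b2 (t / k%:R) (grid_increment b (t / k%:R)) y0 i)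
    (grid_increment b (t / k%:R) i).
Proof.
move=> solX r0 rt LT' LT l0.
have b10 : 0 < b1 by exact: lt_trans b21.
have null := local_time_zeros_null sg0 cb solX LT.
pose M := l * b1 + l ^+ 2 * sg ^+ 2.
have M0 : 0 <= M.
  by rewrite /M addr_ge0// mulr_ge0 ?sqr_ge0// ltW.
pose eta := (8 * l + 1)^-1.
have den0 : 0 < 8 * l + 1 by rewrite ltr_wpDl// mulr_ge0.
have eta0 : 0 < eta by rewrite invr_gt0.
have etaE : (8 * l + 1) * eta = 1 by rewrite /eta mulfV// gt_eqF.
have [e1 e10 He1] := local_time_sandwich sg0 LT eta0.
have [e2 e20 He2] := local_time_sandwich sg0 LT' eta0.
exists (Num.min (Num.min e1 e2) (Num.min 1 eta)).
  by rewrite !lt_min e10 e20 ltr01.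
move=> e C e0; rewrite !lt_min => /andP[/andP[ee1 ee2] /andP[e1' eeta]] C0.
have [lo _ _] := He1 e e0 ee1; have [_ hi' _] := He2 e e0 ee2.
have [N1 HN1] := discretization_eventually solX null e0.
pose W := M + t * C + 1.
have tC0 : 0 <= t * C := mulr_ge0 (ltW t0) C0.
have W0 : 0 < W by exact: ltr_wpDl (addr_ge0 M0 tC0) ltr01.
pose a := Num.min 1 ((4 * W)^-1 ^+ 2).
have a0 : 0 < a by rewrite /a lt_min ltr01 exprn_gt0// invr_gt0 mulr_gt0.
have [N3 HN3] := step_small t a0.
exists (maxn N1 N3) => k; rewrite geq_max => /andP[k1 k3].
have [k0] := HN3 k k3; rewrite le_min => /andP[dt1 dtW].
have kR0 : 0 < k%:R :> R by rewrite ltr0n.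
have [osc HN] := HN1 k k1.
set dt := t / k%:R in dt1 dtW osc HN *.
have dt_gt0 : 0 < dt by rewrite divr_gt0.
pose s := Num.sqrt dt; have s2 : s ^+ 2 = dt by rewrite sqr_sqrtr// ltW.
have s0 : 0 < s by rewrite sqrtr_gt0.
have kdt : k%:R * dt = t by rewrite /dt mulrCA mulfV ?mulr1// gt_eqF.
have sW : s <= (4 * W)^-1.
  rewrite -(@ler_pXn2r _ 2)// ?nnegrE ?invr_ge0 ?mulr_ge0 ?(ltW s0) ?(ltW W0)//.
  by rewrite s2.
have s1 : s <= 1 by rewrite -sqrtr1 ler_wsqrtr.
have dts : dt <= s by rewrite -s2 expr2 ler_piMr// ltW.
have small : M * dt + t * (C * s) <= 4^-1.
  apply: (@le_trans _ _ (W * s)).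
    have : M * dt <= M * s by rewrite ler_wpM2l.
    by rewrite /W; lra.
  rewrite mulrC -ler_pdivlMr//; apply: (le_trans sW).
  by rewrite le_eqVlt; apply/orP; left; apply/eqP; field; rewrite gt_eqF.
(* [m%:R * dt] is the last grid time not after [r]: occupation up to it is at most occupation up to
   [r], and the shift costs one oscillation of the path and one mesh. *)
set m := Num.truncn (r / dt).
have /truncn_itv : 0 <= r / dt by rewrite divr_ge0// ltW.
rewrite -/m ler_pdivlMr// ltr_pdivrMr// => /andP[mr rm].
have mk : (m <= k)%N.
  rewrite -(@ler_nat R) -(@ler_pM2r _ dt)// kdt; exact: le_trans rt.
have rm1 : r <= m%:R * dt + dt by rewrite -natr1 mulrDl mul1r in rm; exact: ltW.
have [A1 _ _ A4] := HN k (leqnn k); have [_ B2 _ B4] := HN m mk.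
rewrite kdt in A1 A4.
have := energy_time_ge sg b20 b21 e0 (grid_increment b dt) s0 l0 (- x) y0 mk C0.
rewrite -/s s2; apply: le_trans.
set y := euler _ _ _ _ (- x) in A1 A4 B2 B4 *.
have esq : e ^+ 2 <= eta.
  by rewrite expr2 (le_trans _ (ltW eeta))// ler_piMr// ltW.
have m0 : 0 <= m%:R * dt by rewrite mulr_ge0// ltW.
have mlev := measurable_level cb solX (e + 2 * e ^+ 2).
have B3 : occupation_time (fun s => b s - X s) (m%:R * dt) (e + 2 * e ^+ 2) <=
    occupation_time (fun s => b s - X s) r (e + 2 * e ^+ 2).
  exact: (measure_up_to_ndecr mlev).
have S1 : L - eta <= sg ^+ 2 / 2 * sum_trap e e dt y k.
  apply: (le_trans lo); apply: (@le_trans _ _ (sg ^+ 2 / (4 * e) * (2 * e * sum_trap e e dt y k))).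
    by rewrite ler_wpM2l// divr_ge0 ?sqr_ge0// mulr_ge0// ltW.
  by rewrite le_eqVlt; apply/orP; left; apply/eqP; field; rewrite gt_eqF.
have S2 : sg ^+ 2 / 2 * sum_trap e e dt y m <= L' + eta.
  apply: le_trans hi'; apply: (@le_trans _ _ (sg ^+ 2 / (4 * e) * (2 * e * sum_trap e e dt y m))).
    by rewrite le_eqVlt; apply/orP; left; apply/eqP; field; rewrite gt_eqF.
  rewrite ler_wpM2l//; last exact: le_trans B2 B3.
  by rewrite divr_ge0 ?sqr_ge0// mulr_ge0// ltW.
have S3 : l * (L - L' - 2 * eta) <= l * (sg ^+ 2 / 2 * sum_trap e e dt y k -
    sg ^+ 2 / 2 * sum_trap e e dt y m).
  by rewrite ler_wpM2l//; lra.
have /andP[inc1 inc2] := solution_increment b21 cb solX null r0 rt (lexx t).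
have tr : 0 <= b2 * (t - r) by rewrite mulr_ge0 ?subr_ge0// ltW.
have Ytr : `|(b t - X t) - (b r - X r)| <= `|b t - b r| + b1 * (t - r).
  rewrite (_ : _ - _ = (b t - b r) - (X t - X r)); last by ring.
  rewrite (le_trans (ler_normB _ _))// lerD2l ger0_norm ?inc2//.
  exact: le_trans tr inc1.
have Yrm := osc _ _ m0 mr rt rm1.
have ykm : `|y k - y m| <= `|b t - b r| + b1 * (t - r) + 3 * eta.
  rewrite (_ : y k - y m = (y k - (b t - X t)) - (y m - (b (m%:R * dt) - X (m%:R * dt)))
    + ((b t - X t) - (b r - X r)) + ((b r - X r) - (b (m%:R * dt) - X (m%:R * dt)))); last by ring.
  rewrite (le_trans (ler_normD _ _))// (le_trans (lerD (ler_normD _ _) (lexx _)))//.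
  by have := ler_normB (y k - (b t - X t)) (y m - (b (m%:R * dt) - X (m%:R * dt))); lra.
have S4 : l * (`|y k - y m| / 2) <= l * ((`|b t - b r| + b1 * (t - r) + 3 * eta) / 2).
  by rewrite ler_wpM2l// ler_pM2r// invr_gt0.
have S5 : M * ((k%:R - m%:R) * dt) <= M * (t - r + dt).
  by rewrite ler_wpM2l// mulrBl kdt; lra.
have S6 : 0 <= l * `|b t - b r| by rewrite mulr_ge0.
have S7 : l * (b1 * (t - r) / 2) + M * (t - r) <=
    (2 * b1 + sg ^+ 2) * (l + l ^+ 2) * (t - r).
  rewrite /M -subr_ge0 (_ : _ - _ = (l * b1 / 2 + 2 * l ^+ 2 * b1 + l * sg ^+ 2) * (t - r)).
    have l2 : 0 <= l ^+ 2 := sqr_ge0 l.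
    apply: mulr_ge0; last by rewrite subr_ge0.
    apply: addr_ge0 (mulr_ge0 l0 (sqr_ge0 sg)).
    apply: addr_ge0 (divr_ge0 (mulr_ge0 l0 (ltW b10)) (ler0n _ 2)) _.
    exact: mulr_ge0 (mulr_ge0 (ler0n _ 2) l2) (ltW b10).
  by field.
rewrite kdt -/M; lra.
Qed.

End discretization.

(** * From energies to exponential tails *)

Section tails.
Context d (T : measurableType d) (R : realType) (P : probability T R).
Variables (sg b1 b2 : R) (B : R -> {RV P >-> R}) (X L : R -> R -> {RV P >-> R}).
Hypotheses (sg0 : 0 < sg) (b20 : 0 < b2) (b21 : b2 < b1)
  (BM : two_sided_brownian_motion sg B)
  (solX : forall x : R, {ae P, forall w,
      lipschitz_solution b1 b2 (fun t => B t w) x (fun t => X x t w)})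
  (locL : forall x t : R, 0 <= t -> {ae P, forall w,
      is_local_time sg (fun s => B s w - X x s w) t (L x t w)}).

Lemma measurable_euler (dt x : R) (i : nat) :
  measurable_fun setT (fun w => euler b1 b2 dt (grid_increment (B ^~ w) dt) x i).
Proof.
elim: i => [|i IH] /=; first exact: measurable_cst.
apply: measurable_funD => //; apply: measurable_funB.
  exact: measurable_funB.
by apply: measurable_funM => //; apply: measurableT_comp IH; exact: measurable_slope.
Qed.

Lemma measurable_sum_energy (e l1 l2 C s dt x y : R) (m n : nat) :
  measurable_fun setT (fun w => \sum_(m <= i < n) energy sg b1 b2 e l1 l2 C s
    (euler b1 b2 dt (grid_increment (B ^~ w) dt) x i)
    (euler b1 b2 dt (grid_increment (B ^~ w) dt) y i)
    (grid_increment (B ^~ w) dt i)).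
Proof.
apply: measurable_sum => i.
apply: (@measurableT_comp _ _ _ _ _ _
  (fun v : R * R * R => energy sg b1 b2 e l1 l2 C s v.1.1 v.1.2 v.2)
  _ (fun w => (euler b1 b2 dt (grid_increment (B ^~ w) dt) x i,
    euler b1 b2 dt (grid_increment (B ^~ w) dt) y i,
    grid_increment (B ^~ w) dt i))); first exact: measurable_energy.
apply: measurable_fun_pair; last exact: measurable_funB.
by apply: measurable_fun_pair; exact: measurable_euler.
Qed.

(** The exponential of each energy has mean at most 1, so Markov's inequality bounds every event at
    level (j, k), and the double lower limit keeps the bound. The smoothing runs through
    [j.+1%:R^-1] so that one constant [C j] can be chosen for each [j]. *)
Lemma energy_event_le (t l1 l2 x y rho : R) (m : nat -> nat) (A : set T) :
  0 < t -> 0 <= l1 -> 0 <= l2 -> measurable A ->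
  {ae P, forall w, A w -> exists2 e1, 0 < e1 &
    forall e C, 0 < e -> e < e1 -> 0 <= C ->
    exists N, forall k, (N <= k)%N -> rho <=
    \sum_(m k <= i < k) energy sg b1 b2 e l1 l2 C (Num.sqrt (t / k%:R))
      (euler b1 b2 (t / k%:R) (grid_increment (B ^~ w) (t / k%:R)) x i)
      (euler b1 b2 (t / k%:R) (grid_increment (B ^~ w) (t / k%:R)) y i)
      (grid_increment (B ^~ w) (t / k%:R) i)} ->
  (P A <= (expR (- rho))%:E)%E.
Proof.
move=> t0 l10 l20 mA HA.
have eps0 j : 0 < j.+1%:R^-1 :> R by rewrite invr_gt0.
have /choice[C HC] : forall j, exists C, 0 <= C /\
    forall (s x y : R) (m n : nat), 0 < s -> s <= 1 ->
    (\int[P]_w (expR (\sum_(i < n | (m <= i)%N)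
     energy sg b1 b2 j.+1%:R^-1 l1 l2 C s
       (euler b1 b2 (s ^+ 2) (grid_increment (B ^~ w) (s ^+ 2)) x i)
       (euler b1 b2 (s ^+ 2) (grid_increment (B ^~ w) (s ^+ 2)) y i)
       (grid_increment (B ^~ w) (s ^+ 2) i)))%:E <= 1)%E.
  move=> j; have [C C0 HC] := euler_energy_le1 sg0 BM b20 b21 (eps0 j) l10 l20.
  by exists C.
(* Shifting by [N0] keeps the mesh at most 1, the range of the one-step estimate. *)
have [N0 HN0] := step_small t (@ltr01 R).
pose E j k w := \sum_(m k <= i < k)
  energy sg b1 b2 j.+1%:R^-1 l1 l2 (C j) (Num.sqrt (t / k%:R))
    (euler b1 b2 (t / k%:R) (grid_increment (B ^~ w) (t / k%:R)) x i)
    (euler b1 b2 (t / k%:R) (grid_increment (B ^~ w) (t / k%:R)) y i)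
    (grid_increment (B ^~ w) (t / k%:R) i).
have mE j k : measurable_fun setT (E j k) by exact: measurable_sum_energy.
apply: (@probability_liminf2_le _ _ _ _ A
  (fun j n => [set w | rho <= E j (n + N0)%N w])) => //.
- move=> j n; rewrite -[X in measurable X]setTI.
  by apply: measurable_fun_le => //; exact: measurable_cst.
- move=> j n; set k := (n + N0)%N.
  have [k0 dt1] := HN0 k (leq_addl _ _).
  have dt0 : 0 < t / k%:R by rewrite divr_gt0// ltr0n.
  apply: exp_markov => //; have [_ /(_ (Num.sqrt (t / k%:R)) x y (m k) k)] := HC j.
  have s1 : Num.sqrt (t / k%:R) <= 1 by rewrite -[leRHS]sqrtr1 ler_wsqrtr.
  rewrite sqrtr_gt0 => /(_ dt0 s1).
  rewrite sqr_sqrtr ?(ltW dt0)//; apply: le_trans; rewrite le_eqVlt.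
  by apply/orP; left; apply/eqP; apply: eq_integral => w _; rewrite /E big_geq_mkord.
- apply: filterS HA => w HA Aw; have [e1 e10 He] := HA Aw.
  exists (Num.truncn e1^-1).+1 => j Jj.
  have ej : j.+1%:R^-1 < e1.
    rewrite -[ltRHS]invrK ltf_pV2 ?posrE ?invr_gt0// (lt_trans (truncnS_gt _))//.
    by rewrite ltr_nat ltnS.
  have [N HN] := He _ (C j) (eps0 j) ej (HC j).1.
  by exists N => n Nn; apply: HN; rewrite (leq_trans Nn)// leq_addr.
Qed.

Let kappa := 1 + b1 / (b1 - b2) + sg ^+ 2 / (b1 - b2).

Lemma local_time_space_tail (x y t l u : R) : 0 < t -> 0 <= l ->
  (P [set w | (u <= L x t w - L y t w)%R] <=
   (expR (- (l * u - kappa * (l + l ^+ 2) * `|x - y| - 1)))%:E)%E.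
Proof.
move=> t0 l0; apply: (@energy_event_le t l l (- x) (- y) _ (fun=> 0)) => //.
  rewrite -[X in measurable X]setTI; apply: measurable_fun_le => //.
  exact: measurable_funB.
have [B0 cB _ _] := BM.
have H1 := solX x; have H2 := solX y.
have H3 := locL x (ltW t0); have H4 := locL y (ltW t0).
near=> w => Aw.
have hB0 : B 0 w = 0 by near: w.
have hcB : continuous (fun s => B s w) by near: w.
have hX : lipschitz_solution b1 b2 (fun s => B s w) x (fun s => X x s w) by near: w.
have hX' : lipschitz_solution b1 b2 (fun s => B s w) y (fun s => X y s w) by near: w.
have hL : is_local_time sg (fun s => B s w - X x s w) t (L x t w) by near: w.
have hL' : is_local_time sg (fun s => B s w - X y s w) t (L y t w) by near: w.
have [e1 e10 He] := energy_space_eventually b20 b21 hcB hB0 t0 sg0 hX hX' hL hL' l0.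
exists e1 => // e C e0 ee1 C0; have [N HN] := He e C e0 ee1 C0.
exists N => k Nk; apply: le_trans (HN k Nk).
by rewrite /kappa !lerD2r ler_wpM2l.
Unshelve. all: by end_near. Qed.

Let kappa' := 2 * b1 + sg ^+ 2.

(** The displacement of [B] left by Tanaka's formula is not of order [t - r]; it is confined to the
    event here and estimated separately by [brownian_tail]. *)
Lemma local_time_time_tail (x t r l u v : R) : 0 <= r -> r <= t -> 0 < t ->
  0 <= l ->
  (P [set w | (u <= L x t w - L x r w)%R /\ (`|B t w - B r w| <= v)%R] <=
   (expR (- (l * u - l * v - kappa' * (l + l ^+ 2) * (t - r) - 1)))%:E)%E.
Proof.
move=> r0 rt t0 l0.
apply: (@energy_event_le t l 0 (- x) 0 _
  (fun k => Num.truncn (r / (t / k%:R)))) => //.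
  apply: measurableI; rewrite -[X in measurable X]setTI; apply: measurable_fun_le => //.
  - exact: measurable_funB.
  - by apply: measurableT_comp => //; exact: measurable_funB.
have [B0 cB _ _] := BM.
have H1 := solX x.
have H3 := locL x (ltW t0); have H4 := locL x r0.
near=> w => -[Aw Bw].
have hB0 : B 0 w = 0 by near: w.
have hcB : continuous (fun s => B s w) by near: w.
have hX : lipschitz_solution b1 b2 (fun s => B s w) x (fun s => X x s w) by near: w.
have hL : is_local_time sg (fun s => B s w - X x s w) t (L x t w) by near: w.
have hL' : is_local_time sg (fun s => B s w - X x s w) r (L x r w) by near: w.
have [e1 e10 He] := energy_time_eventually b20 b21 hcB hB0 t0 sg0 0 hX r0 rt hL' hL l0.
exists e1 => // e C e0 ee1 C0; have [N HN] := He e C e0 ee1 C0.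
exists N => k Nk; apply: le_trans (HN k Nk).
rewrite !lerD2r lerB// ler_wpM2l//.
Unshelve. all: by end_near. Qed.

Lemma brownian_tail (r t mu v : R) : r < t ->
  (P [set w | (v <= mu * (B t w - B r w))%R] <=
   (expR (- (v - mu ^+ 2 * sg ^+ 2 * (t - r) / 2)))%:E)%E.
Proof.
move=> rt; have tr0 : 0 < t - r by rewrite subr_gt0.
pose q := mu ^+ 2 * sg ^+ 2 * (t - r) / 2.
have mB : measurable_fun setT (fun w => mu * (B t w - B r w) - q).
  by apply: measurable_funB => //; apply: measurable_funM => //; exact: measurable_funB.
have sq : 0 < sg * Num.sqrt (t - r) by rewrite mulr_gt0// sqrtr_gt0.
have mexp : measurable_fun setT (fun z : R => expR (mu * z)).
  by apply: measurableT_comp => //; exact: measurable_funM.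
have E1 : (\int[P]_w (expR (mu * (B t w - B r w)))%:E = (expR q)%:E)%E.
  transitivity (\int[distribution P (increment B r t)]_z (expR (mu * z))%:E)%E.
    have mexpE : measurable_fun setT (fun z : R => (expR (mu * z))%:E).
      exact/measurable_EFinP.
    have exp0 (z : R) : (0 <= (expR (mu * z))%:E)%E by rewrite lee_fin expR_ge0.
    by rewrite (ge0_integral_distribution (increment B r t) mexpE exp0).
  rewrite (ge0_integral_distribution_normal (fun A mA => increment_law BM rt mA) mexp
    (fun z => expR_ge0 _)) integral_normal_prob_expR//.
  by rewrite exprMn sqr_sqrtr ?(ltW tr0)// /q mulrA.
have := @exp_markov _ _ _ P _ (v - q) mB.
have -> : [set w | v - q <= mu * (B t w - B r w) - q] =
    [set w | v <= mu * (B t w - B r w)].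
  by apply/seteqP; split => w /=; rewrite lerD2r.
apply; under eq_integral do rewrite expRD mulrC EFinM.
rewrite ge0_integralZl_EFin ?expR_ge0//.
- by rewrite E1 -EFinM -expRD addNr expR0.
- apply/measurable_EFinP; apply: measurableT_comp => //.
  by apply: measurable_funM => //; exact: measurable_funB.
Qed.

End tails.

Lemma measurable_norm_gt d (T : measurableType d) (R : realType) (f : T -> R)
    (a : R) : measurable_fun setT f -> measurable [set w | a < `|f w|].
Proof.
move=> mf; have mn : measurable_fun setT (fun w => `|f w|).
  exact: measurableT_comp.
rewrite (_ : [set w | _] = (fun w => `|f w|) @^-1` `]a, +oo[).
  by rewrite -[X in measurable X]setTI; exact: mn.
by apply/seteqP; split => w /=; rewrite in_itv/= andbT.
Qed.

Lemma ae_le_probability d (T : measurableType d) (R : realType)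
    (P : probability T R) (A D : set T) : measurable A -> measurable D ->
  {ae P, forall w, A w -> D w} -> (P A <= P D)%E.
Proof.
move=> mA mD [N [mN PN0 AN]].
have h : (P (D `|` N) <= P D + P N)%E by exact: measureU2.
apply: (@le_trans _ _ (P (D `|` N))); last by rewrite (le_trans h)// PN0 adde0.
apply: le_measure; rewrite ?inE//; first exact: measurableU.
move=> w Aw; have [Nw|nNw] := pselect (N w); [by right|left].
exact: (contrapT (fun h => nNw (AN w h))).
Qed.

Lemma expRN_le_pow (R : realType) (n : nat) (x : R) : 0 < x ->
  expR (- x) <= n`!%:R / x ^+ n.
Proof.
move=> x0; case: n => [|n].
  by rewrite expr0 divr1 fact0 expR_le1 oppr_le0 ltW.
have p0 : 0 < x ^+ n.+1 by rewrite exprn_gt0.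
have f0 : 0 < n.+1`!%:R :> R by rewrite ltr0n fact_gt0.
rewrite expRN -[leRHS]invrK lef_pV2 ?posrE ?expR_gt0//; last first.
  by rewrite invr_gt0 divr_gt0.
rewrite invf_div; apply: le_trans (expR_ge1Dxn n (ltW x0)).
by rewrite lerDr.
Qed.

Lemma expR_pow2_decay (R : realType) (n k : nat) :
  expR (- (2 ^+ k / 4)) <= n`!%:R * 4 ^+ n / (2 ^+ k) ^+ n :> R.
Proof.
have x0 : 0 < 2 ^+ k / 4 :> R by rewrite divr_gt0// exprn_gt0.
apply: (le_trans (expRN_le_pow n x0)).
by rewrite expr_div_n invf_div mulrA.
Qed.

Section local_time_order.
Context {R : realType} (sg : R) (Y : R -> R).
Hypothesis mlev : forall a, measurable [set s | `|Y s| <= a].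

(** The exponential bound in time controls only large positive increments; monotonicity excludes the
    other sign. *)
Lemma local_time_ndecr (r t L' L : R) : 0 <= r -> r <= t ->
  is_local_time sg Y r L' -> is_local_time sg Y t L -> L' <= L.
Proof.
move=> r0 rt LT' LT; apply/ler_addgt0Pr => eps eps0.
have eps20 : 0 < eps / 2 by rewrite divr_gt0.
have [e1 e10 H1] := local_time_dist LT' eps20.
have [e2 e20 H2] := local_time_dist LT eps20.
pose e := Num.min e1 e2 / 2.
have m0 : 0 < Num.min e1 e2 by rewrite lt_min e10.
have e0 : 0 < e by rewrite divr_gt0.
have em : e < Num.min e1 e2 by rewrite /e; lra.
have /andP[ee1 ee2] : (e < e1) && (e < e2) by rewrite -lt_min.
have := H1 e e0 ee1; have := H2 e e0 ee2; rewrite !ler_norml.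
have : sg ^+ 2 / (4 * e) * occupation_time Y r e <=
    sg ^+ 2 / (4 * e) * occupation_time Y t e.
  rewrite ler_wpM2l//; first by rewrite divr_ge0 ?sqr_ge0// mulr_ge0// ltW.
  exact: (measure_up_to_ndecr (mlev e)).
set u := _ * occupation_time Y r e; set v := _ * occupation_time Y t e.
by move=> uv /andP[? ?] /andP[? ?]; lra.
Qed.

Lemma local_time_at0 (L : R) : is_local_time sg Y 0 L -> L = 0.
Proof.
move=> LT; apply/eqP; rewrite -normr_le0; apply/ler_addgt0Pr => eps eps0.
have [e1 e10 H1] := local_time_dist LT eps0.
have e0 : 0 < e1 / 2 by rewrite divr_gt0.
have := H1 _ e0 _; rewrite -[occupation_time _ _ _]/(measure_up_to
  [set s | `|Y s| <= e1 / 2] 0) measure_up_to0// mulr0 sub0r normrN add0r.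
by apply; lra.
Qed.
End local_time_order.

(** * Increments at distance 16^-k *)

Section increment_tail.
Context d (T : measurableType d) (R : realType) (P : probability T R).
Variables (sg b1 b2 : R) (B : R -> {RV P >-> R}) (X L : R -> R -> {RV P >-> R}).
Hypotheses (sg0 : 0 < sg) (b20 : 0 < b2) (b21 : b2 < b1)
  (BM : two_sided_brownian_motion sg B)
  (solX : forall x : R, {ae P, forall w,
      lipschitz_solution b1 b2 (fun t => B t w) x (fun t => X x t w)})
  (locL : forall x t : R, 0 <= t -> {ae P, forall w,
      is_local_time sg (fun s => B s w - X x s w) t (L x t w)}).

Let kappa := 1 + b1 / (b1 - b2) + sg ^+ 2 / (b1 - b2).
Let kappa' := 2 * b1 + sg ^+ 2.
(** One constant for the three tails: weight times mesh is at most 2, which gives [2 * kappa] in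
    space, [2 * kappa'] in time and [sg ^+ 2] for the Brownian bracket. *)
Let M := 2 * kappa + 2 * kappa' + sg ^+ 2 + 1.

Let kappa0 : 0 <= kappa.
Proof.
have c0 : 0 < b1 - b2 by rewrite subr_gt0.
have b10 : 0 < b1 := lt_trans b20 b21.
by rewrite /kappa addr_ge0 ?addr_ge0 ?divr_ge0 ?sqr_ge0 ?(ltW c0) ?(ltW b10).
Qed.

Let kappa'0 : 0 <= kappa'.
Proof.
have b10 : 0 < b1 := lt_trans b20 b21.
by rewrite /kappa' addr_ge0 ?sqr_ge0// mulr_ge0// ltW.
Qed.

(* The scales: mesh [16 ^- k], threshold [2 ^- k], exponential weight [4 ^ k]. *)
Let weight_mesh (k : nat) (h : R) : 0 <= h -> h <= (16 ^+ k)^-1 ->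
  (4 ^+ k + (4 ^+ k) ^+ 2) * h <= 2.
Proof.
move=> h0 hk; have e16 : 16 ^+ k = (4 ^+ k) ^+ 2 :> R.
  by rewrite -exprM mulnC exprM; congr (_ ^+ k); lra.
have p4 : 1 <= 4 ^+ k :> R by rewrite exprn_ege1//; lra.
have p16 : 0 < 16 ^+ k :> R by rewrite exprn_gt0.
have s4 : 4 ^+ k <= (4 ^+ k) ^+ 2 :> R by rewrite expr2 ler_peMr//; lra.
have : 2 * 16 ^+ k * h <= 2.
  by rewrite -mulrA ger_pMr// -ler_pdivlMl// mulr1.
have := ler_wpM2r h0 s4; rewrite e16; lra.
Qed.

Let weight_threshold (k : nat) : 4 ^+ k * (2 ^+ k)^-1 = 2 ^+ k :> R.
Proof.
have -> : 4 ^+ k = 2 ^+ k * 2 ^+ k :> R by rewrite -exprMn; congr (_ ^+ k); lra.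
by rewrite mulfK// expf_neq0.
Qed.

Let measurable_ge (f : T -> R) (a : R) : measurable_fun setT f ->
  measurable [set w | a <= f w].
Proof.
by move=> mf; rewrite -[X in measurable X]setTI; exact: measurable_fun_le.
Qed.

Let mL x t y r : measurable_fun setT (fun w => L x t w - L y r w).
Proof. exact: measurable_funB. Qed.

Let level_measurable x : {ae P, forall w a,
  measurable [set s | `|B s w - X x s w| <= a]}.
Proof.
have [_ cB _ _] := BM; have := solX x; apply: filterS2 cB => w cBw solw a.
exact: measurable_level cBw solw a.
Qed.

Lemma local_time_space_increment (k : nat) (x y t : R) : 0 <= t ->
  `|x - y| <= (16 ^+ k)^-1 ->
  (P [set w | ((2 ^+ k)^-1 / 2 < `|L x t w - L y t w|)%R] <=
   (2 * (expR M * expR (- (2 ^+ k / 4))))%:E)%E.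
Proof.
rewrite le_eqVlt => /orP[/eqP <- xy|t0 xy].
  apply: (@le_trans _ _ (P set0)); last first.
    by rewrite measure0 lee_fin !mulr_ge0 ?expR_ge0.
  apply: ae_le_probability => //; first exact: measurable_norm_gt.
  have H1 := locL x (lexx 0); have H2 := locL y (lexx 0).
  have H3 := level_measurable x; have H4 := level_measurable y.
  near=> w => /=.
  have -> : L x 0 w = 0.
    by apply: (@local_time_at0 _ sg (fun s => B s w - X x s w)); near: w.
  have -> : L y 0 w = 0.
    by apply: (@local_time_at0 _ sg (fun s => B s w - X y s w)); near: w.
  by rewrite subrr normr0 ltNge divr_ge0// invr_ge0 exprn_ge0.
have l0 : 0 <= 4 ^+ k :> R by rewrite exprn_ge0.
have one u v : `|u - v| <= (16 ^+ k)^-1 ->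
    (P [set w | ((2 ^+ k)^-1 / 2 <= L u t w - L v t w)%R] <=
     (expR M * expR (- (2 ^+ k / 4)))%:E)%E.
  move=> uv; apply: (le_trans (local_time_space_tail sg0 b20 b21 BM solX locL
    u v ((2 ^+ k)^-1 / 2) t0 l0)).
  rewrite -expRD lee_fin ler_expR -/kappa mulrA weight_threshold.
  have := weight_mesh (normr_ge0 _) uv => /(ler_wpM2l kappa0).
  have : 0 <= 2 ^+ k :> R by rewrite exprn_ge0.
  have := kappa'0; have := sqr_ge0 sg; rewrite /M mulrA; lra.
have mE u v : measurable [set w | (2 ^+ k)^-1 / 2 <= L u t w - L v t w].
  exact: measurable_ge.
apply: (@le_trans _ _ (P ([set w | ((2 ^+ k)^-1 / 2 <= L x t w - L y t w)%R] `|`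
  [set w | ((2 ^+ k)^-1 / 2 <= L y t w - L x t w)%R]))%E).
  apply: le_measure; rewrite ?inE; [exact: measurable_norm_gt|exact: measurableU|].
  move=> w /=; case: (ger0P (L x t w - L y t w)) => h1 h2; [left|right]; lra.
apply: (le_trans (measureU2 _ (mE x y) (mE y x))).
rewrite mulrDl mul1r EFinD; apply: leeD; apply: one => //.
by rewrite distrC.
Unshelve. all: by end_near. Qed.

Lemma local_time_time_increment (k : nat) (x r t : R) : 0 <= r -> r <= t ->
  t - r <= (16 ^+ k)^-1 ->
  (P [set w | ((2 ^+ k)^-1 / 2 < `|L x t w - L x r w|)%R] <=
   (3 * (expR M * expR (- (2 ^+ k / 4))))%:E)%E.
Proof.
move=> r0; rewrite le_eqVlt => /orP[/eqP <- _|rt trh].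
  rewrite (_ : [set w | _] = set0).
    by rewrite measure0 lee_fin !mulr_ge0 ?expR_ge0.
  apply/seteqP; split => w //=; rewrite subrr normr0 ltNge.
  by rewrite divr_ge0// invr_ge0 exprn_ge0.
have t0 : 0 < t by exact: le_lt_trans rt.
have l0 : 0 <= 4 ^+ k :> R by rewrite exprn_ge0.
have tr0 : 0 <= t - r by rewrite subr_ge0 ltW.
have p2 : 0 <= 2 ^+ k :> R by rewrite exprn_ge0.
have wm := weight_mesh tr0 trh.
have sg2 := sqr_ge0 sg.
(* The Brownian threshold is half of the local time threshold, so [4 ^+ k] times their difference
   still leaves [2 ^+ k / 4] in the exponent. *)
pose E1 := [set w | (2 ^+ k)^-1 / 2 <= L x t w - L x r w /\
  `|B t w - B r w| <= (2 ^+ k)^-1 / 4].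
pose E2 := [set w | 2 ^+ k / 4 <= 4 ^+ k * (B t w - B r w)].
pose E3 := [set w | 2 ^+ k / 4 <= (- 4 ^+ k) * (B t w - B r w)].
have mdB : measurable_fun setT (fun w => B t w - B r w) by exact: measurable_funB.
have mE1 : measurable E1.
  apply: measurableI; first exact: measurable_ge.
  rewrite -[X in measurable X]setTI; apply: measurable_fun_le => //.
  exact: measurableT_comp.
have mE2 : measurable E2 by apply: measurable_ge; exact: measurable_funM.
have mE3 : measurable E3 by apply: measurable_ge; exact: measurable_funM.
set q := expR M * _.
have P1 : (P E1 <= q%:E)%E.
  apply: (le_trans (local_time_time_tail sg0 b20 b21 BM solX locL
    x ((2 ^+ k)^-1 / 2) ((2 ^+ k)^-1 / 4) r0 (ltW rt) t0 l0)).
  rewrite /q -expRD lee_fin ler_expR -/kappa' !mulrA weight_threshold.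
  have := ler_wpM2l kappa'0 wm; have := kappa0; rewrite /M mulrA; lra.
have PB m : m ^+ 2 = (4 ^+ k) ^+ 2 ->
    (P [set w | (2 ^+ k / 4 <= m * (B t w - B r w))%R] <= q%:E)%E.
  move=> mE; apply: (le_trans (brownian_tail sg0 BM m (2 ^+ k / 4) rt)).
  rewrite /q -expRD lee_fin ler_expR mE.
  have : (4 ^+ k) ^+ 2 * (t - r) <= 2.
    by apply: le_trans wm; rewrite ler_wpM2r// lerDr.
  move=> /(ler_wpM2l sg2); have := kappa0; have := kappa'0; rewrite /M; lra.
have P2 : (P E2 <= q%:E)%E by exact: PB.
have P3 : (P E3 <= q%:E)%E by apply: PB; rewrite sqrrN.
have U3 : (P (E1 `|` (E2 `|` E3)) <= (3 * q)%:E)%E.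
  apply: (le_trans (measureU2 _ mE1 (measurableU _ _ mE2 mE3))).
  rewrite (_ : 3 * q = q + (q + q)); last by ring.
  by rewrite !EFinD; apply: leeD => //; apply: (le_trans (measureU2 _ mE2 mE3)); exact: leeD.
apply: le_trans U3; apply: ae_le_probability.
- exact: measurable_norm_gt.
- by apply: measurableU => //; exact: measurableU.
have H1 := locL x r0; have H2 := locL x (ltW t0); have H3 := level_measurable x.
near=> w => /= big.
have LL : L x r w <= L x t w.
  apply: (@local_time_ndecr _ sg (fun s => B s w - X x s w) _ r t _ _ r0 (ltW rt)).
  - by near: w.
  - by near: w.
  - by near: w.
move: big; rewrite ger0_norm ?subr_ge0// => big.
have key : (2 ^+ k)^-1 / 4 * 4 ^+ k = 2 ^+ k / 4 :> R.
  by rewrite mulrAC (mulrC _ (4 ^+ k)) weight_threshold.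
have [small|] := leP `|B t w - B r w| ((2 ^+ k)^-1 / 4).
  by left; split => //; exact: ltW.
move=> hB; right; move: hB; case: (ger0P (B t w - B r w)) => _ hB; [left|right].
  by rewrite /E2/= -key mulrC ler_wpM2l// ltW.
by rewrite /E3/= -key mulNr -mulrN mulrC ler_wpM2l// ltW.
Unshelve. all: by end_near. Qed.

Lemma local_time_increment_tail (n : nat) : exists2 C : R, 0 <= C &
  forall (k : nat) (x y t r : R), 0 <= t -> 0 <= r ->
  `|x - y| <= (16 ^+ k)^-1 -> `|t - r| <= (16 ^+ k)^-1 ->
  (P [set w | ((2 ^+ k)^-1 < `|L x t w - L y r w|)%R] <=
   (C / (2 ^+ k) ^+ n)%:E)%E.
Proof.
pose C := 5 * expR M * (n`!%:R * 4 ^+ n).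
exists C; first by rewrite !mulr_ge0 ?expR_ge0 ?exprn_ge0.
have sorted k x y t r : 0 <= r -> r <= t ->
  `|x - y| <= (16 ^+ k)^-1 -> t - r <= (16 ^+ k)^-1 ->
  (P [set w | ((2 ^+ k)^-1 < `|L x t w - L y r w|)%R] <=
   (C / (2 ^+ k) ^+ n)%:E)%E.
  move=> r0 rt xy tr.
  have mE u v u' v' : measurable [set w | (2 ^+ k)^-1 / 2 < `|L u v w - L u' v' w|].
    exact: measurable_norm_gt.
  apply: (@le_trans _ _ (P ([set w | ((2 ^+ k)^-1 / 2 < `|L x t w - L y t w|)%R] `|`
    [set w | ((2 ^+ k)^-1 / 2 < `|L y t w - L y r w|)%R]))%E).
    apply: le_measure; rewrite ?inE; [exact: measurable_norm_gt|exact: measurableU|].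
    move=> w /= h; have [h1|h1] := ltP ((2 ^+ k)^-1 / 2) `|L x t w - L y t w|.
      by left.
    right; have := ler_normD (L x t w - L y t w) (L y t w - L y r w).
    by rewrite addrA subrK; lra.
  apply: (le_trans (measureU2 _ (mE x t y t) (mE y t y r))).
  apply: (le_trans (leeD (local_time_space_increment (le_trans r0 rt) xy)
    (local_time_time_increment y r0 rt tr))).
  rewrite -EFinD lee_fin -mulrDl (_ : 2 + 3 = 5); last by lra.
  by rewrite mulrA /C -(mulrA (5 * expR M)) ler_wpM2l ?mulr_ge0 ?expR_ge0// expR_pow2_decay.
move=> k x y t r t0 r0 xy tr; have [rt|/ltW tr'] := leP r t.
  by apply: sorted => //; rewrite (le_trans _ tr)// ler_norm.
under eq_set => w do rewrite distrC.
apply: sorted => //; first by rewrite distrC.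
by rewrite (le_trans _ tr)// distrC ler_norm.
Qed.

End increment_tail.

(** * Kolmogorov continuity *)

Lemma limsup_set_geometric d (T : measurableType d) (R : realType)
    (P : probability T R) (c : R) (E : (set T)^nat) : 0 <= c ->
  (forall k, measurable (E k)) -> (forall k, (P (E k) <= (c / 2 ^+ k)%:E)%E) ->
  P (lim_sup_set E) = 0%E.
Proof.
move=> c0 mE PE; apply: lim_sup_set_cvg0 => //.
apply: (@le_lt_trans _ _ (c / (1 - 2^-1))%:E); last exact: ltry.
apply: lime_le; first exact: is_cvg_nneseries.
near=> n; apply: (@le_trans _ _ (\sum_(0 <= i < n) (c / 2 ^+ i)%:E)%E).
  by apply: lee_sum => i _; exact: PE.
have h2 : `|2^-1| < 1 :> R by rewrite ger0_norm ?invr_ge0// invf_lt1// ltr1n.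
rewrite sumEFin lee_fin; move: c0; rewrite le_eqVlt => /orP[/eqP<-|c0].
  by rewrite mul0r big1// => i _; rewrite mul0r.
have := @geometric_le_lim R n c 2^-1 (ltW c0) _ h2; rewrite invr_gt0 ltr0n => /(_ isT).
apply: le_trans; rewrite /series/= /geometric/=.
by rewrite le_eqVlt; apply/orP; left; apply/eqP; apply: eq_bigr => i _; rewrite exprVn.
Unshelve. all: by end_near. Qed.

Lemma not_limsup_set (T : Type) (E : (set T)^nat) (w : T) : ~ lim_sup_set E w ->
  exists K, forall k, (K <= k)%N -> ~ E k w.
Proof.
move=> /existsNP[K /not_implyP[_ h]]; exists K => k Kk Ek.
by apply: h; exists k.
Qed.

Lemma measurable_lim_sup_set d (T : measurableType d) (E : (set T)^nat) :
  (forall k, measurable (E k)) -> measurable (lim_sup_set E).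
Proof.
move=> mE; apply: bigcap_measurable => // n _.
by apply: bigcup_measurable => k _; exact: mE.
Qed.

Lemma probability_union_seq_le d (T : measurableType d) (R : realType)
    (P : probability T R) (I : eqType) (s : seq I) (A : I -> set T) (e : R) :
  (forall i, measurable (A i)) -> (forall i, i \in s -> (P (A i) <= e%:E)%E) ->
  measurable [set w | exists2 i, i \in s & A i w] /\
  (P [set w | exists2 i, i \in s & A i w] <= ((size s)%:R * e)%:E)%E.
Proof.
move=> mA; elim: s => [_|i s IH PA].
  rewrite (_ : [set w | _] = set0); last by apply/seteqP; split => w //= -[].
  by rewrite measure0 mul0r.
have [j js|mU PU] := IH; first by apply: PA; rewrite inE js orbT.
rewrite (_ : [set w | _] = A i `|` [set w | exists2 i, i \in s & A i w]).
  split; first exact: measurableU.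
  apply: (le_trans (measureU2 _ (mA i) mU)).
  rewrite [size _]/= -addn1 natrD mulrDl mul1r addrC EFinD leeD//.
  by apply: PA; rewrite inE eqxx.
apply/seteqP; split => w /=.
  by move=> [j]; rewrite inE => /orP[/eqP->|js] Aw; [left|right; exists j].
by move=> [Aw|[j js Aw]]; [exists i|exists j]; rewrite ?inE ?eqxx ?js ?orbT.
Qed.

(** [2 / 2 ^+ k] is the sum of the admissible increments from [k] on, so subtracting and adding it
    produces adjacent monotone sequences, which give the limit and the error bound together. *)
Lemma geometric_increments_cvg (R : realType) (u : R^nat) (k0 : nat) :
  (forall k, (k0 <= k)%N -> `|u k.+1 - u k| <= (2 ^+ k)^-1) ->
  cvgn u /\ forall k, (k0 <= k)%N -> `|limn u - u k| <= 2 / 2 ^+ k.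
Proof.
move=> du; pose e k : R := 2 / 2 ^+ k.
have eS k : e k.+1 = e k - (2 ^+ k)^-1.
  by rewrite /e exprS invfM mulrA divff// mul1r; lra.
pose v k : R := u (k + k0)%N - e (k + k0)%N.
pose z k : R := u (k + k0)%N + e (k + k0)%N.
have v_nd : {homo v : m n / (m <= n)%N >-> m <= n}.
  apply/nondecreasing_seqP => k; have := du _ (leq_addl k k0).
  rewrite /v addSn eS ler_norml; lra.
have z_ni : {homo z : m n / (m <= n)%N >-> n <= m}.
  apply/nonincreasing_seqP => k; have := du _ (leq_addl k k0).
  rewrite /z addSn eS ler_norml; lra.
have e0 : e k @[k --> \oo] --> 0.
  have h2 : `|2^-1| < 1 :> R by rewrite ger0_norm ?invr_ge0// invf_lt1// ltr1n.
  have := cvg_geometric (2 : R) h2; apply: cvg_trans; apply: near_eq_cvg.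
  by apply: nearW => k; rewrite /geometric/= exprVn.
have e0' : e (k + k0)%N @[k --> \oo] --> 0 by rewrite (cvg_shiftn k0 e).
have zv : (z - v) k @[k --> \oo] --> 0.
  have : e (k + k0)%N + e (k + k0)%N @[k --> \oo] --> (0 + 0 : R) by exact: cvgD.
  rewrite addr0; apply: cvg_trans; apply: near_eq_cvg; apply: nearW => k.
  by rewrite /z /v !fctE; lra.
have [lzv cv cz] := adjacent_seq v_nd z_ni zv.
have ul : u @ \oo --> limn v.
  rewrite -(cvg_shiftn k0 u).
  have : v k + e (k + k0)%N @[k --> \oo] --> limn v + 0 by exact: cvgD.
  rewrite addr0; apply: cvg_trans; apply: near_eq_cvg; apply: nearW => k.
  by rewrite /v /=; lra.
split; first by apply/cvg_ex; exists (limn v).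
move=> k k0k; rewrite (cvg_lim _ ul)//.
have := nondecreasing_cvgn_le v_nd cv (k - k0)%N.
have := nonincreasing_cvgn_ge z_ni cz (k - k0)%N.
by rewrite lzv /v /z subnK// ler_norml -/(e k); lra.
Qed.

(** * Grids of mesh 16^-k *)

Section dyadic_floor.
Context {R : realType}.

Definition floor16 (k : nat) (x : R) : R := (Num.floor (16 ^+ k * x))%:~R / 16 ^+ k.

(* The multiples of [16 ^- k.+1] in the interval [[- 2 ^+ k.+1, 2 ^+ k.+1]]. *)
Definition grid (k : nat) : seq R :=
  [seq ((i%:R - 32 ^+ k.+1) / 16 ^+ k.+1) | i <- iota 0 (2 * 32 ^ k.+1).+1].

Lemma size_grid_le k : (size (grid k))%:R <= 65 * 32 ^+ k :> R.
Proof.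
rewrite size_map size_iota -addn1 natrD natrM natrX exprS.
have : 1 <= 32 ^+ k :> R by rewrite exprn_ege1// ler1n.
lra.
Qed.

Lemma mem_grid k (m : int) : `|m%:~R| <= 32 ^+ k.+1 :> R ->
  m%:~R / 16 ^+ k.+1 \in grid k.
Proof.
move=> mk; set N := (32 ^ k.+1)%N.
have NE : 32 ^+ k.+1 = N%:~R :> R by rewrite /N -pmulrn natrX.
have : `|m| <= N by rewrite -(ler_int R) intr_norm -NE.
rewrite ler_norml => /andP[m1 m2].
have mN : 0 <= m + N by rewrite -lerBlDr sub0r.
apply/mapP; exists (absz (m + N)).
  by rewrite mem_iota leq0n add0n ltnS -lez_nat gez0_abs// mul2n -addnn PoszD lerD2r.
by congr (_ / _); rewrite NE [in RHS]pmulrn gez0_abs// intrD addrK.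
Qed.

Lemma floor16_itv k x : floor16 k x <= x <= floor16 k x + (16 ^+ k)^-1.
Proof.
have p : 0 < 16 ^+ k :> R by rewrite exprn_gt0.
have /andP[h1 /ltW h2] := floor_itv (16 ^+ k * x); rewrite intrD in h2.
rewrite /floor16 -{3}[_^-1]mul1r -mulrDl.
by rewrite ler_pdivrMr// ler_pdivlMr// (mulrC x) h1.
Qed.

Lemma floor16_dist k x : `|floor16 k x - x| <= (16 ^+ k)^-1.
Proof. by have := floor16_itv k x; rewrite ler_norml; lra. Qed.

Lemma floor16_near k x y : `|x - y| <= (16 ^+ k.+1)^-1 ->
  `|floor16 k.+1 x - floor16 k.+1 y| <= (16 ^+ k)^-1.
Proof.
have := floor16_dist k.+1 x; have := floor16_dist k.+1 y.
have : 0 < (16 ^+ k)^-1 :> R by rewrite invr_gt0 exprn_gt0.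
rewrite exprS invfM !ler_norml; lra.
Qed.

Lemma floor16S_dist k x : `|floor16 k.+1 x - floor16 k x| <= (16 ^+ k)^-1.
Proof.
have := floor16_itv k.+1 x; have := floor16_itv k x.
have : 0 < (16 ^+ k)^-1 :> R by rewrite invr_gt0 exprn_gt0.
rewrite exprS invfM ler_norml; lra.
Qed.

Lemma floor_norm_le (x M : R) : 1 <= M -> `|x| <= M -> `|(Num.floor x)%:~R| <= 2 * M.
Proof.
by move=> M1; have := floor_itv x; rewrite intrD !ler_norml; lra.
Qed.

Lemma floor16_grid k x : `|x| <= 2 ^+ k -> floor16 k x \in grid k.
Proof.
move=> xk; have p : 0 < 16 ^+ k :> R by rewrite exprn_gt0.
have -> : floor16 k x = (16 * Num.floor (16 ^+ k * x))%:~R / 16 ^+ k.+1.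
  by rewrite /floor16 intrM exprS invfM mulrACA divff// mul1r.
apply: mem_grid; rewrite intrM normrM.
have : `|16 ^+ k * x| <= 32 ^+ k.
  rewrite normrM (gtr0_norm p) (_ : 32 = 16 * 2); last by lra.
  by rewrite exprMn ler_wpM2l// ltW.
have M1 : 1 <= 32 ^+ k :> R by rewrite exprn_ege1// ler1n.
have -> : `|16%:~R| = 16 :> R by rewrite ger0_norm// ler0n.
by move=> /(floor_norm_le M1); rewrite exprS; lra.
Qed.

(** [grid k] has the mesh of level [k.+1], so it contains the approximations of both levels that
    chaining compares; its radius is doubled because rounding down may enlarge a number. *)
Lemma floor16S_grid k x : `|x| <= 2 ^+ k -> floor16 k.+1 x \in grid k.
Proof.
move=> xk; have p : 0 < 16 ^+ k.+1 :> R by rewrite exprn_gt0.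
apply: mem_grid; have : `|16 ^+ k.+1 * x| <= 16 * 32 ^+ k.
  rewrite normrM (gtr0_norm p) (_ : 32 = 16 * 2); last by lra.
  by rewrite exprMn mulrA -exprS ler_wpM2l// ltW.
have M1 : 1 <= 16 * 32 ^+ k :> R.
  by rewrite mulr_ege1 ?ler1n// exprn_ege1// ler1n.
by move=> /(floor_norm_le M1); rewrite (exprS 32 k); lra.
Qed.

End dyadic_floor.

Section chaining.
Context {R : realType} (z : R -> R -> R) (K : nat).
Hypothesis z_grid : forall k a b s t, (K <= k)%N ->
  a \in grid k -> b \in grid k -> s \in grid k -> t \in grid k ->
  `|a - b| <= (16 ^+ k)^-1 -> `|s - t| <= (16 ^+ k)^-1 ->
  `|z a s - z b t| <= (2 ^+ k)^-1.

Definition dyadic_value (k : nat) (x t : R) : R := z (floor16 k x) (floor16 k t).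

Let fine_level (M : R) : exists k0, (K <= k0)%N /\
  forall k, (k0 <= k)%N -> M <= 2 ^+ k.
Proof.
exists (maxn K (Num.truncn `|M|).+1); split; first exact: leq_maxl.
move=> k; rewrite geq_max => /andP[_ Mk]; apply: (le_trans (ler_norm M)).
apply: (le_trans (ltW (truncnS_gt _))); rewrite -natrX ler_nat.
by apply: (leq_trans Mk); apply: ltnW; exact: ltn_expl.
Qed.

Let dyadic_value_step k x t : (K <= k)%N -> `|x| <= 2 ^+ k -> `|t| <= 2 ^+ k ->
  `|dyadic_value k.+1 x t - dyadic_value k x t| <= (2 ^+ k)^-1.
Proof.
move=> Kk xk tk; apply: z_grid => //; rewrite ?floor16_grid ?floor16S_grid//.
- exact: floor16S_dist.
- exact: floor16S_dist.
Qed.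

Lemma dyadic_value_cvg x t : cvgn (fun k => dyadic_value k x t).
Proof.
have [k0 [Kk0 M]] := fine_level (Num.max `|x| `|t|).
apply: (geometric_increments_cvg (k0 := k0) _).1 => k k0k.
have := M _ k0k; rewrite ge_max => /andP[? ?].
by apply: dyadic_value_step => //; exact: leq_trans k0k.
Qed.

Lemma dyadic_limit_continuous :
  continuous (fun p : R * R => limn (fun k => dyadic_value k p.1 p.2)).
Proof.
move=> [x t]; set f := fun p : R * R => _.
have [k0 [Kk0 M]] := fine_level (Num.max (`|x| + 1) (`|t| + 1)).
have dist k y s : (k0 <= k)%N -> `|x - y| <= 1 -> `|t - s| <= 1 ->
    `|f (y, s) - dyadic_value k y s| <= 2 / 2 ^+ k.
  move=> k0k xy ts.
  apply: (geometric_increments_cvg (k0 := k0) (u := fun k => dyadic_value k y s) _).2 => // j k0j.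
  have := M _ k0j; rewrite ge_max => /andP[xj tj].
  apply: dyadic_value_step; first exact: leq_trans k0j.
    have := ler_normB x (x - y); rewrite opprB addrC subrK; lra.
  have := ler_normB t (t - s); rewrite opprB addrC subrK; lra.
(* Level [k.+1] values at the two points differ by at most [2 ^- k], and each is within
   [2 / 2 ^+ k.+1] of its limit: three times [2 ^- k], below [5 / 2 ^+ k]. *)
apply/cvgrPdist_le => eps eps0; have [k1 [_ M1]] := fine_level (5 / eps).
pose k := maxn k0 k1; have kk0 : (k0 <= k)%N by exact: leq_maxl.
have epsk : 5 / 2 ^+ k <= eps.
  rewrite ler_pdivrMr ?exprn_gt0// mulrC -ler_pdivrMr//.
  by apply: M1; exact: leq_maxr.
have Kk : (K <= k)%N by exact: leq_trans kk0.
have r0 : 0 < (16 ^+ k.+1)^-1 :> R by rewrite invr_gt0 exprn_gt0.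
have r1 : (16 ^+ k.+1)^-1 <= 1 :> R.
  by rewrite invf_le1 ?exprn_gt0// exprn_ege1// ler1n.
suff near_le y s : `|x - y| <= (16 ^+ k.+1)^-1 -> `|t - s| <= (16 ^+ k.+1)^-1 ->
    `|f (x, t) - f (y, s)| <= eps.
  have : nbhs ((x, t) : R * R) (ball ((x, t) : R * R) (16 ^+ k.+1)^-1).
    exact: nbhsx_ballx.
  apply: filterS => -[y s] [/= xy ts].
  by apply: near_le; rewrite ltW.
move=> xy ts.
have d1 : `|dyadic_value k.+1 x t - dyadic_value k.+1 y s| <= (2 ^+ k)^-1.
  have := M _ kk0; rewrite ge_max => /andP[xk tk].
  apply: z_grid => //; rewrite ?floor16_near// floor16S_grid//; try lra.
    have := ler_normB x (x - y); rewrite opprB addrC subrK; lra.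
  have := ler_normB t (t - s); rewrite opprB addrC subrK; lra.
have kS : (k0 <= k.+1)%N by exact: leqW.
have := dist _ x t kS; rewrite !subrr normr0 ler01 => /(_ isT isT) d2.
have d3 := dist _ y s kS (le_trans xy r1) (le_trans ts r1).
have eS : 2 / 2 ^+ k.+1 = (2 ^+ k)^-1 :> R.
  by rewrite exprS invfM mulrA divff// mul1r.
have : 0 <= (2 ^+ k)^-1 :> R by rewrite invr_ge0 exprn_ge0.
move: d1 d2 d3 epsk; rewrite eS !ler_norml; lra.
Qed.

End chaining.

(* The exponent 21: at level [k] there are O(2 ^ (20 k)) pairs of grid points. *)
Section continuous_modification.
Context d (T : measurableType d) (R : realType) (P : probability T R).
Variables (Z : R -> R -> {RV P >-> R}) (C : R).
Hypotheses (C0 : 0 <= C) (Z_tail : forall (k : nat) (x y t r : R),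
  `|x - y| <= (16 ^+ k)^-1 -> `|t - r| <= (16 ^+ k)^-1 ->
  (P [set w | ((2 ^+ k)^-1 < `|Z x t w - Z y r w|)%R] <=
   (C / (2 ^+ k) ^+ 21)%:E)%E).

Let close_pairs (k : nat) : seq ((R * R) * (R * R)) :=
  let pts := [seq (a, s) | a <- grid k, s <- grid k] in
  [seq q <- [seq (p, p') | p <- pts, p' <- pts] |
    (`|q.1.1 - q.2.1| <= (16 ^+ k)^-1) && (`|q.1.2 - q.2.2| <= (16 ^+ k)^-1)].

Let bad k : set T := [set w | exists2 q, q \in close_pairs k &
  (2 ^+ k)^-1 < `|Z q.1.1 q.1.2 w - Z q.2.1 q.2.2 w|].

Let measurable_far (k : nat) x t y r :
  measurable [set w | (2 ^+ k)^-1 < `|Z x t w - Z y r w|].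
Proof. by apply: measurable_norm_gt; exact: measurable_funB. Qed.

Let size_close_pairs k : (size (close_pairs k))%:R <= (65 * 32 ^+ k) ^+ 4 :> R.
Proof.
apply: (@le_trans _ _ ((size (grid k : seq R))%:R ^+ 4)).
  rewrite -natrX ler_nat /close_pairs size_filter (leq_trans (count_size _ _))//.
  by rewrite !size_allpairs (expnM _ 2 2) -!mulnn.
by rewrite lerXn2r ?nnegrE// ?mulr_ge0 ?exprn_ge0// size_grid_le.
Qed.

Let bad_prob k : measurable (bad k) /\ (P (bad k) <= (65 ^+ 4 * C / 2 ^+ k)%:E)%E.
Proof.
have [||mb Pb] := @probability_union_seq_le _ _ _ P _ (close_pairs k)
  (fun q => [set w | (2 ^+ k)^-1 < `|Z q.1.1 q.1.2 w - Z q.2.1 q.2.2 w|])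
  (C / (2 ^+ k) ^+ 21).
- by move=> q; exact: measurable_far.
- by move=> q; rewrite mem_filter => /andP[/andP[h1 h2] _]; exact: Z_tail.
split=> //; apply: (le_trans Pb); rewrite lee_fin.
have p2 : 2 ^+ k != 0 :> R by rewrite expf_neq0.
have e32 : 32 ^+ k = (2 ^+ k) ^+ 5 :> R.
  by rewrite -exprM mulnC exprM; congr (_ ^+ k); lra.
apply: (le_trans (ler_wpM2r _ (size_close_pairs k))).
  by rewrite divr_ge0// !exprn_ge0.
rewrite e32; move: (2 ^+ k) p2 (65 : R) => y y0 u.
by rewrite le_eqVlt; apply/orP; left; apply/eqP; field.
Qed.

Let good : set T := ~` lim_sup_set bad.

Let measurable_good : measurable good.
Proof. by apply: measurableC; apply: measurable_lim_sup_set => k; exact: (bad_prob k).1. Qed.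

Let bad_null : P (lim_sup_set bad) = 0%E.
Proof.
apply: (limsup_set_geometric (c := 65 ^+ 4 * C)).
- by rewrite mulr_ge0// exprn_ge0.
- by move=> k; exact: (bad_prob k).1.
- by move=> k; exact: (bad_prob k).2.
Qed.

Let good_grid w : good w -> exists K, forall k a b s t, (K <= k)%N ->
  a \in grid k -> b \in grid k -> s \in grid k -> t \in grid k ->
  `|a - b| <= (16 ^+ k)^-1 -> `|s - t| <= (16 ^+ k)^-1 ->
  `|Z a s w - Z b t w| <= (2 ^+ k)^-1.
Proof.
move=> gw; have [K badK] := not_limsup_set gw; exists K => k a b s t Kk ak bk sk tk ab st.
rewrite leNgt; apply/negP => far; apply: (badK k Kk).
exists ((a, s), (b, t)) => //; rewrite mem_filter.
apply/andP; split; first by rewrite /= ab st.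
by apply: allpairs_f; apply: allpairs_f.
Qed.

(** The indicator makes the limit exist at every [w], so the modification is measurable and
    continuous everywhere, being 0 off [good]. *)
Let approx x t (k : nat) (w : T) : R :=
  Z (floor16 k x) (floor16 k t) w * \1_good w.

Let lim_approx x t w := limn (fun k => approx x t k w).

Let approx_bad x t w : ~ good w -> forall k, approx x t k w = 0.
Proof. by move=> gw k; rewrite /approx indicE memNset// mulr0. Qed.

Let approx_good x t w : good w -> forall k,
  approx x t k w = dyadic_value (fun a s => Z a s w) k x t.
Proof. by move=> gw k; rewrite /approx indicE mem_set// mulr1. Qed.

Let approx_cvg x t w : approx x t k w @[k --> \oo] --> lim_approx x t w.
Proof.
rewrite /lim_approx; have [gw|gw] := pselect (good w).
  have [K gK] := good_grid gw.
  have := @dyadic_value_cvg _ _ _ gK x t.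
  by rewrite (_ : (fun k => dyadic_value _ _ _ _) = fun k => approx x t k w)//;
    apply/funext => k; rewrite approx_good.
rewrite (_ : (fun k => _) = fun=> 0); last by apply/funext => k; rewrite approx_bad.
by rewrite lim_cst//; exact: cvg_cst.
Qed.

Let measurable_lim_approx x t : measurable_fun setT (lim_approx x t).
Proof.
apply: (@measurable_fun_cvg _ _ _ _ (fun k => approx x t k)).
  move=> k; apply: measurable_funM => //; exact: measurable_indic.
by move=> w _; exact: approx_cvg.
Qed.

Lemma continuous_modification : exists Z' : R -> R -> {RV P >-> R},
  (forall x t : R, {ae P, forall w, Z' x t w = Z x t w}) /\
  (forall w : T, continuous (fun p : R * R => Z' p.1 p.2 w)).
Proof.
exists (fun x t => mfun_Sub (mem_set (measurable_lim_approx x t))).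
split => [x t|w]; last first.
  have [gw|gw] := pselect (good w).
    have [K gK] := good_grid gw.
    rewrite [X in continuous X](_ : _ = fun p : R * R =>
      limn (fun k => dyadic_value (fun a s => Z a s w) k p.1 p.2)).
      exact: dyadic_limit_continuous gK.
    apply/funext => -[x t]; rewrite /= /lim_approx.
    by congr (limn _); apply/funext => k; rewrite approx_good.
  rewrite [X in continuous X](_ : _ = cst 0); first exact: cst_continuous.
  apply/funext => -[x t]; rewrite /= /lim_approx.
  rewrite (_ : (fun k => _) = cst 0) ?lim_cst//.
  by apply/funext => k; rewrite approx_bad.
(* On [good] the dyadic values converge, but their limit is not yet identified: a second
   Borel-Cantelli argument compares them with [Z x t], with an exceptional set that depends on [x]
   and [t]. *)
pose far k := [set w | (2 ^+ k)^-1 < `|Z (floor16 k x) (floor16 k t) w - Z x t w|].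
have far_null : P (lim_sup_set far) = 0%E.
  apply: (limsup_set_geometric C0) => k; first exact: measurable_far.
  apply: (le_trans (Z_tail (floor16_dist k x) (floor16_dist k t))).
  rewrite lee_fin ler_wpM2l// lef_pV2 ?posrE ?exprn_gt0//.
  by rewrite exprS ler_peMr ?exprn_ege1 ?ler1n ?exprn_ge0.
exists (lim_sup_set bad `|` lim_sup_set far); split.
- apply: measurableU; apply: measurable_lim_sup_set => k; last exact: measurable_far.
  exact: (bad_prob k).1.
- apply/eqP; rewrite eq_le measure_ge0 andbT.
  have mb : measurable (lim_sup_set bad).
    by apply: measurable_lim_sup_set => k; exact: (bad_prob k).1.
  have mf : measurable (lim_sup_set far).
    by apply: measurable_lim_sup_set => k; exact: measurable_far.
  have h : (P (lim_sup_set bad `|` lim_sup_set far) <=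
    P (lim_sup_set bad) + P (lim_sup_set far))%E by exact: measureU2.
  by rewrite (le_trans h)// bad_null far_null adde0.
apply: subsetCl => w /not_orP[gw fw] /=; rewrite /lim_approx.
have [K farK] := not_limsup_set fw.
have Zx : dyadic_value (fun a s => Z a s w) k x t @[k --> \oo] --> Z x t w.
  apply/cvgrPdist_le => eps eps0.
  have h2 : `|2^-1| < 1 :> R by rewrite ger0_norm ?invr_ge0// invf_lt1// ltr1n.
  have /cvgrPdist_le/(_ _ eps0) := cvg_expr h2; apply: filterS2 (nbhs_infty_ge K).
  move=> k Kk; rewrite sub0r normrN exprVn ger0_norm ?invr_ge0 ?exprn_ge0//.
  apply: le_trans; rewrite distrC leNgt; apply/negP; exact: farK.
apply/cvg_lim => //; apply: cvg_trans Zx; apply: near_eq_cvg.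
by apply: nearW => k; rewrite approx_good.
Qed.

End continuous_modification.

Theorem theorem3p6 (R : realType) (d : measure_display) (T : measurableType d)
    (P : probability T R) (sigma beta1 beta2 : R)
    (B : R -> {RV P >-> R}) (X L : R -> R -> {RV P >-> R})
    (sigma_gt0 : 0 < sigma)
    (beta1_gt0 : 0 < beta1) (beta2_gt0 : 0 < beta2)
    (beta12_gt0 : 0 < beta1 - beta2)
    (BM : two_sided_brownian_motion sigma B)
    (solX : forall x : R, {ae P, forall w,
      lipschitz_solution beta1 beta2 (fun t => B t w) x (fun t => X x t w)})
    (locL : forall x t : R, 0 <= t -> {ae P, forall w,
      is_local_time sigma (fun s => B s w - X x s w) t (L x t w)}) :
  exists L' : R -> R -> {RV P >-> R},
    (forall x t : R, 0 <= t -> {ae P, forall w, L' x t w = L x t w}) /\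
    (forall w : T, {within [set xt : R * R | 0 <= xt.2],
      continuous (fun xt : R * R => L' xt.1 xt.2 w)}).
Proof.
have b21 : beta2 < beta1 by rewrite -subr_gt0.
have [C C0 tail] := local_time_increment_tail sigma_gt0 beta2_gt0 b21 BM solX locL 21.
(* Extending by [Num.max t 0], which is 1-Lipschitz, carries the tail bound to the whole plane,
   where the continuity criterion is stated. *)
have max0 (t : R) : 0 <= Num.max t 0 by rewrite le_max lexx orbT.
have max_dist (t r : R) : `|Num.max t 0 - Num.max r 0| <= `|t - r|.
  rewrite /Num.max; case: ltP => ht; case: ltP => hr; rewrite ?subrr ?normr0//.
  - by rewrite sub0r normrN distrC !ger0_norm//; lra.
  - by rewrite subr0 !ger0_norm//; lra.
have [|L' [L'L cL']] := @continuous_modification _ _ _ P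
  (fun x t => L x (Num.max t 0)) C C0.
  move=> k x y t r xy tr; apply: tail => //.
  exact: le_trans (max_dist t r) tr.
exists L'; split => [x t t0|w].
  by have := L'L x t; rewrite (max_idPl t0).
exact: continuous_subspaceT.
Qed.
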